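(* Fix $\sigma_-<0<\sigma_+$, put $\kappa:=\sigma_+/\sigma_-<0$, and fix mesh ratios $r>0$, $r_y>0$. For $M\in\mathbb N$ let $h_y=\pi/M$, $h_-=h_y/r_y$, $h_+=r h_-$, and let $\mathcal A_{h_\pm,h_y}$ be the discrete operator on $V_{h_\pm}\otimes W_{h_y}$ defined in the context. (i) If either ($|\kappa|<1$ and $r^2\kappa^2<1+r_y^2(1-\kappa^2)$) or ($|\kappa|>1$ and $r^2\kappa^2>1+r_y^2(1-\kappa^2)$), then $\mathcal A_{h_\pm,h_y}^{-1}$ exists and satisfies $$\|\mathcal A_{h_\pm,h_y}^{-1}\|\le \frac{1}{|\sigma_-|\min\left\{1,|\kappa|,\left|\frac{1+\kappa}{2}\right|,\left|\frac{\sqrt{1+r_y^2}+\kappa\sqrt{r^2+r_y^2}}{\sqrt{1+r_y^2}+\sqrt{r^2+r_y^2}}\right|\right\}}.$$ (ii) Contrary, if either ($|\kappa|<1$ and $r^2\kappa^2>1+r_y^2(1-\kappa^2)$) or ($|\kappa|>1$ and $r^2\kappa^2<1+r_y^2(1-\kappa^2)$), then $$\lim_{h_-\to0}\|\mathcal A_{h_\pm,h_y}^{-1}\|=+\infty,$$ and in particular, with $$s_{\kappa,r,r_y}:=\arccos\left(1+\frac{6r_y^2(1-\kappa^2)}{(1-\kappa^2r^2)-2r_y^2(1-\kappa^2)}\right),$$ the operator $\mathcal A_{h_\pm,h_y}$ admits a nontrivial kernel for each $$h_-=\frac1m\,\frac1{r_y}\,s_{\kappa,r,r_y},\qquad m\in\mathbb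 N$$ (for which $h_y=r_yh_-$ is an admissible mesh size, i.e. $\pi/h_y\in\mathbb N$). Note that to simultaneously satisfy $\pi/h_y\in\mathbb N$ we can choose a particular $r_y$ or $r$ such that $s_{\kappa,r,r_y}=\pi l/k$, $l,k\in\mathbb N$, which yields that $\pi/h_y\in\mathbb N$ for $m\in k\mathbb N$.
   Context: $\mathbb N=\{1,2,\dots\}$; all spaces are real. $\Omega=(-\infty,\infty)\times(0,\pi)$, $\Omega_-=(-\infty,0)\times(0,\pi)$, $\Omega_+=(0,\infty)\times(0,\pi)$. The coefficient $\sigma$ equals the constant $\sigma_-<0$ on $\Omega_-$ and the constant $\sigma_+>0$ on $\Omega_+$. $H^1_0(\Omega)$ and its subspaces carry the scalar product $\langle u,v\rangle_{H^1_0(\Omega)}=\int_\Omega\nabla u\cdot\nabla v$ (equivalent to the usual $H^1$ scalar product). Put $a_\Omega(u,v)=\int_\Omega\sigma\nabla u\cdot\nabla v$. Discrete spaces: $W_{h_y}$ is the space of $w\in H^1_0(0,\pi)$ that are affine on each interval $(h_ym,h_y(m+1))$, $m=0,\dots,M-1$, where $h_y=\pi/M$. With $x_n=h_+n$ for $n\ge0$ and $x_n=h_-n$ for $n<0$, $V_{h_\pm}$ is the space of $v\in H^1(\mathbb R)$ that are affine on each $(x_n,x_{n+1})$, $n\in\mathbb Z$ (one space depending on both $h_+$ and $h_-$). $V_{h_\pm}\otimes W_{h_y}\subset H^1_0(\Omega)$ is the tensor product space, spanned by the functions $(x,y)\mapsto v(x)w(y)$, $v\in V_{h_\pm}$, $w\in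 W_{h_y}$. The bounded operator $\mathcal A_{h_\pm,h_y}$ on $V_{h_\pm}\otimes W_{h_y}$ is defined by $\langle\mathcal A_{h_\pm,h_y}u,v\rangle_{H^1_0(\Omega)}=a_\Omega(u,v)$ for all $u,v\in V_{h_\pm}\otimes W_{h_y}$. $\|\cdot\|$ is the operator norm on $V_{h_\pm}\otimes W_{h_y}$, and $\|\mathcal A_{h_\pm,h_y}^{-1}\|:=+\infty$ if the inverse does not exist. The ratios are $r=h_+/h_-$, $r_y=h_y/h_-$; they are held fixed in the limit $h_-\to0$, which runs along $h_-=\pi/(r_yM)$, $M\to\infty$.
   Formalization: In the final Note, ''s=πl/k yields π/h_y∈ℕ for m∈kℕ'' is false in general (l=2, k=3, m=3 gives 9/2); it is proved for m∈lℕ, while the version with m∈kℕ is proved only for some suitably chosen r_y or r and l, k. *)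

(* Defs.v *)
From mathcomp Require Import all_boot all_order all_algebra.
From mathcomp Require Import all_classical all_reals all_analysis.

Set Implicit Arguments.
Unset Strict Implicit.
Unset Printing Implicit Defensive.

Import Order.TTheory GRing.Theory Num.Theory.
Import numFieldNormedType.Exports.

Local Open Scope classical_set_scope.
Local Open Scope ring_scope.

Section Sobolev1D.
Variable R : realType.
Implicit Types (I : set R) (f g phi : R -> R).

Definition leb1 : {measure set (measurableTypeR R) -> \bar R} :=
  @lebesgue_measure R.

Definition sq_integrable I f : Prop :=
  measurable_fun I (f : measurableTypeR R -> measurableTypeR R) /\
  leb1.-integrable I (fun x => (f x ^+ 2)%:E).

Definition test_function I phi : Prop :=
  (forall n x, derivable (derive1n n phi) x 1) /\
  exists K : set R, [/\ compact K, K `<=` I & forall x, ~ K x -> phi x = 0].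

Definition weak_derivative I f g : Prop :=
  forall phi, test_function I phi ->
    \int[leb1]_(x in I) (f x * derive1 phi x) =
    - \int[leb1]_(x in I) (g x * phi x).

(* H^1(I); by the one-dimensional Sobolev embedding each class has exactly one
   continuous representative, and the function is required to be that one, so
   that point values make sense. *)
Definition H1 I : set (R -> R) :=
  [set f | [/\ {within closure I, continuous f}, sq_integrable I f &
     exists g, sq_integrable I g /\ weak_derivative I f g]].

(* H^1_0(a, b): functions of H^1(a, b) with zero trace.  They are extended by
   zero to the whole line, so that equality of functions on R is equality
   in H^1_0(a, b). *)
Definition H10 (a b : R) : set (R -> R) :=
  [set f | H1 `]a, b[ f /\ forall x, ~ (a < x < b) -> f x = 0].

Definition affine_on I f : Prop :=
  exists c d : R, forall x, I x -> f x = c * x + d.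

End Sobolev1D.

Section DiscreteSpaces.
Variable R : realType.

Definition hy (M : nat) : R := pi / M%:R.
Definition hminus (ry : R) (M : nat) : R := hy M / ry.
Definition hplus (r ry : R) (M : nat) : R := r * hminus ry M.

Definition Wspace (M : nat) : set (R -> R) :=
  [set w | H10 0 pi w /\
    forall m : nat, (m < M)%N -> affine_on `]hy M * m%:R, hy M * m.+1%:R[ w].

Definition node (hm hp : R) (n : int) : R :=
  if 0 <= n then hp * n%:~R else hm * n%:~R.

Definition Vspace (hm hp : R) : set (R -> R) :=
  [set v | H1 [set: R] v /\
    forall n : int, affine_on `]node hm hp n, node hm hp (n + 1)[ v].

Definition tensor_space (V W : set (R -> R)) : set (R * R -> R) :=
  [set u | exists (k : nat) (v w : 'I_k -> R -> R),
    [/\ forall i, V (v i), forall i, W (w i) &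
        u = fun p => \sum_(i < k) v i p.1 * w i p.2]].

Definition discrete_space (r ry : R) (M : nat) : set (R * R -> R) :=
  tensor_space (Vspace (hminus ry M) (hplus r ry M)) (Wspace M).

End DiscreteSpaces.

Section Forms.
Variable R : realType.
Implicit Types (u v w : R * R -> R) (p : R * R).

Definition leb2 :
    {measure set (measurableTypeR R * measurableTypeR R)%type -> \bar R} :=
  (@lebesgue_measure R \x @lebesgue_measure R)%E.

Definition Omega : set (R * R) := [set p | 0 < p.2 < pi].

(* Members of the discrete spaces are piecewise bilinear and continuous, so off
   the (null) grid lines the classical partial derivatives exist, and they
   represent the weak gradient. *)
Definition dx u p : R := derive1 (fun x => u (x, p.2)) p.1.
Definition dy u p : R := derive1 (fun y => u (p.1, y)) p.2.
Definition grad_dot u v p : R := dx u p * dx v p + dy u p * dy v p.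

Definition inner u v : R := \int[leb2]_(p in Omega) grad_dot u v p.
Definition H10norm u : R := Num.sqrt (inner u u).

(* The value on the null set {x = 0} is irrelevant. *)
Definition sigma (sm sp : R) p : R := if p.1 < 0 then sm else sp.

Definition aform (sm sp : R) u v : R :=
  \int[leb2]_(p in Omega) (sigma sm sp p * grad_dot u v p).

Implicit Types (S : set (R * R -> R)) (A : (R * R -> R) -> (R * R -> R)).

(* The operator on S with inner (A u) v = a(u, v) for all u, v in S: A u is
   the Riesz representer of a(u, .) in the Hilbert space S. *)
Definition riesz_op (sm sp : R) S u : R * R -> R :=
  xget (fun=> 0)
    [set w | S w /\ forall v, S v -> inner w v = aform sm sp u v].

Definition invertible_on S A : Prop := set_bij S S A.

Definition inverse_on S A : (R * R -> R) -> (R * R -> R) :=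
  'pinv_(fun=> (fun=> 0)) S A.

Definition opnorm S A : \bar R :=
  ereal_sup [set (H10norm (A u))%:E | u in [set u | S u /\ H10norm u <= 1]].

Definition norm_inverse S A : \bar R :=
  if `[< invertible_on S A >] then opnorm S (inverse_on S A) else +oo%E.

Definition nontrivial_kernel S A : Prop :=
  exists u, [/\ S u, u <> (fun=> 0) & A u = (fun=> 0)].

Definition discrete_op (sm sp r ry : R) (M : nat) :=
  riesz_op sm sp (discrete_space r ry M).

End Forms.

Section Ratios.
Variable R : realType.
Implicit Types kappa r ry : R.

Definition stable_ratios kappa r ry : Prop :=
  (`|kappa| < 1 /\ r ^+ 2 * kappa ^+ 2 < 1 + ry ^+ 2 * (1 - kappa ^+ 2)) \/
  (`|kappa| > 1 /\ r ^+ 2 * kappa ^+ 2 > 1 + ry ^+ 2 * (1 - kappa ^+ 2)).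

Definition unstable_ratios kappa r ry : Prop :=
  (`|kappa| < 1 /\ r ^+ 2 * kappa ^+ 2 > 1 + ry ^+ 2 * (1 - kappa ^+ 2)) \/
  (`|kappa| > 1 /\ r ^+ 2 * kappa ^+ 2 < 1 + ry ^+ 2 * (1 - kappa ^+ 2)).

Definition stability_constant kappa r ry : R :=
  Num.min 1 (Num.min `|kappa| (Num.min `|(1 + kappa) / 2|
    `|(Num.sqrt (1 + ry ^+ 2) + kappa * Num.sqrt (r ^+ 2 + ry ^+ 2)) /
      (Num.sqrt (1 + ry ^+ 2) + Num.sqrt (r ^+ 2 + ry ^+ 2))|)).

Definition s_angle kappa r ry : R :=
  acos (1 + 6 * ry ^+ 2 * (1 - kappa ^+ 2) /
        ((1 - kappa ^+ 2 * r ^+ 2) - 2 * ry ^+ 2 * (1 - kappa ^+ 2))).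

Definition hminus_kernel kappa r ry (m : nat) : R :=
  m%:R^-1 * ry^-1 * s_angle kappa r ry.

Definition admissible_hy (h : R) : Prop :=
  exists M : nat, (0 < M)%N /\ pi / h = M%:R.

End Ratios.

(* Main.v *)
(* On each half-line, a discrete function splits into its value at the interface
   times a decaying discrete-harmonic mode, plus a part that vanishes at the
   interface; the splitting is orthogonal for the energy of (- D^2 + lam).  After
   an expansion in the discrete sine basis in y, the form a_Omega is therefore
   diagonal: the operator multiplies the left part by sm, the right part by sp,
   and the k-th trace mode by
     (sm E_- + sp E_+) / (E_- + E_+),  E_{+,-} = sqrt lam sqrt (1 + lam h^2 / 12),
   where lam = mu / h_y^2 and mu = 6 (1 - cos t) / (2 + cos t), t = k pi / M, runs
   through a subset of (0, 12).  That multiplier is monotone in mu; its limits at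
   mu = 0 and mu = 12 are the last two entries of the stability constant.  They
   have the same sign in the stable case, and opposite signs in the unstable case,
   where the zero sits at the angle t = s and the multipliers of the modes with
   t close to s tend to 0. *)

Require Import Defs.
From mathcomp Require Import all_boot all_order all_algebra.
From mathcomp Require Import all_classical all_reals all_analysis.
From mathcomp Require Import measurable_realfun ring lra.
Import Order.TTheory GRing.Theory Num.Theory.
Import numFieldNormedType.Exports.

Set Implicit Arguments.
Unset Strict Implicit.
Unset Printing Implicit Defensive.

Local Open Scope classical_set_scope.
Local Open Scope ring_scope.

(** * Integrals with prescribed values *)

(** The space in [x] is infinite-dimensional, so no matrix is diagonalised there; energies on a
    half-line are summed by parts in closed form. With [a = -1/h + lam h/6] and [b = 1/h + lam h/3],
    a geometric discrete-harmonic sequence of ratio [q] satisfies [a + 2 b q + a q^2 = 0]. Its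
    decaying root leaves the boundary flux [b + a q = sqrt (b^2 - a^2)], and
    [b^2 - a^2 = lam (1 + lam h^2 / 12)]: this is [E]. On functions vanishing at the interface the
    form acts side by side; only the product of the two interface values couples the sides, and
    matching it fixes the trace multiplier. Operators with three multipliers compose entrywise, so
    the inverse carries the reciprocals, while evaluation at the interface isolates the trace
    multiplier and gives the lower bound. With [xi = mu / (12 ry^2)] the trace multiplier depends
    only on [(1 + r^2 xi) / (1 + xi)]. It vanishes where [1 + xi = kappa^2 (1 + r^2 xi)], that is
    [xi = - (1 - kappa^2) / (1 - kappa^2 r^2)]; solving for [cos t] yields the angle [s]. The forms
    are integrals of classical derivatives over an unbounded strip, hence the preparation on
    integrability, exhaustion and null sets. *)

Section HasIntegral.
Context d (T : measurableType d) (R : realType).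
Variable mu : {measure set T -> \bar R}.
Implicit Types (D A B N : set T) (f g : T -> R) (I J c : R).

(** [Rintegral] takes a value for every integrand, and its linearity holds only under integrability.
    Carrying integrability along with the value lets integrals be computed by composition. *)
Definition has_integral D f I : Prop :=
  mu.-integrable D (EFin \o f) /\ \int[mu]_(x in D) f x = I.

Lemma has_integralE D f I : has_integral D f I -> \int[mu]_(x in D) f x = I.
Proof. by case. Qed.

Lemma integrable_has_integral D f :
  mu.-integrable D (EFin \o f) -> has_integral D f (\int[mu]_(x in D) f x).
Proof. by []. Qed.

Lemma eq_has_integral D f g I : measurable D ->
  (forall x, D x -> f x = g x) -> has_integral D f I -> has_integral D g I.
Proof.
move=> mD fg [intf <-]; split.
  by apply: eq_integrable intf => // x /set_mem Dx /=; rewrite fg.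
by apply: eq_Rintegral => x /set_mem Dx; rewrite fg.
Qed.

Lemma has_integralD D f g I J : measurable D ->
  has_integral D f I -> has_integral D g J ->
  has_integral D (fun x => f x + g x) (I + J).
Proof.
move=> mD [intf <-] [intg <-]; split; first exact: (integrableD mD intf intg).
exact: RintegralD.
Qed.

Lemma has_integralZ D f I c : measurable D ->
  has_integral D f I -> has_integral D (fun x => c * f x) (c * I).
Proof.
move=> mD [intf <-]; split; first exact: (@integrableZl _ _ _ _ D mD c _ intf).
exact: RintegralZl.
Qed.

Lemma has_integral0 D : has_integral D (fun=> 0) 0.
Proof.
split; first exact: integrable0.
by rewrite /Rintegral integral0.
Qed.

Lemma has_integral_sum D k (f : 'I_k -> T -> R) (I : 'I_k -> R) :
  measurable D -> (forall i, has_integral D (f i) (I i)) ->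
  has_integral D (fun x => \sum_(i < k) f i x) (\sum_(i < k) I i).
Proof.
move=> mD; elim: k f I => [|k IHk] f I hf.
  rewrite big_ord0; apply: (eq_has_integral mD _ (has_integral0 D)) => x _.
  by rewrite big_ord0.
rewrite big_ord_recr /=.
apply: (eq_has_integral mD _ (has_integralD mD (IHk _ _ (fun i => hf _)) (hf ord_max))).
by move=> x _; rewrite big_ord_recr.
Qed.

Lemma has_integralU A B f I J : measurable A -> measurable B ->
  [disjoint A & B] -> has_integral A f I -> has_integral B f J ->
  has_integral (A `|` B) f (I + J).
Proof.
move=> mA mB dAB [intA <-] [intB <-].
have mf : measurable_fun (A `|` B) f.
  by apply/measurable_funU => //; split; apply/measurable_EFinP;
    [exact: (measurable_int mu intA)|exact: (measurable_int mu intB)].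
have intU : mu.-integrable (A `|` B) (EFin \o f).
  apply/integrableP; split; first exact/measurable_EFinP.
  rewrite ge0_integral_setU//=; last first.
    by apply/measurable_EFinP; exact: measurableT_comp.
  by apply: lte_add_pinfty; [case/integrableP: intA|case/integrableP: intB].
by split=> //; rewrite Rintegral_setU.
Qed.

(** Domination by [f ^+ 2 + g ^+ 2], which bounds the product because the squares of [f - g] and
    [f + g] are nonnegative. *)
Lemma integrable_mulL2 D f g : measurable D ->
  measurable_fun D f -> measurable_fun D g ->
  mu.-integrable D (fun x => (f x ^+ 2)%:E) ->
  mu.-integrable D (fun x => (g x ^+ 2)%:E) ->
  mu.-integrable D (EFin \o (fun x => f x * g x)).
Proof.
move=> mD mf mg intf intg.
have intfg := integrableD mD intf intg.
apply: (le_integrable mD _ _ intfg).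
  by apply/measurable_EFinP; exact: measurable_funM.
move=> x _ /=; rewrite lee_fin.
rewrite [leRHS]ger0_norm ?addr_ge0 ?sqr_ge0//.
have := sqr_ge0 (f x - g x); have := sqr_ge0 (f x + g x).
by rewrite ler_norml sqrrB sqrrD => ? ?; apply/andP; split; nra.
Qed.

End HasIntegral.

(** * Exhaustion by increasing sets, and changes on null sets *)

Section ExhaustionAndNullSets.
Context d (T : measurableType d) (R : realType).
Variable mu : {measure set T -> \bar R}.
Implicit Types (D N : set T) (f g : T -> R) (I J c : R) (F : (set T)^nat).

(** Monotone convergence. It turns uniform bounds on finite sums over mesh cells into integrability
    on a whole half-line. *)
Lemma integrable_bigcup_bounded F f I c :
  nondecreasing_seq F -> (forall n, measurable (F n)) ->
  (forall n x, F n x -> 0 <= f x) ->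
  (forall n, mu.-integrable (F n) (EFin \o f)) ->
  (forall n, \int[mu]_(x in F n) f x <= c) ->
  mu.-integrable (\bigcup_n F n) (EFin \o f).
Proof.
move=> ndF mF f0 intf le_c.
have mf n : measurable_fun (F n) (EFin \o f) by exact: measurable_int (intf n).
apply/integrableP; split.
  by apply/measurable_fun_bigcup.
rewrite (eq_integral (EFin \o f)); last first.
  by move=> x /set_mem [n _ Fnx] /=; rewrite ger0_norm ?(f0 n).
have f0' n x : F n x -> (0 <= (EFin \o f) x)%E by move=> /f0; rewrite lee_fin.
have cv := @ge0_nondecreasing_set_cvg_integral _ _ _ F (EFin \o f) mu ndF mF mf f0'.
apply: (@le_lt_trans _ _ c%:E); last exact: ltry.
rewrite -(cvg_lim _ cv)//; apply: lime_le; first by apply/cvg_ex; eexists; exact: cv.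
apply: nearW => n; rewrite -(fineK (integrable_fin_num (mF n) (intf n))) lee_fin.
exact: le_c.
Qed.

(** Dominated convergence for the restrictions of [f] to [F n], with [|f|] as majorant, so that
    integrands of varying sign are covered. *)
Lemma cvg_Rintegral_bigcup F f :
  nondecreasing_seq F -> (forall n, measurable (F n)) ->
  mu.-integrable (\bigcup_n F n) (EFin \o f) ->
  \int[mu]_(x in F n) f x @[n --> \oo] --> \int[mu]_(x in \bigcup_n F n) f x.
Proof.
move=> ndF mF intf; set D := \bigcup_n F n.
have mD : measurable D by exact: bigcupT_measurable.
have FD n : F n `<=` D by move=> x Fx; exists n.
have mf : measurable_fun D (EFin \o f) := measurable_int mu intf.
have [//|||||_ _ cv] := @dominated_convergence _ _ _ mu D mD
    (fun n => (EFin \o f) \_ (F n)) (EFin \o f) (abse \o (EFin \o f)).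
- move=> n; apply/measurable_restrict => //; rewrite setIidr//.
  exact: measurable_funS mf.
- exact: mf.
- apply: aeW => x [m _ Fmx]; apply: cvg_near_cst; exists m => // n /= mn.
  rewrite patchE mem_set//.
  by have /subsetPset := ndF _ _ mn; exact.
- exact: integrable_abse.
- apply: aeW => x n Dx; rewrite patchE; case: ifPn => //= _.
  by rewrite normr0 lee_fin normr_ge0.
have {}cv : (\int[mu]_(x in F n) (EFin \o f) x @[n --> \oo] -->
    \int[mu]_(x in D) (EFin \o f) x)%E.
  apply: cvg_trans cv; apply: near_eq_cvg; apply: nearW => n /=.
  by rewrite -integral_mkcondr setIidr.
rewrite /Rintegral; apply: fine_cvg.
by rewrite fineK; [exact: cv|exact: integrable_fin_num].
Qed.

Import HBSimple HBNNSimple.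

(* No measurability of the integrand is assumed: the integral is a supremum
   over simple functions, which do not see null sets. *)
Lemma ge0_integral_null_patch N (h : T -> \bar R) :
  measurable N -> mu N = 0 -> (forall x, 0 <= h x)%E ->
  (\int[mu]_x h x = \int[mu]_x (h \_ (~` N)) x)%E.
Proof.
move=> mN N0 h0; have mC := measurableC mN.
have hN0 x : (0 <= (h \_ (~` N)) x)%E by rewrite patchE; case: ifPn.
rewrite !ge0_integralTE//; apply/eqP; rewrite eq_le; apply/andP; split; last first.
  apply: le_ereal_sup => _ [g /= gh] <-; exists g => //= x.
  by apply: le_trans (gh x) _; rewrite patchE; case: ifPn.
apply: ge_ereal_sup => _ [g /= gh] <-; apply: ereal_sup_ubound.
exists (proj_nnsfun g mC) => /=.
  move=> x; rewrite patchE mindicE; case: ifPn => xN.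
    by rewrite mulr1; exact: gh.
  by rewrite mulr0.
have mg : measurable_fun setT (fun x : T => (g x)%:E) by exact/measurable_EFinP.
have g0 (x : T) : setT x -> (0 <= (g x)%:E)%E by rewrite lee_fin.
rewrite -!integralT_nnsfun (ge0_negligible_integral mN measurableT mg g0 N0).
rewrite setTD [RHS]integral_mkcond; apply: eq_integral => x _ /=.
by rewrite patchE mindicE; case: ifPn => _; rewrite ?mulr1 ?mulr0.
Qed.

(** Meant for integrands built from [derive1], about whose values on the grid lines nothing is
    known. Positive and negative parts are cut off outside [N] separately. *)
Lemma eq_Rintegral_off_null D N f g : measurable N -> mu N = 0 ->
  (forall x, D x -> ~ N x -> f x = g x) ->
  \int[mu]_(x in D) f x = \int[mu]_(x in D) g x.
Proof.
move=> mN N0 fg; rewrite /Rintegral; congr fine.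
rewrite integral_mkcond [RHS]integral_mkcond.
set F := _ \_ D; set G := _ \_ D.
have FG : F \_ (~` N) = G \_ (~` N).
  apply/funext => x; rewrite !patchE; case: ifPn => // /set_mem Nx.
  by rewrite /F /G !patchE; case: ifPn => // /set_mem Dx; rewrite fg.
rewrite integralE [RHS]integralE; congr (_ - _)%E.
  rewrite (ge0_integral_null_patch mN N0)// [RHS](ge0_integral_null_patch mN N0)//.
  by rewrite -!funepos_restrict FG.
rewrite (ge0_integral_null_patch mN N0)// [RHS](ge0_integral_null_patch mN N0)//.
by rewrite -!funeneg_restrict FG.
Qed.

End ExhaustionAndNullSets.

(** * Fubini for products of functions of one variable *)

Section ProductIntegral.
Context d1 d2 (T1 : measurableType d1) (T2 : measurableType d2) (R : realType).
Variable m1 : {sigma_finite_measure set T1 -> \bar R}.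
Variable m2 : {sigma_finite_measure set T2 -> \bar R}.

(** Tonelli applied to [|F| |G|] gives integrability; Fubini then gives the value. *)
Lemma has_integral_prodT (F : T1 -> R) (G : T2 -> R) I J :
  has_integral m1 setT F I -> has_integral m2 setT G J ->
  has_integral (m1 \x m2)%E setT (fun p => F p.1 * G p.2) (I * J).
Proof.
move=> [intF <-] [intG <-].
have mF : measurable_fun setT F by apply/measurable_EFinP; exact: (measurable_int m1 intF).
have mG : measurable_fun setT G by apply/measurable_EFinP; exact: (measurable_int m2 intG).
have mFG : measurable_fun setT (fun p : T1 * T2 => F p.1 * G p.2).
  by apply: measurable_funM; exact: measurableT_comp.
have mFG' : measurable_fun setT (EFin \o (fun p : T1 * T2 => F p.1 * G p.2)).
  exact/measurable_EFinP.
have intFG : (m1 \x m2)%E.-integrable setT (EFin \o (fun p => F p.1 * G p.2)).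
  apply/(integrable12ltyP _ _ mFG').
  have E x : (\int[m2]_y `|(F x * G y)%:E| =
      `|F x|%:E * \int[m2]_y `|G y|%:E)%E.
    rewrite -ge0_integralZl//.
    - by apply: eq_integral => y _ /=; rewrite normrM.
    - by apply/measurable_EFinP; exact: measurableT_comp.
  rewrite (eq_integral _ _ (fun x _ => E x)) /=.
  have /integrableP[_ G1] := intG; have /integrableP[_ F1] := intF.
  rewrite ge0_integralZr//; last 2 first.
  - by apply/measurable_EFinP; exact: measurableT_comp.
  - exact: integral_ge0.
  apply: lte_mul_pinfty; [exact: integral_ge0| |exact: G1].
  by rewrite ge0_fin_numE//; exact: integral_ge0.
split=> //; rewrite /Rintegral -(integral12_prod_meas1 intFG) /fubini_F.
have E x : (\int[m2]_y (F x * G y)%:E =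
    (F x)%:E * (\int[m2]_y (G y))%:E)%E.
  rewrite fineK; last exact: integrable_fin_num.
  by rewrite -integralZl//; exact: measurableT.
rewrite (eq_integral _ _ (fun x _ => E x)) integralZr//.
by rewrite fineM//; exact: integrable_fin_num.
Qed.

Lemma has_integral_prod (F : T1 -> R) (G : T2 -> R) (E : set T2) I J :
  measurable E -> has_integral m1 setT F I -> has_integral m2 E G J ->
  has_integral (m1 \x m2)%E [set p | E p.2] (fun p => F p.1 * G p.2) (I * J).
Proof.
move=> mE hF [intG GJ].
have hG : has_integral m2 setT (G \_ E) J.
  split; last by rewrite -Rintegral_mkcond.
  by move/(integrable_mkcond _ mE): intG; rewrite restrict_EFin.
have [intFG <-] := has_integral_prodT hF hG.
have mE' : measurable [set p : T1 * T2 | E p.2].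
  by rewrite -[X in measurable X]setTI; exact: measurable_snd.
have FGE : (fun p : T1 * T2 => F p.1 * (G \_ E) p.2) =
    (fun p => F p.1 * G p.2) \_ [set p | E p.2].
  apply/funext => p; rewrite !patchE.
  have -> : (p \in [set p | E p.2]) = (p.2 \in E) by apply/idP/idP; rewrite !inE.
  by case: ifPn; rewrite ?mulr0.
rewrite FGE in intFG *; split; last by rewrite Rintegral_mkcond.
by apply/(integrable_mkcond _ mE'); rewrite restrict_EFin.
Qed.

End ProductIntegral.

(** * Half-line meshes *)

Section Mesh.
Variable R : realType.
Implicit Types (d x t : R) (u v phi f F : R -> R) (n N : nat).

(* The mesh on a half-line has the nodes d * n; a negative d gives the meshes
   to the left of the origin, so both half-lines are treated at once. *)
Definition cell d n : set R := [set x | n%:R <= x / d < n.+1%:R].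
Definition strip d N : set R := [set x | 0 <= x / d < N%:R].
Definition half_line d : set R := [set x | 0 <= x / d].

(** Interpolation on closed cells: [t] may equal 0 and 1, and neighbouring cells use the same nodal
    value, so continuity across the nodes is built in. *)
Definition P1 d v : Prop := forall n t, 0 <= t <= 1 ->
  v (d * (n%:R + t)) = (1 - t) * v (d * n%:R) + t * v (d * n.+1%:R).

Definition slope d v x : R :=
  (v (d * (Num.truncn (x / d)).+1%:R) - v (d * (Num.truncn (x / d))%:R)) / d.

Lemma truncn_cell d n x : cell d n x -> Num.truncn (x / d) = n.
Proof. by move=> cx; apply: truncn_def. Qed.

Lemma slope_cell d v n x : cell d n x ->
  slope d v x = (v (d * n.+1%:R) - v (d * n%:R)) / d.
Proof. by move=> /truncn_cell; rewrite /slope => ->. Qed.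

Lemma P1_cell d v n x : d != 0 -> P1 d v -> cell d n x ->
  v x = (1 - (x / d - n%:R)) * v (d * n%:R) + (x / d - n%:R) * v (d * n.+1%:R).
Proof.
move=> d0 Pv /andP[nx xn]; rewrite -Pv; last first.
  by rewrite subr_ge0 nx /= lerBlDr nat1r ltW.
by congr v; rewrite addrC subrK mulrC divfK.
Qed.

Lemma measurable_preimage_divr d (A : set R) : measurable A ->
  measurable [set x | A (x / d)].
Proof.
move=> mA; have mf : measurable_fun setT (fun x : R => x / d).
  by apply: measurable_funM => //; exact: measurable_cst.
by rewrite -[X in measurable X]setTI; exact: mf.
Qed.

Lemma measurable_cell d n : measurable (cell d n).
Proof.
have -> : cell d n = [set x | `[n%:R, n.+1%:R[%classic (x / d)].
  by apply/seteqP; split => x /=; rewrite in_itv.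
by apply: measurable_preimage_divr; exact: measurable_itv.
Qed.

Lemma measurable_strip d N : measurable (strip d N).
Proof.
have -> : strip d N = [set x | `[0, N%:R[%classic (x / d)].
  by apply/seteqP; split => x /=; rewrite in_itv.
by apply: measurable_preimage_divr; exact: measurable_itv.
Qed.

Lemma strip0 d : strip d 0 = set0.
Proof.
apply/seteqP; split => // x /andP[x0 x0']; have := le_lt_trans x0 x0'.
by rewrite ltxx.
Qed.

Lemma stripS d N : strip d N.+1 = strip d N `|` cell d N.
Proof.
apply/seteqP; split => x; rewrite /strip /cell /=.
  move=> /andP[x0 xN]; have [xN'|xN'] := ltP (x / d) N%:R.
    by left; rewrite x0.
  by right.
case=> /andP[x0 xN].
  by rewrite x0 (lt_trans xN)// ltr_nat.
by rewrite xN andbT (le_trans _ x0).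
Qed.

Lemma strip_cell_disjoint d N : [disjoint strip d N & cell d N].
Proof.
apply/disj_set2P/seteqP; split => // x [/andP[_ xN] /andP[Nx _]].
by have := lt_le_trans xN Nx; rewrite ltxx.
Qed.

Lemma nondecreasing_strip d : nondecreasing_seq (strip d).
Proof.
apply/nondecreasing_seqP => N; apply/subsetPset; rewrite stripS.
exact: subsetUl.
Qed.

Lemma bigcup_strip d : \bigcup_N strip d N = half_line d.
Proof.
apply/seteqP; split => x; first by case=> N _ /andP[].
by move=> x0; exists (Num.truncn (x / d)).+1 => //=; rewrite /strip /= x0 truncnS_gt.
Qed.

Lemma bigcup_cell d : \bigcup_n cell d n = half_line d.
Proof.
apply/seteqP; split => x; first by case=> n _ /andP[nx _]; exact: le_trans nx.
by move=> x0; exists (Num.truncn (x / d)) => //=; rewrite /cell /=; exact: truncn_itv.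
Qed.

Lemma measurable_half_line d : measurable (half_line d).
Proof. by rewrite -bigcup_cell; apply: bigcupT_measurable => n; exact: measurable_cell. Qed.

Lemma measurable_slope d v : measurable_fun (half_line d) (slope d v).
Proof.
rewrite -bigcup_cell; apply/measurable_fun_bigcup => [n|n]; first exact: measurable_cell.
apply: (@eq_measurable_fun _ _ _ _ (cell d n)
  (fun=> (v (d * n.+1%:R) - v (d * n%:R)) / d)); last exact: measurable_cst.
by move=> x /set_mem /slope_cell ->.
Qed.

Lemma has_integral_segment_FTC (F f : R -> R) (a b : R) : a < b ->
  (forall x, is_derive x 1 F (f x)) -> continuous f ->
  has_integral (@leb1 R) `[a, b] f (F b - F a).
Proof.
move=> ab dF cf.
have cf' : {within `[a, b], continuous f} by exact: continuous_subspaceT.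
split; first by apply: continuous_compact_integrable => //; exact: segment_compact.
have cF x : {for x, continuous F}.
  by apply: differentiable_continuous; apply/derivable1_diffP; case: (dF x).
rewrite /Rintegral (@continuous_FTC2 _ f F a b)//.
  split=> [x _||]; first by case: (dF x).
    by apply: cvg_at_right_filter; exact: cF.
  by apply: cvg_at_left_filter; exact: cF.
by move=> x _; rewrite derive1E; case: (dF x).
Qed.

Lemma integrable_cell d n f : d != 0 -> continuous f ->
  (@leb1 R).-integrable (cell d n) (EFin \o f).
Proof.
move=> d0 cf.
pose a := - (`|d| * n.+1%:R); pose b := `|d| * n.+1%:R.
have : (@leb1 R).-integrable `[a, b] (EFin \o f).
  apply: continuous_compact_integrable; first exact: segment_compact.
  exact: continuous_subspaceT.
apply: integrableS; [exact: measurable_itv|exact: measurable_cell|].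
move=> x /andP[nx xn] /=; rewrite in_itv /= -ler_norml.
rewrite -[x](divfK d0) normrM mulrC ler_wpM2l//.
by rewrite ger0_norm ?(ltW xn)// (le_trans _ nx).
Qed.

(** For negative [d] the cell is traversed from right to left and is open at its left end;
    [Num.sg d] records the orientation, and the end points form a null set. *)
Lemma has_integral_cell_FTC d n (F f : R -> R) : d != 0 ->
  (forall x, is_derive x 1 F (f x)) -> continuous f ->
  has_integral (@leb1 R) (cell d n) f (Num.sg d * (F (d * n.+1%:R) - F (d * n%:R))).
Proof.
move=> d0 dF cf; have intf := integrable_cell n d0 cf; split=> //.
have lt_n : n%:R < n.+1%:R :> R by rewrite ltr_nat.
have [d_gt0|d_lt0|d_eq0] := ltgtP d 0; last by rewrite d_eq0 eqxx in d0.
- have E : cell d n = `]d * n.+1%:R, d * n%:R]%classic.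
    apply/seteqP; split => x; rewrite /cell /= in_itv /=.
      by rewrite ler_ndivlMr// ltr_ndivrMr// !(mulrC d) andbC.
    by rewrite ler_ndivlMr// ltr_ndivrMr// !(mulrC d) andbC.
  rewrite E in intf *; rewrite (Rintegral_itv_obnd_cbnd intf).
  rewrite (has_integralE (has_integral_segment_FTC _ dF cf)) ?ltr_nM2l//.
  by rewrite ltr0_sg// mulN1r opprB.
- have E : cell d n = `[d * n%:R, d * n.+1%:R[%classic.
    apply/seteqP; split => x; rewrite /cell /= in_itv /=.
      by rewrite ler_pdivlMr// ltr_pdivrMr// !(mulrC d).
    by rewrite ler_pdivlMr// ltr_pdivrMr// !(mulrC d).
  rewrite E in intf *; rewrite (Rintegral_itv_bndo_bndc intf).
  rewrite (has_integralE (has_integral_segment_FTC _ dF cf)) ?ltr_pM2l//.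
  by rewrite gtr0_sg// mul1r.
Qed.

Lemma has_integral_strip d f (I : nat -> R) N :
  (forall n, has_integral (@leb1 R) (cell d n) f (I n)) ->
  has_integral (@leb1 R) (strip d N) f (\sum_(n < N) I n).
Proof.
move=> hf; elim: N => [|N IHN].
  rewrite strip0 big_ord0; split; first exact: integrable_set0.
  by rewrite Rintegral_set0.
rewrite stripS big_ord_recr /=; apply: has_integralU => //.
- exact: measurable_strip.
- exact: measurable_cell.
- exact: strip_cell_disjoint.
Qed.

(** The element matrices of linear finite elements: stiffness [1/h] times [[1 -1; -1 1]] and mass
    [h/6] times [[2 1; 1 2]], with [h = |d|]. *)
Lemma has_integral_cell_energy d n u v (al be : R) : d != 0 -> P1 d u -> P1 d v ->
  has_integral (@leb1 R) (cell d n)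
    (fun x => al * (slope d u x * slope d v x) + be * (u x * v x))
    (let u0 := u (d * n%:R) in let u1 := u (d * n.+1%:R) in
     let v0 := v (d * n%:R) in let v1 := v (d * n.+1%:R) in
     al / `|d| * ((u1 - u0) * (v1 - v0)) +
     be * `|d| / 6 * (2 * (u0 * v0) + 2 * (u1 * v1) + u0 * v1 + u1 * v0)).
Proof.
move=> d0 Pu Pv; set u0 := u (d * n%:R); set u1 := u (d * n.+1%:R).
set v0 := v (d * n%:R); set v1 := v (d * n.+1%:R); cbv zeta.
(* In the local coordinate [s = x / d - n] the integrand is the quadratic [c0 + c1 s + c2 s^2]; [F]
   is its primitive, the factor [d] coming from the chain rule. *)
pose c0 := al * ((u1 - u0) / d * ((v1 - v0) / d)) + be * (u0 * v0).
pose c1 := be * (u0 * (v1 - v0) + (u1 - u0) * v0).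
pose c2 := be * ((u1 - u0) * (v1 - v0)).
pose f x := c0 + c1 * (x / d - n%:R) + c2 * (x / d - n%:R) ^+ 2.
pose F x := d * (c0 * (x / d - n%:R) + c1 * (2^-1 * (x / d - n%:R) ^+ 2) +
                 c2 * (3^-1 * (x / d - n%:R) ^+ 3)).
have dF x : is_derive x 1 F (f x).
  apply: is_derive_eq; rewrite /f /GRing.scale /=; field.
  by rewrite d0.
have cf : continuous f.
  move=> x; apply: differentiable_continuous; apply/derivable1_diffP.
  by rewrite /f; apply: ex_derive.
have := has_integral_cell_FTC n d0 dF cf.
rewrite (_ : Num.sg d * _ = al / `|d| * ((u1 - u0) * (v1 - v0)) +
  be * `|d| / 6 * (2 * (u0 * v0) + 2 * (u1 * v1) + u0 * v1 + u1 * v0)).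
  apply: eq_has_integral; first exact: measurable_cell.
  move=> x cx; rewrite !(slope_cell _ cx) (P1_cell d0 Pu cx) (P1_cell d0 Pv cx).
  rewrite /f /c0 /c1 /c2 -/u0 -/u1 -/v0 -/v1; ring.
have e1 : (d * n.+1%:R) / d - n%:R = 1 by rewrite mulrAC divff// mul1r -natr1 addrAC subrr add0r.
have e0 : (d * n%:R) / d - n%:R = 0 by rewrite mulrAC divff// mul1r subrr.
rewrite /F e1 e0 /c0 /c1 /c2.
have sd : Num.sg d = `|d| / d by rewrite normrEsg mulfK.
have nd : `|d| ^+ 2 = d ^+ 2 by rewrite real_normK ?num_real.
have nd0 : `|d| != 0 by rewrite normr_eq0.
have -> : al / `|d| = al * `|d| / d ^+ 2 by rewrite -nd; field.
by rewrite sd; field.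
Qed.

Lemma has_integral_strip_energy d N u v (al be : R) : d != 0 -> P1 d u -> P1 d v ->
  has_integral (@leb1 R) (strip d N)
    (fun x => al * (slope d u x * slope d v x) + be * (u x * v x))
    (\sum_(n < N) (let u0 := u (d * n%:R) in let u1 := u (d * n.+1%:R) in
     let v0 := v (d * n%:R) in let v1 := v (d * n.+1%:R) in
     al / `|d| * ((u1 - u0) * (v1 - v0)) +
     be * `|d| / 6 * (2 * (u0 * v0) + 2 * (u1 * v1) + u0 * v1 + u1 * v0))).
Proof.
move=> d0 Pu Pv.
exact: (has_integral_strip _ (fun n => has_integral_cell_energy n al be d0 Pu Pv)).
Qed.

End Mesh.

(** * Discrete harmonic functions and square-integrability on a half-line *)

Section HalfLine.
Variable R : realType.
Implicit Types (d x t lam : R) (u v e phi f : R -> R) (n N : nat).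

Lemma le_has_integral_subset (A B : set R) f (I J : R) :
  measurable A -> measurable B -> A `<=` B -> (forall x, B x -> 0 <= f x) ->
  has_integral (@leb1 R) A f I -> has_integral (@leb1 R) B f J -> I <= J.
Proof.
move=> mA mB AB f0 [intA <-] [intB <-]; rewrite /Rintegral.
apply: fine_le; [exact: integrable_fin_num|exact: integrable_fin_num|].
apply: ge0_subset_integral => //.
exact: (measurable_int (@leb1 R) intB).
Qed.

Lemma has_integral_extend (A B : set R) f (I : R) :
  measurable A -> measurable B -> A `<=` B -> (forall x, B x -> ~ A x -> f x = 0) ->
  has_integral (@leb1 R) A f I -> has_integral (@leb1 R) B f I.
Proof.
move=> mA mB AB f0 hA; rewrite -[I]addr0 -(setDUK AB).
apply: has_integralU => //; first exact: measurableD.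
  by apply/disj_set2P; rewrite setDE setICA setICr setI0.
apply: (eq_has_integral _ _ (has_integral0 _ _)); first exact: measurableD.
by move=> x [Bx nAx]; rewrite f0.
Qed.

(* The off-diagonal and half-diagonal entries of the stiffness matrix of
   (- D^2 + lam) on a cell of length h. *)
Definition offdiag (lam h : R) : R := - h^-1 + lam * h / 6.
Definition halfdiag (lam h : R) : R := h^-1 + lam * h / 3.

(** The row of the stiffness matrix at the interior node [n.+1]; [halfdiag] occurs twice because
    both adjacent cells contribute to the diagonal. *)
Definition discrete_harmonic d lam e : Prop := forall n,
  offdiag lam `|d| * e (d * n%:R) + 2 * halfdiag lam `|d| * e (d * n.+1%:R) +
  offdiag lam `|d| * e (d * n.+2%:R) = 0.

(** The contribution of the cell from node [n] to node [n.+1] to the row of node [n]: the discrete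
    normal derivative that appears as boundary term in a summation by parts. *)
Definition flux d lam e n : R :=
  halfdiag lam `|d| * e (d * n%:R) + offdiag lam `|d| * e (d * n.+1%:R).

(** Summation by parts: the rows of the interior nodes vanish and only the fluxes at the two ends of
    the strip survive. *)
Lemma has_integral_strip_harmonic d lam e v N : d != 0 -> P1 d e -> P1 d v ->
  discrete_harmonic d lam e ->
  has_integral (@leb1 R) (strip d N)
    (fun x => slope d e x * slope d v x + lam * (e x * v x))
    (flux d lam e 0 * v 0 - flux d lam e N * v (d * N%:R)).
Proof.
move=> d0 Pe Pv he; have := has_integral_strip_energy N 1 lam d0 Pe Pv.
cbv zeta; set S := \sum_(n < N) _.
have -> : S = flux d lam e 0 * v 0 - flux d lam e N * v (d * N%:R).
  rewrite {}/S; elim: N => [|N IHN]; first by rewrite big_ord0 mulr0 subrr.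
  rewrite big_ord_recr /= IHN.
  have nd0 : `|d| != 0 by rewrite normr_eq0.
  have hN := he N; rewrite /flux.
  (* Harmonicity at node [N.+1] expresses the flux into the next cell by the values at nodes [N] and
     [N.+1], which makes the sum telescope. *)
  have -> : halfdiag lam `|d| * e (d * N.+1%:R) + offdiag lam `|d| * e (d * N.+2%:R) =
    - (offdiag lam `|d| * e (d * N%:R) + halfdiag lam `|d| * e (d * N.+1%:R)).
    by apply/eqP; rewrite -subr_eq0 -hN; apply/eqP; ring.
  by rewrite /offdiag /halfdiag; field.
apply: eq_has_integral; first exact: measurable_strip.
by move=> x _; rewrite mul1r.
Qed.

Lemma has_integral_strip_sqr d v N : d != 0 -> P1 d v ->
  has_integral (@leb1 R) (strip d N) (fun x => v x ^+ 2)
    (\sum_(n < N) `|d| / 3 * (v (d * n%:R) ^+ 2 + v (d * n.+1%:R) ^+ 2 +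
       v (d * n%:R) * v (d * n.+1%:R))).
Proof.
move=> d0 Pv; have := has_integral_strip_energy N 0 1 d0 Pv Pv.
cbv zeta; set S := \sum_(n < N) _; set S' := \sum_(n < N) _.
have -> : S = S' by apply: eq_bigr => n _; field; rewrite normr_eq0.
apply: eq_has_integral; first exact: measurable_strip.
by move=> x _; rewrite mul0r add0r mul1r.
Qed.

Lemma has_integral_strip_sqr_slope d v N : d != 0 -> P1 d v ->
  has_integral (@leb1 R) (strip d N) (fun x => slope d v x ^+ 2)
    (\sum_(n < N) `|d|^-1 * (v (d * n.+1%:R) - v (d * n%:R)) ^+ 2).
Proof.
move=> d0 Pv; have := has_integral_strip_energy N 1 0 d0 Pv Pv.
cbv zeta; set S := \sum_(n < N) _; set S' := \sum_(n < N) _.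
have -> : S = S' by apply: eq_bigr => n _; field; rewrite normr_eq0.
apply: eq_has_integral; first exact: measurable_strip.
by move=> x _; rewrite mul0r addr0 mul1r.
Qed.

Definition L2_on (D : set R) v : Prop := (@leb1 R).-integrable D (fun x => (v x ^+ 2)%:E).

(** Inverse inequality, cell by cell, with the sharp constant [12 / h^2]: for end values [a], [b]
    the defect is [3 (a + b)^2 / h], which is zero for [b = - a]. *)
Lemma L2_slope d v : d != 0 -> P1 d v -> L2_on (half_line d) v ->
  L2_on (half_line d) (slope d v).
Proof.
move=> d0 Pv intv; rewrite /L2_on -bigcup_strip.
have nd0 : 0 < `|d| by rewrite normr_gt0.
apply: (@integrable_bigcup_bounded _ (measurableTypeR R) R (@leb1 R) _ (fun x => slope d v x ^+ 2)
  (12 / `|d| ^+ 2 * \int[@leb1 R]_(x in half_line d) v x ^+ 2)).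
- exact: nondecreasing_strip.
- by move=> n; exact: measurable_strip.
- by move=> n x _; exact: sqr_ge0.
- by move=> n; case: (has_integral_strip_sqr_slope n d0 Pv).
- move=> N; rewrite (has_integralE (has_integral_strip_sqr_slope N d0 Pv)).
  have hv := has_integral_strip_sqr N d0 Pv.
  have le_v : \sum_(n < N) `|d| / 3 * (v (d * n%:R) ^+ 2 + v (d * n.+1%:R) ^+ 2 +
       v (d * n%:R) * v (d * n.+1%:R)) <= \int[@leb1 R]_(x in half_line d) v x ^+ 2.
    apply: (le_has_integral_subset _ _ _ _ hv (integrable_has_integral intv)).
    + exact: measurable_strip.
    + exact: measurable_half_line.
    + by move=> x /andP[].
    + by move=> x _; exact: sqr_ge0.
  have c0 : 0 <= 12 / `|d| ^+ 2 by rewrite divr_ge0// sqr_ge0.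
  apply: le_trans (ler_wpM2l c0 le_v).
  rewrite mulr_sumr; apply: ler_sum => n _.
  rewrite -subr_ge0; set a := v _; set b := v _.
  have -> : 12 / `|d| ^+ 2 * (`|d| / 3 * (a ^+ 2 + b ^+ 2 + a * b)) -
    `|d|^-1 * (b - a) ^+ 2 = `|d|^-1 * (3 * (a + b) ^+ 2) by field; rewrite gt_eqF.
  by rewrite mulr_ge0 ?invr_ge0// mulr_ge0// sqr_ge0.
Qed.

(** The integrals over strips converge, so their increments tend to 0; the integral of [v^2] over a
    cell is at least [h/6] times the squared value at its first node, as [6/h] times it exceeds
    [a^2] by [(a + b)^2 + b^2]. *)
Lemma L2_nodes_cvg0 d v : d != 0 -> P1 d v -> L2_on (half_line d) v ->
  v (d * N%:R) @[N --> \oo] --> 0.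
Proof.
move=> d0 Pv intv; have nd0 : 0 < `|d| by rewrite normr_gt0.
rewrite /L2_on -bigcup_strip in intv.
have cv := @cvg_Rintegral_bigcup _ (measurableTypeR R) R (@leb1 R) _ (fun x => v x ^+ 2)
  (@nondecreasing_strip _ d)
  (fun n => @measurable_strip _ d n) intv.
set S := fun n => _ in cv.
have cvS : S N.+1 - S N @[N --> \oo] --> 0.
  by rewrite -[X in _ --> X](subrr (\int[@leb1 R]_(x in \bigcup_n strip d n) v x ^+ 2));
    apply: cvgB => //; rewrite cvg_shiftS.
have cv2 : v (d * N%:R) ^+ 2 @[N --> \oo] --> 0.
  have cv6 : 6 / `|d| * (S N.+1 - S N) @[N --> \oo] --> 0.
    by rewrite -(mulr0 (6 / `|d|)); apply: cvgM => //; exact: cvg_cst.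
  apply: (@squeeze_cvgr _ _ _ _ (fun=> 0) (fun N => 6 / `|d| * (S N.+1 - S N))) => //.
    apply: nearW => N; rewrite sqr_ge0 /S !(has_integralE (has_integral_strip_sqr _ d0 Pv)).
    rewrite big_ord_recr /= addrAC subrr add0r.
    rewrite -subr_ge0; set a := v _; set b := v _.
    have -> : 6 / `|d| * (`|d| / 3 * (a ^+ 2 + b ^+ 2 + a * b)) - a ^+ 2 =
      (a + b) ^+ 2 + b ^+ 2 by field; rewrite gt_eqF.
    by rewrite addr_ge0// sqr_ge0.
  exact: cvg_cst.
apply/norm_cvg0P.
have -> : (fun N => `|v (d * N%:R)|) = (fun N => Num.sqrt (v (d * N%:R) ^+ 2)).
  by apply/funext => N; rewrite sqrtr_sqr.
rewrite -[X in _ --> X]sqrtr0.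
by apply: (cvg_comp _ Num.sqrt cv2); exact: sqrt_continuous.
Qed.

(** Square-summable nodal values suffice, since [(a^2 + b^2 + a b) / 3 <= (a^2 + b^2) / 2] and each
    node belongs to at most two cells. *)
Lemma L2_of_nodes d v (c : R) : d != 0 -> P1 d v ->
  (forall N, \sum_(n < N) v (d * n%:R) ^+ 2 <= c) -> L2_on (half_line d) v.
Proof.
move=> d0 Pv le_c; rewrite /L2_on -bigcup_strip.
apply: (@integrable_bigcup_bounded _ (measurableTypeR R) R (@leb1 R) _
  (fun x => v x ^+ 2) (`|d| * c)).
- exact: nondecreasing_strip.
- by move=> n; exact: measurable_strip.
- by move=> n x _; exact: sqr_ge0.
- by move=> n; case: (has_integral_strip_sqr n d0 Pv).
- move=> N; rewrite (has_integralE (has_integral_strip_sqr N d0 Pv)).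
  have h1 : \sum_(n < N) v (d * n.+1%:R) ^+ 2 <= c.
    by apply: le_trans (le_c N.+1); rewrite big_ord_recl lerDr sqr_ge0.
  have h0 := le_c N.
  have : \sum_(n < N) v (d * n%:R) ^+ 2 + \sum_(n < N) v (d * n.+1%:R) ^+ 2 <= 2 * c by lra.
  rewrite -big_split /= => h.
  have : `|d| / 2 * \sum_(n < N) (v (d * n%:R) ^+ 2 + v (d * n.+1%:R) ^+ 2) <= `|d| * c.
    by apply: (le_trans (ler_wpM2l _ h)); rewrite ?divr_ge0// mulrA divfK.
  apply: le_trans; rewrite mulr_sumr; apply: ler_sum => n _.
  rewrite -subr_ge0; set a := v _; set b := v _.
  have -> : `|d| / 2 * (a ^+ 2 + b ^+ 2) - `|d| / 3 * (a ^+ 2 + b ^+ 2 + a * b) =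
    `|d| / 6 * (a - b) ^+ 2 by field.
  by rewrite mulr_ge0 ?sqr_ge0// divr_ge0.
Qed.

Lemma integrable_energy d u v lam : d != 0 -> P1 d u -> P1 d v ->
  measurable_fun (half_line d) u -> measurable_fun (half_line d) v ->
  L2_on (half_line d) u -> L2_on (half_line d) v ->
  (@leb1 R).-integrable (half_line d)
    (EFin \o (fun x => slope d u x * slope d v x + lam * (u x * v x))).
Proof.
move=> d0 Pu Pv mu mv intu intv.
have mH : measurable (half_line d : set (measurableTypeR R)) := measurable_half_line d.
have i1 := @integrable_mulL2 _ (measurableTypeR R) R (@leb1 R) _ _ _ mH
  (@measurable_slope _ d u) (@measurable_slope _ d v)
  (L2_slope d0 Pu intu) (L2_slope d0 Pv intv).
have i2 := @integrable_mulL2 _ (measurableTypeR R) R (@leb1 R) _ _ _ mH mu mv intu intv.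
by case: (has_integralD mH (integrable_has_integral i1)
  (has_integralZ lam mH (integrable_has_integral i2))).
Qed.

(** Limit of the identity on strips: nodal values of square-integrable interpolants tend to 0, hence
    so does the product at the far end, and only the interface term remains. *)
Lemma has_integral_half_line_harmonic d lam e v : d != 0 -> P1 d e -> P1 d v ->
  measurable_fun (half_line d) e -> measurable_fun (half_line d) v ->
  L2_on (half_line d) e -> L2_on (half_line d) v -> discrete_harmonic d lam e ->
  has_integral (@leb1 R) (half_line d)
    (fun x => slope d e x * slope d v x + lam * (e x * v x))
    (flux d lam e 0 * v 0).
Proof.
move=> d0 Pe Pv me mv inte intv he.
have inth := integrable_energy lam d0 Pe Pv me mv inte intv; split=> //.
rewrite -bigcup_strip in inth.
have cv := @cvg_Rintegral_bigcup _ (measurableTypeR R) R (@leb1 R) _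
  (fun x => slope d e x * slope d v x + lam * (e x * v x)) (@nondecreasing_strip _ d)
  (fun n => @measurable_strip _ d n) inth.
rewrite -bigcup_strip -(cvg_lim _ cv)//; apply: cvg_lim => //.
have -> : (fun N => \int[@leb1 R]_(x in strip d N)
      (slope d e x * slope d v x + lam * (e x * v x))) =
    (fun N => flux d lam e 0 * v 0 - flux d lam e N * v (d * N%:R)).
  by apply/funext => N; exact: has_integralE (has_integral_strip_harmonic _ d0 Pe Pv he).
rewrite -[X in _ --> X]subr0; apply: cvgB; first exact: cvg_cst.
have e0 := L2_nodes_cvg0 d0 Pe inte; have v0 := L2_nodes_cvg0 d0 Pv intv.
rewrite -(mulr0 (halfdiag lam `|d| * 0 + offdiag lam `|d| * 0)).
apply: cvgM => //; apply: cvgD; (apply: cvgM; first exact: cvg_cst) => //.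
by rewrite (cvg_shiftS (fun N => e (d * N%:R))).
Qed.

Definition clamp t : R := Num.min 1 (Num.max 0 t).

Lemma continuous_clamp : continuous clamp.
Proof.
move=> t; apply: continuous_min; first exact: cvg_cst.
by apply: continuous_max; [exact: cvg_cst|exact: cvg_id].
Qed.

(** A sum of globally continuous functions that reproduces [v - v 0] on the first [N] cells and
    vanishes on the opposite half-line. Adding the ramps of both sides gives continuity at the
    origin and at the nodes at once. *)
Definition ramp d v N x : R :=
  \sum_(n < N) (v (d * n.+1%:R) - v (d * n%:R)) * clamp (x / d - n%:R).

Lemma continuous_ramp d v N : continuous (ramp d v N).
Proof.
elim: N => [|N IHN].
  have -> : ramp d v 0 = cst 0 by apply/funext => x; rewrite /ramp big_ord0.
  by move=> x; exact: cvg_cst.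
have -> : ramp d v N.+1 = (fun x => ramp d v N x +
    (v (d * N.+1%:R) - v (d * N%:R)) * clamp (x / d - N%:R)).
  by apply/funext => x; rewrite /ramp big_ord_recr.
move=> x; apply: cvgD; first exact: IHN.
apply: cvgM; first exact: cvg_cst.
apply: (@continuous_comp _ _ _ (fun x => x / d - N%:R) clamp); last exact: continuous_clamp.
apply: cvgB; last exact: cvg_cst.
by apply: cvgM; [exact: cvg_id|exact: cvg_cst].
Qed.

Lemma ramp_le0 d v N x : x / d <= 0 -> ramp d v N x = 0.
Proof.
move=> x0; rewrite /ramp big1// => n _; rewrite /clamp max_l ?min_r ?mulr0//.
by rewrite subr_le0 (le_trans x0).
Qed.

Lemma ramp_strip d v N x : d != 0 -> P1 d v -> strip d N x -> v x = v 0 + ramp d v N x.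
Proof.
move=> d0 Pv; elim: N => [|N IHN]; first by rewrite strip0.
rewrite stripS /ramp big_ord_recr /= => -[sx|cx].
  have /andP[_ xN] := sx.
  rewrite [clamp _](_ : _ = 0) ?mulr0 ?addr0; first exact: IHN.
  by rewrite /clamp max_l ?min_r// subr_le0 ltW.
rewrite (P1_cell d0 Pv cx); have /andP[Nx xN] := cx.
have -> : \sum_(n < N) (v (d * n.+1%:R) - v (d * n%:R)) * clamp (x / d - n%:R) =
    \sum_(n < N) (v (d * n.+1%:R) - v (d * n%:R)).
  apply: eq_bigr => n _; rewrite /clamp max_r; last first.
    by rewrite subr_ge0 (le_trans _ Nx)// ler_nat ltnW.
  by rewrite min_l ?mulr1// lerBrDr nat1r (le_trans _ Nx)// ler_nat.
rewrite -(big_mkord xpredT (fun n => v (d * n.+1%:R) - v (d * n%:R))).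
rewrite telescope_sumr// mulr0 /clamp max_r ?subr_ge0// min_r; last first.
  by rewrite lerBlDr nat1r ltW.
ring.
Qed.

Definition piecewise_linear (hm hp : R) v : Prop := P1 hp v /\ P1 (- hm) v.

Lemma continuous_piecewise_linear hm hp v : 0 < hm -> 0 < hp ->
  piecewise_linear hm hp v -> continuous v.
Proof.
move=> hm0 hp0 [Pp Pm] x.
(* Enough cells on either side to cover the ball of radius 1 around [x]. *)
pose N := (maxn (Num.truncn ((x + 1) / hp)) (Num.truncn ((1 - x) / hm))).+1.
have xp : x + 1 < hp * N%:R.
  rewrite mulrC -ltr_pdivrMr//; apply: lt_le_trans (truncnS_gt _) _.
  by rewrite ler_nat ltnS leq_maxl.
have xm : 1 - x < hm * N%:R.
  rewrite mulrC -ltr_pdivrMr//; apply: lt_le_trans (truncnS_gt _) _.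
  by rewrite ler_nat ltnS leq_maxr.
pose g y := v 0 + ramp hp v N y + ramp (- hm) v N y.
have cg : {for x, continuous g}.
  apply: cvgD; last exact: continuous_ramp.
  by apply: cvgD; [exact: cvg_cst|exact: continuous_ramp].
have vg y : `|x - y| < 1 -> v y = g y.
  rewrite ltr_norml => /andP[yx xy]; rewrite /g.
  have [y0|y0] := leP 0 y.
    rewrite (@ramp_le0 (- hm)) ?addr0; last by rewrite invrN mulrN oppr_le0 divr_ge0// ltW.
    apply: ramp_strip; rewrite ?gt_eqF//.
    rewrite /strip /= divr_ge0 ?(ltW hp0)//= ltr_pdivrMr// mulrC (lt_trans _ xp)//; lra.
  rewrite (@ramp_le0 hp) ?addr0; last by rewrite mulr_le0_ge0 ?invr_ge0 ?(ltW hp0) ?(ltW y0).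
  apply: ramp_strip; rewrite ?oppr_eq0 ?gt_eqF//.
  rewrite /strip /= invrN mulrN -mulNr divr_ge0 ?oppr_ge0 ?(ltW hm0) ?(ltW y0)//=.
  rewrite ltr_pdivrMr// mulrC (lt_trans _ xm)//; lra.
rewrite /continuous_at vg ?subrr ?normr0//.
apply: cvg_trans cg; apply: near_eq_cvg.
by near=> y; rewrite vg//; near: y; exact: (nbhsx_ballx x 1 ltr01).
Unshelve. all: by end_near. Qed.

End HalfLine.

(** * The one-dimensional discrete spaces *)

Section DiscreteSpaceCharacterization.
Variable R : realType.
Implicit Types (d x t hm hp h : R) (u v w phi dphi f g F : R -> R) (n N M : nat).

(** Affinity is given on the open interval; the one-sided limits identify the end values of [v] with
    those of the affine function. *)
Lemma affine_interpolation (a b : R) v t : a < b -> {within `[a, b], continuous v} ->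
  affine_on `]a, b[ v -> 0 <= t <= 1 -> v (a + t * (b - a)) = (1 - t) * v a + t * v b.
Proof.
move=> ab /(continuous_within_itvP _ ab)[_ va vb] [c [e ve]] /andP[t0 t1].
pose g x := c * x + e.
have cg x : g y @[y --> x] --> g x.
  by apply: cvgD; [apply: cvgM; [exact: cvg_cst|exact: cvg_id]|exact: cvg_cst].
have gva : v a = g a.
  have h : v y @[y --> a^'+] --> g a.
    apply: cvg_trans (cvg_at_right_filter (cg a)); apply: near_eq_cvg.
    near=> y; rewrite ve//=; rewrite in_itv /=; apply/andP; split.
      by near: y; exact: nbhs_right_gt.
    by near: y; exact: nbhs_right_lt.
  by apply: (cvg_unique _ va h).
have gvb : v b = g b.
  have h : v y @[y --> b^'-] --> g b.
    apply: cvg_trans (cvg_at_left_filter (cg b)); apply: near_eq_cvg.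
    near=> y; rewrite ve//=; rewrite in_itv /=; apply/andP; split.
      by near: y; exact: nbhs_left_gt.
    by near: y; exact: nbhs_left_lt.
  by apply: (cvg_unique _ vb h).
have [->|tn0] := eqVneq t 0; first by rewrite mul0r addr0 subr0 mul1r mul0r addr0.
have [->|tn1] := eqVneq t 1; first by rewrite mul1r addrC subrK subrr mul0r add0r mul1r.
have t0' : 0 < t by rewrite lt_neqAle eq_sym tn0.
have t1' : t < 1 by rewrite lt_neqAle tn1.
have ba : 0 < b - a by rewrite subr_gt0.
rewrite ve ?gva ?gvb /g; last first.
  rewrite /= in_itv /= ltrDl mulr_gt0//= -ltrBrDl.
  by rewrite gtr_pMl.
ring.
Unshelve. all: by end_near. Qed.

(** [H1] states continuity on the closure of an open interval; this makes it usable on the closed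
    segment. *)
Lemma segment_sub_closure (a b : R) : a < b -> `[a, b] `<=` closure `]a, b[.
Proof.
move=> ab x; rewrite /= in_itv /= => /andP[ax xb] B Bx.
have [xa|xa] := eqVneq x a.
  rewrite xa in Bx.
  have [y [? ?]] : exists y, `]a, b[%classic y /\ B y.
    apply: (@filter_ex _ (a^'+)); near=> y; split.
      rewrite /= in_itv /=; apply/andP; split; near: y.
        exact: nbhs_right_gt.
      exact: nbhs_right_lt.
    by near: y; exact: (@cvg_within _ _ _ _ B Bx).
  by exists y.
have [xb'|xb'] := eqVneq x b.
  rewrite xb' in Bx.
  have [y [? ?]] : exists y, `]a, b[%classic y /\ B y.
    apply: (@filter_ex _ (b^'-)); near=> y; split.
      rewrite /= in_itv /=; apply/andP; split; near: y.
        exact: nbhs_left_gt.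
      exact: nbhs_left_lt.
    by near: y; exact: (@cvg_within _ _ _ _ B Bx).
  by exists y.
exists x; split; last exact: nbhs_singleton.
by rewrite /= in_itv /= !lt_neqAle eq_sym xa ax xb' xb.
Unshelve. all: by end_near. Qed.

Lemma P1_of_affine h v N : 0 < h ->
  (forall n, (n < N)%N -> {within `[h * n%:R, h * n.+1%:R], continuous v}) ->
  (forall n, (n < N)%N -> affine_on `]h * n%:R, h * n.+1%:R[ v) ->
  forall n t, (n < N)%N -> 0 <= t <= 1 ->
  v (h * (n%:R + t)) = (1 - t) * v (h * n%:R) + t * v (h * n.+1%:R).
Proof.
move=> h0 cv av n t nN t01.
have lt_n : h * n%:R < h * n.+1%:R by rewrite ltr_pM2l// ltr_nat.
rewrite -(affine_interpolation lt_n (cv n nN) (av n nN) t01); congr v.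
rewrite -natr1; ring.
Qed.

Lemma P1_of_affine_neg h v : 0 < h -> continuous v ->
  (forall n, affine_on `]- (h * n.+1%:R), - (h * n%:R)[ v) -> P1 (- h) v.
Proof.
move=> h0 cv av n t /andP[t0 t1].
have lt_n : - (h * n.+1%:R) < - (h * n%:R) by rewrite ltrN2 ltr_pM2l// ltr_nat.
have t01' : 0 <= 1 - t <= 1 by rewrite subr_ge0 t1 lerBlDr lerDl.
have e := affine_interpolation lt_n (continuous_subspaceT cv) (av n) t01'.
rewrite !mulNr; transitivity (v (- (h * n.+1%:R) + (1 - t) * (- (h * n%:R) - - (h * n.+1%:R)))).
  by congr v; rewrite -natr1; ring.
by rewrite e; ring.
Qed.

Lemma P1_affine d v n : d != 0 -> P1 d v -> affine_on (cell d n) v.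
Proof.
move=> d0 Pv.
exists ((v (d * n.+1%:R) - v (d * n%:R)) / d),
  (v (d * n%:R) - (v (d * n.+1%:R) - v (d * n%:R)) * n%:R).
by move=> x cx; rewrite (P1_cell d0 Pv cx); field.
Qed.

Lemma affine_onS (A B : set R) v : A `<=` B -> affine_on B v -> affine_on A v.
Proof. by move=> AB [c [e H]]; exists c, e => x /AB; exact: H. Qed.

(** Integration by parts on each cell, where [v] is affine; the boundary terms telescope by
    continuity at the nodes. *)
Lemma strip_by_parts d N v phi dphi : d != 0 -> P1 d v -> continuous v ->
  (forall x, is_derive x 1 phi (dphi x)) -> continuous dphi ->
  exists I J, [/\ has_integral (@leb1 R) (strip d N) (fun x => v x * dphi x) I,
    has_integral (@leb1 R) (strip d N) (fun x => slope d v x * phi x) J &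
    I + J = Num.sg d * (v (d * N%:R) * phi (d * N%:R) - v 0 * phi 0)].
Proof.
move=> d0 Pv cv dphiP cdphi.
have cphi : continuous phi.
  move=> x; apply: differentiable_continuous; apply/derivable1_diffP.
  by case: (dphiP x).
pose c n := (v (d * n.+1%:R) - v (d * n%:R)) / d.
have hI n : has_integral (@leb1 R) (cell d n) (fun x => v x * dphi x)
    (\int[@leb1 R]_(x in cell d n) (v x * dphi x)).
  apply: integrable_has_integral; apply: integrable_cell => // x.
  by apply: cvgM; [exact: cv|exact: cdphi].
have hJ n : has_integral (@leb1 R) (cell d n) (fun x => slope d v x * phi x)
    (\int[@leb1 R]_(x in cell d n) (slope d v x * phi x)).
  apply: integrable_has_integral.
  have [int _] := has_integralZ (c n)
    (measurable_cell d n : measurable (cell d n : set (measurableTypeR R)))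
    (integrable_has_integral (integrable_cell n d0 cphi)).
  apply: eq_integrable int; first exact: measurable_cell.
  by move=> x /set_mem cx /=; rewrite (slope_cell _ cx).
have hIJ n : \int[@leb1 R]_(x in cell d n) (v x * dphi x) +
    \int[@leb1 R]_(x in cell d n) (slope d v x * phi x) =
    Num.sg d * (v (d * n.+1%:R) * phi (d * n.+1%:R) - v (d * n%:R) * phi (d * n%:R)).
  (* The affine branch of [v] on this cell, extended to the line so that [A * phi] is differentiable
     everywhere. *)
  pose A x := (1 - (x / d - n%:R)) * v (d * n%:R) + (x / d - n%:R) * v (d * n.+1%:R).
  have dA x : is_derive x 1 A (c n).
    by apply: is_derive_eq; rewrite /c /GRing.scale /=; field.
  have cA : continuous A.
    move=> x; apply: differentiable_continuous; apply/derivable1_diffP.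
    by case: (dA x).
  have dF x : is_derive x 1 (fun x => A x * phi x) (A x * dphi x + c n * phi x).
    by apply: is_derive_eq; rewrite /GRing.scale /=; ring.
  have cF : continuous (fun x => A x * dphi x + c n * phi x).
    move=> x; apply: cvgD; apply: cvgM; [exact: cA|exact: cdphi|exact: cvg_cst|exact: cphi].
  have [_ e] := has_integral_cell_FTC n d0 dF cF.
  have [_ <-] := has_integralD
    (measurable_cell d n : measurable (cell d n : set (measurableTypeR R))) (hI n) (hJ n).
  transitivity (\int[@leb1 R]_(x in cell d n) (A x * dphi x + c n * phi x)).
    by apply: eq_Rintegral => x /set_mem cx; rewrite (slope_cell _ cx) (P1_cell d0 Pv cx).
  rewrite e /A; congr (_ * (_ * _ - _ * _)).
    by rewrite -natr1; field.
  by field.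
exists (\sum_(n < N) \int[@leb1 R]_(x in cell d n) (v x * dphi x)).
exists (\sum_(n < N) \int[@leb1 R]_(x in cell d n) (slope d v x * phi x)).
split; [exact: (has_integral_strip N hI)|exact: (has_integral_strip N hJ)|].
rewrite -big_split /=; under eq_bigr do rewrite hIJ.
rewrite -mulr_sumr; congr (_ * _).
rewrite -(big_mkord xpredT (fun n => v (d * n.+1%:R) * phi (d * n.+1%:R) -
  v (d * n%:R) * phi (d * n%:R))).
by rewrite (telescope_sumr (fun n => v (d * n%:R) * phi (d * n%:R)))// mulr0.
Qed.

Definition neg_line : set R := [set x | x < 0].

Lemma measurable_neg_line : measurable neg_line.
Proof.
have -> : neg_line = `]-oo, 0[%classic by apply/seteqP; split => x /=; rewrite in_itv.
exact: measurable_itv.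
Qed.

Lemma half_line_pos h : 0 < h -> half_line h = [set x | 0 <= x].
Proof.
by move=> h0; apply/seteqP; split => x; rewrite /half_line /= pmulr_lge0 ?invr_gt0.
Qed.

Lemma half_line_neg h : 0 < h -> half_line (- h) = [set x | x <= 0].
Proof.
move=> h0; apply/seteqP; split => x;
  by rewrite /half_line /= nmulr_lge0 ?invr_lt0 ?oppr_lt0.
Qed.

(** The two closed half-lines share the origin; dropping this null point from the left one yields a
    partition of the line. *)
Lemma has_integral_neg_line h f (I : R) : 0 < h ->
  has_integral (@leb1 R) (half_line (- h)) f I -> has_integral (@leb1 R) neg_line f I.
Proof.
move=> h0; have -> : half_line (- h) = `]-oo, 0]%classic.
  by rewrite half_line_neg//; apply/seteqP; split => x /=; rewrite in_itv.
have -> : neg_line = `]-oo, 0[%classic by apply/seteqP; split => x /=; rewrite in_itv.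
move=> [intf <-].
have intf' : (@leb1 R).-integrable `]-oo, 0[%classic (EFin \o f).
  apply: integrableS intf; [exact: measurable_itv|exact: measurable_itv|].
  by apply: subset_itvl; rewrite bnd_simp.
by split => //; rewrite (Rintegral_itv_bndo_bndc intf').
Qed.

Lemma has_integral_line hm hp f g F (I J : R) : 0 < hm -> 0 < hp ->
  (forall x, x < 0 -> F x = f x) -> (forall x, 0 <= x -> F x = g x) ->
  has_integral (@leb1 R) (half_line (- hm)) f I ->
  has_integral (@leb1 R) (half_line hp) g J -> has_integral (@leb1 R) setT F (I + J).
Proof.
move=> hm0 hp0 Ff Fg /(has_integral_neg_line hm0) hI hJ.
have {}hI : has_integral (@leb1 R) neg_line F I.
  apply: eq_has_integral hI; first exact: measurable_neg_line.
  by move=> x x0; rewrite Ff.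
have {}hJ : has_integral (@leb1 R) (half_line hp) F J.
  apply: eq_has_integral hJ; first exact: measurable_half_line.
  by rewrite half_line_pos// => x x0; rewrite Fg.
have -> : [set: R] = neg_line `|` half_line hp.
  rewrite half_line_pos//; apply/seteqP; split => // x _ /=.
  by case: (ltP x 0); [left|right].
apply: has_integralU => //.
- exact: measurable_neg_line.
- exact: measurable_half_line.
- rewrite half_line_pos//; apply/disj_set2P/seteqP; split => // x [/= x0].
  by rewrite leNgt x0.
Qed.

Definition line_slope hm hp v x : R :=
  if x < 0 then slope (- hm) v x else slope hp v x.

Lemma line_slope_neg hm hp v x : x < 0 -> line_slope hm hp v x = slope (- hm) v x.
Proof. by rewrite /line_slope => ->. Qed.

Lemma line_slope_pos hm hp v x : 0 <= x -> line_slope hm hp v x = slope hp v x.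
Proof. by rewrite /line_slope leNgt => /negbTE ->. Qed.

Lemma measurable_line_slope hm hp v : 0 < hm -> 0 < hp ->
  measurable_fun setT (line_slope hm hp v).
Proof.
move=> hm0 hp0; have -> : [set: R] = neg_line `|` half_line hp.
  rewrite half_line_pos//; apply/seteqP; split => // x _ /=.
  by case: (ltP x 0); [left|right].
apply/measurable_funU; [exact: measurable_neg_line|exact: measurable_half_line|split].
  apply: (@eq_measurable_fun _ _ _ _ _ (slope (- hm) v)).
    by move=> x /set_mem x0; rewrite /line_slope x0.
  apply: (@measurable_funS _ _ _ _ (half_line (- hm))); last exact: measurable_slope.
    exact: measurable_half_line.
  by rewrite half_line_neg// => x /ltW.
apply: (@eq_measurable_fun _ _ _ _ _ (slope hp v)); last exact: measurable_slope.
by move=> x /set_mem; rewrite half_line_pos// /line_slope /= leNgt => /negbTE ->.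
Qed.

Lemma L2_on_subset (A B : set R) v : measurable A -> measurable B -> A `<=` B ->
  L2_on B v -> L2_on A v.
Proof. by move=> mA mB AB; exact: integrableS. Qed.

Lemma L2_line_slope hm hp v : 0 < hm -> 0 < hp -> piecewise_linear hm hp v ->
  L2_on setT v -> L2_on setT (line_slope hm hp v).
Proof.
move=> hm0 hp0 [Pp Pm] intv.
have hpn : hp != 0 by rewrite gt_eqF.
have hmn : - hm != 0 by rewrite oppr_eq0 gt_eqF.
have ip := L2_slope hpn Pp (L2_on_subset (measurable_half_line hp) measurableT (@subsetT _ _) intv).
have im := L2_slope hmn Pm
  (L2_on_subset (measurable_half_line (- hm)) measurableT (@subsetT _ _) intv).
have [] // := has_integral_line (F := fun x => line_slope hm hp v x ^+ 2) hm0 hp0 _ _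
  (integrable_has_integral im) (integrable_has_integral ip).
- by move=> x x0; rewrite line_slope_neg.
- by move=> x x0; rewrite line_slope_pos.
Qed.

Lemma test_function_derive I phi x : test_function I phi ->
  is_derive x 1 phi (derive1 phi x).
Proof.
by move=> [dphi _]; rewrite derive1E; apply: DeriveDef => //; exact: (dphi 0%N x).
Qed.

Lemma test_function_continuous_derive I phi : test_function I phi ->
  continuous (derive1 phi).
Proof.
move=> [dphi _] x; apply: differentiable_continuous; apply/derivable1_diffP.
by have := dphi 1%N x; rewrite derive1n1.
Qed.

Lemma derive1_eq0 phi x : (\forall y \near x, phi y = 0) -> derive1 phi x = 0.
Proof.
move=> h; rewrite derive1E (@near_eq_derive _ _ _ phi (cst 0))//.
  exact: derive_cst.
Qed.

Lemma test_function_supp I phi : test_function I phi ->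
  exists2 L : R, 0 < L & forall x, L <= `|x| -> phi x = 0 /\ derive1 phi x = 0.
Proof.
move=> [_ [K [cK _ K0]]].
have [L [_ KL]] := compact_bounded cK.
(* [phi] already vanishes beyond [|L| + 1]; the extra unit provides a neighbourhood on which it is
   zero, so its derivative vanishes too. *)
exists (`|L| + 2); first by rewrite ltr_wpDl.
have nK x : `|L| + 1 < `|x| -> phi x = 0.
  move=> Lx; apply: K0 => Kx.
  have LL : L < `|L| + 1 by rewrite ltr_pwDr// ler_norm.
  by have := KL (`|L| + 1) LL x Kx; rewrite /= leNgt Lx.
move=> x Lx; have Lx1 : `|L| + 1 < `|x| by apply: lt_le_trans Lx; rewrite ltrD2l ltr1n.
split; first exact: nK.
apply: derive1_eq0.
have cn : continuous (fun y : R => `|y|) by move=> y; exact: norm_continuous.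
near=> y; apply: nK; near: y.
exact: (cvgr_gt _ (cn x)).
Unshelve. all: by end_near. Qed.

(** Both strips reach beyond the support of [phi], which kills the outer boundary terms; the two
    terms at the origin cancel because the orientations are opposite. *)
Lemma weak_derivative_line hm hp v : 0 < hm -> 0 < hp -> piecewise_linear hm hp v ->
  weak_derivative setT v (line_slope hm hp v).
Proof.
move=> hm0 hp0 Pv phi tphi; have [Pp Pm] := Pv.
have cv := continuous_piecewise_linear hm0 hp0 Pv.
have hpn : hp != 0 by rewrite gt_eqF.
have hmn : - hm != 0 by rewrite oppr_eq0 gt_eqF.
have [L L0 phi0] := test_function_supp tphi.
pose N := (maxn (Num.truncn (L / hp)) (Num.truncn (L / hm))).+1.
have Lp : L < hp * N%:R.
  rewrite mulrC -ltr_pdivrMr//; apply: lt_le_trans (truncnS_gt _) _.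
  by rewrite ler_nat ltnS leq_maxl.
have Lm : L < hm * N%:R.
  rewrite mulrC -ltr_pdivrMr//; apply: lt_le_trans (truncnS_gt _) _.
  by rewrite ler_nat ltnS leq_maxr.
have dphi x := test_function_derive x tphi.
have cdphi := test_function_continuous_derive tphi.
have [Ip [Jp [hIp hJp IJp]]] := strip_by_parts N hpn Pp cv dphi cdphi.
have [Im [Jm [hIm hJm IJm]]] := strip_by_parts N hmn Pm cv dphi cdphi.
have strip_half d : strip d N `<=` half_line d by move=> x /andP[].
have outp x : half_line hp x -> ~ strip hp N x -> L <= `|x|.
  rewrite /half_line /strip /= => x0; rewrite x0 /= => /negP; rewrite -leNgt => Nx.
  apply: ltW; apply: lt_le_trans Lp _; rewrite mulrC -ler_pdivlMr//.
  by rewrite (le_trans Nx)// ler_pM2r ?invr_gt0// ler_norm.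
have outm x : half_line (- hm) x -> ~ strip (- hm) N x -> L <= `|x|.
  rewrite /half_line /strip /= => x0; rewrite x0 /= => /negP; rewrite -leNgt => Nx.
  apply: ltW; apply: lt_le_trans Lm _; rewrite mulrC -ler_pdivlMr// (le_trans Nx)//.
  by rewrite invrN mulrN -mulNr ler_pM2r ?invr_gt0// -normrN ler_norm.
have ext d f I : (forall x, half_line d x -> ~ strip d N x -> f x = 0) ->
    has_integral (@leb1 R) (strip d N) f I -> has_integral (@leb1 R) (half_line d) f I.
  by apply: has_integral_extend; [exact: measurable_strip|exact: measurable_half_line|].
have {}hIp : has_integral (@leb1 R) (half_line hp) (fun x => v x * derive1 phi x) Ip.
  by apply: (ext _ _ _ _ hIp) => x Hx Sx; rewrite (phi0 _ (outp _ Hx Sx)).2 mulr0.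
have {}hJp : has_integral (@leb1 R) (half_line hp) (fun x => slope hp v x * phi x) Jp.
  by apply: (ext _ _ _ _ hJp) => x Hx Sx; rewrite (phi0 _ (outp _ Hx Sx)).1 mulr0.
have {}hIm : has_integral (@leb1 R) (half_line (- hm)) (fun x => v x * derive1 phi x) Im.
  by apply: (ext _ _ _ _ hIm) => x Hx Sx; rewrite (phi0 _ (outm _ Hx Sx)).2 mulr0.
have {}hJm : has_integral (@leb1 R) (half_line (- hm)) (fun x => slope (- hm) v x * phi x) Jm.
  by apply: (ext _ _ _ _ hJm) => x Hx Sx; rewrite (phi0 _ (outm _ Hx Sx)).1 mulr0.
rewrite (has_integralE (has_integral_line hm0 hp0 _ _ hIm hIp))//.
have hJ : has_integral (@leb1 R) setT (fun x => line_slope hm hp v x * phi x) (Jm + Jp).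
  apply: (has_integral_line hm0 hp0 _ _ hJm hJp) => x x0.
    by rewrite line_slope_neg.
  by rewrite line_slope_pos.
rewrite (has_integralE hJ); apply/eqP; rewrite -subr_eq0 opprK.
have -> : Im + Ip + (Jm + Jp) = (Im + Jm) + (Ip + Jp) by ring.
rewrite IJp IJm.
have [-> _] : phi (hp * N%:R) = 0 /\ derive1 phi (hp * N%:R) = 0.
  by apply: phi0; rewrite ger0_norm ?(ltW Lp)// (le_trans (ltW L0) (ltW Lp)).
have [-> _] : phi (- hm * N%:R) = 0 /\ derive1 phi (- hm * N%:R) = 0.
  by apply: phi0; rewrite mulNr normrN ger0_norm ?(ltW Lm)// (le_trans (ltW L0) (ltW Lm)).
rewrite sgrN gtr0_sg// gtr0_sg//; apply/eqP; ring.
Qed.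

Lemma node_nat hm hp n : node hm hp n%:Z = hp * n%:R.
Proof. by []. Qed.

Lemma node_opp_nat hm hp n : node hm hp (- n%:Z) = - (hm * n%:R).
Proof.
by case: n => [|n]; rewrite /node /= ?mulr0 ?oppr0// intrN mulrN.
Qed.

Lemma cell_pos h n : 0 < h -> cell h n = [set x | h * n%:R <= x < h * n.+1%:R].
Proof.
move=> h0; apply/seteqP; split => x; rewrite /cell /=;
  by rewrite ler_pdivlMr// ltr_pdivrMr// !(mulrC h).
Qed.

Lemma cell_neg h n : 0 < h -> cell (- h) n = [set x | - (h * n.+1%:R) < x <= - (h * n%:R)].
Proof.
move=> h0; have hN : - h < 0 by rewrite oppr_lt0.
apply/seteqP; split => x; rewrite /cell /=;
  by rewrite ler_ndivlMr// ltr_ndivrMr// !mulrN !(mulrC h) andbC.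
Qed.

(** The weak derivative is [line_slope], square-integrable by the inverse inequality. The cell [n]
    of the mesh [- hm] lies between the nodes of index [- n.+1] and [- n]. *)
Lemma VspaceP hm hp v : 0 < hm -> 0 < hp ->
  Vspace hm hp v <-> piecewise_linear hm hp v /\ L2_on setT v.
Proof.
move=> hm0 hp0; split.
  move=> [[cv [mv intv] _] av].
  have {}cv : continuous v by apply/continuous_subspace_setT; rewrite closureT in cv.
  split=> //; split.
    move=> n t t01; apply: (@P1_of_affine hp v n.+1) => // k _.
      exact: continuous_subspaceT.
    have := av k%:Z; rewrite (_ : (k%:Z + 1)%R = k.+1%:Z) ?node_nat//.
    by rewrite intS addrC.
  apply: P1_of_affine_neg => // n.
  have := av (- n.+1%:Z); rewrite (_ : (- n.+1%:Z + 1)%R = - n%:Z) ?node_opp_nat//.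
  by rewrite intS opprD addrAC addNr add0r.
move=> [Pv intv]; have [Pp Pm] := Pv.
have cv := continuous_piecewise_linear hm0 hp0 Pv.
have hpn : hp != 0 by rewrite gt_eqF.
have hmn : - hm != 0 by rewrite oppr_eq0 gt_eqF.
split; first split.
- exact: continuous_subspaceT.
- by split=> //; exact: continuous_measurable_fun.
- exists (line_slope hm hp v); split; last exact: weak_derivative_line.
  by split; [exact: measurable_line_slope|exact: L2_line_slope].
- move=> [n|n].
    rewrite (_ : (Posz n + 1)%R = n.+1%:Z) ?node_nat; last by rewrite intS addrC.
    apply: affine_onS (P1_affine n hpn Pp); rewrite cell_pos// => x /=.
    by rewrite in_itv /= => /andP[/ltW -> ->].
  rewrite NegzE (_ : (- n.+1%:Z + 1)%R = - n%:Z) ?node_opp_nat; last first.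
    by rewrite intS opprD addrAC addNr add0r.
  apply: affine_onS (P1_affine n hmn Pm); rewrite cell_neg// => x /=.
  by rewrite in_itv /= => /andP[-> /ltW ->].
Qed.

Lemma P1_neg_eq0 h v : 0 < h -> (forall x, x <= 0 -> v x = 0) -> P1 (- h) v.
Proof.
move=> h0 v0 n t /andP[t0 t1].
have le0 (y : R) : 0 <= y -> - h * y <= 0 by move=> y0; rewrite mulNr oppr_le0 mulr_ge0// ltW.
by rewrite !v0 ?le0 ?mulr0 ?addr0// addr_ge0.
Qed.

Lemma hy_gt0 M : (0 < M)%N -> 0 < hy R M.
Proof. by move=> M0; rewrite divr_gt0 ?pi_gt0// ltr0n. Qed.

Lemma hyM M : (0 < M)%N -> hy R M * M%:R = pi.
Proof. by move=> M0; rewrite divfK// pnatr_eq0 -lt0n. Qed.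

Definition zero_outside v : Prop := forall x, ~ (0 < x < pi) -> v x = 0.

Lemma zero_outside_ge v x : zero_outside v -> pi <= x -> v x = 0.
Proof. by move=> v0 x_pi; apply: v0 => /andP[_]; rewrite ltNge x_pi. Qed.

Lemma zero_outside_le v x : zero_outside v -> x <= 0 -> v x = 0.
Proof. by move=> v0 x0; apply: v0 => /andP[]; rewrite ltNge x0. Qed.

Lemma zero_outside_piecewise_linear h v : 0 < h -> P1 h v -> zero_outside v ->
  piecewise_linear h h v.
Proof.
by move=> h0 Pv v0; split=> //; apply: P1_neg_eq0 => // x; exact: zero_outside_le.
Qed.

Lemma strip_hy M : (0 < M)%N -> strip (hy R M) M = `[0, pi[%classic.
Proof.
move=> M0; have h0 := hy_gt0 M0; apply/seteqP; split => x; rewrite /strip /= in_itv /=;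
  by rewrite pmulr_lge0 ?invr_gt0// ltr_pdivrMr// mulrC hyM.
Qed.

Lemma has_integral_open_strip M f (I : R) : (0 < M)%N ->
  has_integral (@leb1 R) (strip (hy R M) M) f I ->
  has_integral (@leb1 R) `]0, pi[ f I.
Proof.
move=> M0; rewrite strip_hy// => -[intf <-].
have intf' : (@leb1 R).-integrable `]0, pi[%classic (EFin \o f).
  apply: integrableS intf; [exact: measurable_itv|exact: measurable_itv|].
  by apply: subset_itvr; rewrite bnd_simp.
by split => //; rewrite (Rintegral_itv_obnd_cbnd intf').
Qed.

(** [P1] speaks of all cells of the half-line: the first [M] of them carry the affine pieces, and on
    the later ones all values are zero. *)
Lemma WspaceP M w : (0 < M)%N -> Wspace M w <-> P1 (hy R M) w /\ zero_outside w.
Proof.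
move=> M0; have h0 := hy_gt0 M0; have hn : hy R M != 0 by rewrite gt_eqF.
have hpi n : (n <= M)%N -> hy R M * n%:R <= pi.
  by move=> nM; rewrite -(hyM M0) ler_pM2l// ler_nat.
split.
  move=> [[[cw _ _] w0] aw]; split=> // n t t01.
  have [nM|Mn] := ltnP n M.
    apply: (@P1_of_affine (hy R M) w M) => // k kM.
    apply: continuous_subspaceW cw => x /=.
    rewrite in_itv /= => /andP[kx xk].
    apply: segment_sub_closure; first exact: pi_gt0.
    rewrite /= in_itv /=.
    have k0 : 0 <= hy R M * k%:R by apply: mulr_ge0 => //; exact: ltW.
    by rewrite (le_trans k0 kx) (le_trans xk (hpi _ kM)).
  have ge_pi (y : R) : n%:R <= y -> w (hy R M * y) = 0.
    move=> ny; apply: (zero_outside_ge w0); rewrite -(hyM M0) ler_pM2l//.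
    by apply: (le_trans _ ny); rewrite ler_nat.
  by rewrite !ge_pi ?mulr0 ?addr0 ?ler_nat// lerDl; case/andP: t01.
move=> [Pw w0].
have Plw := zero_outside_piecewise_linear h0 Pw w0.
have cw := continuous_piecewise_linear h0 h0 Plw.
have mw : measurable_fun setT w by exact: continuous_measurable_fun.
split; last first.
  move=> n nM; apply: affine_onS (P1_affine n hn Pw); rewrite cell_pos// => x /=.
  by rewrite in_itv /= => /andP[/ltW -> ->].
split=> //; split.
- exact: continuous_subspaceT.
- split; first exact: measurable_funTS.
  by case: (has_integral_open_strip M0 (has_integral_strip_sqr M hn Pw)).
- exists (slope (hy R M) w); split.
    split; last by case: (has_integral_open_strip M0 (has_integral_strip_sqr_slope M hn Pw)).
    apply: (@measurable_funS _ _ _ _ (half_line (hy R M))); last exact: measurable_slope.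
      exact: measurable_half_line.
    by rewrite half_line_pos// => x /=; rewrite in_itv /= => /andP[/ltW].
  move=> phi tphi.
  have dphi x := test_function_derive x tphi.
  have cdphi := test_function_continuous_derive tphi.
  have [I [J [hI hJ IJ]]] := strip_by_parts M hn Pw cw dphi cdphi.
  rewrite (has_integralE (has_integral_open_strip M0 hI)).
  rewrite (has_integralE (has_integral_open_strip M0 hJ)).
  move: IJ; rewrite hyM// (zero_outside_ge w0)// (zero_outside_le w0)//.
  by rewrite !mul0r subrr mulr0 => /eqP; rewrite addr_eq0 => /eqP.
Qed.

End DiscreteSpaceCharacterization.

(** * Bilinear forms on tensor products *)

Section TensorForms.
Variable R : realType.
Implicit Types (d x t hm hp h a b lam : R) (u v w f g F : R -> R) (k n N M : nat).

Definition nodes d : set R := range (fun n : nat => d * n%:R).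

Lemma countable_nodes d : countable (nodes d).
Proof. exact: card_image_le. Qed.

Lemma is_derive_slope d v x : d != 0 -> P1 d v -> half_line d x -> ~ nodes d x ->
  is_derive x 1 v (slope d v x).
Proof.
move=> d0 Pv Hx Nx; pose n := Num.truncn (x / d).
have /andP[nx xn] : n%:R <= x / d < n.+1%:R by exact: truncn_itv.
have {}nx : n%:R < x / d.
  rewrite lt_neqAle nx andbT; apply/eqP => e; apply: Nx.
  by exists n => //; rewrite e mulrC divfK.
have cx : cell d n x by rewrite /cell /= xn ltW.
pose c := (v (d * n.+1%:R) - v (d * n%:R)) / d.
have dA : is_derive x 1 (fun y => v (d * n%:R) + c * (y - d * n%:R)) c.
  by apply: is_derive_eq; rewrite /GRing.scale /=; ring.
rewrite (slope_cell _ cx) -/c; apply: near_eq_is_derive dA.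
have cd : (fun y => y / d) y @[y --> x] --> x / d by apply: cvgM; [exact: cvg_id|exact: cvg_cst].
near=> y; rewrite (@P1_cell _ d v n y)//; first by rewrite /c; field.
rewrite /cell /=; apply/andP; split.
  by apply: ltW; near: y; exact: (cvgr_gt _ cd).
by near: y; exact: (cvgr_lt _ cd).
Unshelve. all: by end_near. Qed.

Lemma is_derive_line_slope hm hp v x : 0 < hm -> 0 < hp -> piecewise_linear hm hp v ->
  ~ (nodes hp `|` nodes (- hm)) x -> is_derive x 1 v (line_slope hm hp v x).
Proof.
move=> hm0 hp0 [Pp Pm] Nx; have [x0|x0] := ltP x 0.
  rewrite line_slope_neg//; apply: is_derive_slope => //.
  - by rewrite oppr_eq0 gt_eqF.
  - by rewrite half_line_neg//; exact: ltW.
  - by move=> Nx'; apply: Nx; right.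
rewrite line_slope_pos//; apply: is_derive_slope => //.
- by rewrite gt_eqF.
- by rewrite half_line_pos.
- by move=> Nx'; apply: Nx; left.
Qed.

Lemma derive1_lincomb k (v : 'I_k -> R -> R) (dv c : 'I_k -> R) x :
  (forall i, is_derive x 1 (v i) (dv i)) ->
  derive1 (fun x => \sum_(i < k) v i x * c i) x = \sum_(i < k) dv i * c i.
Proof.
move=> vdv; suff h : is_derive x 1 (fun x => \sum_(i < k) v i x * c i) (\sum_(i < k) dv i * c i).
  by rewrite derive1E; case: h.
elim: k v dv c vdv => [|k IHk] v dv c vdv.
  rewrite big_ord0 (_ : (fun _ => _) = cst 0); first exact: is_derive_cst.
  by apply/funext => y; rewrite big_ord0.
rewrite big_ord_recr /= (_ : (fun _ => _) =
  (fun x => \sum_(i < k) v (widen_ord (leqnSn k) i) x * c (widen_ord (leqnSn k) i)) \+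
  (fun x => v ord_max x * c ord_max)); last by apply/funext => y; rewrite big_ord_recr.
apply: is_deriveD; first by apply: IHk.
have h := vdv ord_max; apply: is_derive_eq.
by rewrite /GRing.scale /=; ring.
Qed.

Definition tens k (v w : 'I_k -> R -> R) : R * R -> R :=
  fun p => \sum_(i < k) v i p.1 * w i p.2.

Lemma dx_tens k (v w : 'I_k -> R -> R) (dv : 'I_k -> R) (p : R * R) :
  (forall i, is_derive p.1 1 (v i) (dv i)) ->
  dx (tens v w) p = \sum_(i < k) dv i * w i p.2.
Proof. by move=> vdv; rewrite /dx /tens /= (derive1_lincomb _ vdv). Qed.

Lemma dy_tens k (v w : 'I_k -> R -> R) (dw : 'I_k -> R) (p : R * R) :
  (forall i, is_derive p.2 1 (w i) (dw i)) ->
  dy (tens v w) p = \sum_(i < k) v i p.1 * dw i.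
Proof.
move=> wdw; rewrite /dy /tens /=.
under eq_fun do under eq_bigr do rewrite mulrC.
by rewrite (derive1_lincomb _ wdw); apply: eq_bigr => i _; rewrite mulrC.
Qed.

Definition half_stiff d u v : R := \int[@leb1 R]_(x in half_line d) (slope d u x * slope d v x).
Definition half_mass d u v : R := \int[@leb1 R]_(x in half_line d) (u x * v x).
Definition seg_stiff h u v : R := \int[@leb1 R]_(y in `]0, pi[) (slope h u y * slope h v y).
Definition seg_mass u v : R := \int[@leb1 R]_(y in `]0, pi[) (u y * v y).

(** By [VspaceP], membership in [Vspace hm hp]; [seg_fun] plays the same role for [Wspace] through
    [WspaceP]. *)
Definition line_fun hm hp v : Prop := piecewise_linear hm hp v /\ L2_on setT v.

Lemma line_fun_measurable hm hp v (A : set R) : 0 < hm -> 0 < hp -> line_fun hm hp v ->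
  measurable_fun A v.
Proof.
move=> hm0 hp0 [/(continuous_piecewise_linear hm0 hp0) cv _].
by apply: measurable_funTS; exact: continuous_measurable_fun.
Qed.

Lemma line_fun_L2 hm hp v d : line_fun hm hp v -> L2_on (half_line d) v.
Proof.
by case=> _; apply: L2_on_subset => //; exact: measurable_half_line.
Qed.

Lemma has_integral_half_mass hm hp u v d : 0 < hm -> 0 < hp ->
  line_fun hm hp u -> line_fun hm hp v ->
  has_integral (@leb1 R) (half_line d) (fun x => u x * v x) (half_mass d u v).
Proof.
move=> hm0 hp0 lu lv; apply: integrable_has_integral.
apply: (@integrable_mulL2 _ (measurableTypeR R)).
- exact: measurable_half_line.
- exact: line_fun_measurable lu.
- exact: line_fun_measurable lv.
- exact: line_fun_L2 lu.
- exact: line_fun_L2 lv.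
Qed.

Lemma has_integral_half_stiff hm hp u v d : d != 0 -> P1 d u -> P1 d v ->
  line_fun hm hp u -> line_fun hm hp v ->
  has_integral (@leb1 R) (half_line d) (fun x => slope d u x * slope d v x)
    (half_stiff d u v).
Proof.
move=> d0 Pu Pv lu lv; apply: integrable_has_integral.
apply: (@integrable_mulL2 _ (measurableTypeR R)).
- exact: measurable_half_line.
- exact: measurable_slope.
- exact: measurable_slope.
- by apply: L2_slope => //; exact: line_fun_L2 lu.
- by apply: L2_slope => //; exact: line_fun_L2 lv.
Qed.

Definition seg_fun M w : Prop := P1 (hy R M) w /\ zero_outside w.

Lemma has_integral_seg_mass M u v : (0 < M)%N -> seg_fun M u -> seg_fun M v ->
  has_integral (@leb1 R) `]0, pi[ (fun y => u y * v y) (seg_mass u v).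
Proof.
move=> M0 [Pu _] [Pv _]; have hn : hy R M != 0 by rewrite gt_eqF// hy_gt0.
apply: integrable_has_integral.
have [int _] := has_integral_open_strip M0 (has_integral_strip_energy M 0 1 hn Pu Pv).
apply: eq_integrable int; first exact: measurable_itv.
by move=> x _ /=; rewrite mul0r add0r mul1r.
Qed.

Lemma has_integral_seg_stiff M u v : (0 < M)%N -> seg_fun M u -> seg_fun M v ->
  has_integral (@leb1 R) `]0, pi[ (fun y => slope (hy R M) u y * slope (hy R M) v y)
    (seg_stiff (hy R M) u v).
Proof.
move=> M0 [Pu _] [Pv _]; have hn : hy R M != 0 by rewrite gt_eqF// hy_gt0.
apply: integrable_has_integral.
have [int _] := has_integral_open_strip M0 (has_integral_strip_energy M 1 0 hn Pu Pv).
apply: eq_integrable int; first exact: measurable_itv.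
by move=> x _ /=; rewrite mul0r addr0 mul1r.
Qed.

(** The null set off which the classical partial derivatives of tensors of discrete functions are
    given by slopes. *)
Definition grid hm hp h : set (R * R) :=
  ((nodes hp `|` nodes (- hm)) `*` setT) `|` (setT `*` nodes h).

Lemma measurable_countable (A : set R) : countable A ->
  measurable (A : set (measurableTypeR R)).
Proof. by apply: countable_measurable => x; exact: measurable_set1. Qed.

Lemma countable_x_nodes hm hp : countable (nodes hp `|` nodes (- hm)).
Proof.
apply: (@sub_countable _ _ _ (range (node hm hp)));
  last exact: sub_countable (card_image_le _ _) (countableP _).
apply: subset_card_le => _ [[n _ <-]|[n _ <-]]; first by exists n%:Z.
by exists (- n%:Z) => //; rewrite node_opp_nat mulNr.
Qed.

Lemma measurable_grid hm hp h :
  measurable (grid hm hp h : set (measurableTypeR R * measurableTypeR R)).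
Proof.
apply: measurableU; apply: measurableX => //.
  by apply: measurable_countable; exact: countable_x_nodes.
by apply: measurable_countable; exact: countable_nodes.
Qed.

Lemma leb2_grid hm hp h : @leb2 R (grid hm hp h) = 0.
Proof.
have mx := measurable_countable (countable_x_nodes hm hp).
have my := measurable_countable (countable_nodes h).
have mX1 := measurableX mx (@measurableT _ (measurableTypeR R)).
have mX2 := measurableX (@measurableT _ (measurableTypeR R)) my.
apply/eqP; rewrite -measure_le0.
apply: (le_trans (measureU2 _ mX1 mX2)).
have e1 : @leb2 R ((nodes hp `|` nodes (- hm)) `*` [set: measurableTypeR R]) = 0.
  transitivity (@lebesgue_measure R (nodes hp `|` nodes (- hm)) * @lebesgue_measure R setT)%E.
    exact: product_measure1E.
  by rewrite countable_lebesgue_measure0 ?mul0e//; exact: countable_x_nodes.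
have e2 : @leb2 R ([set: measurableTypeR R] `*` nodes h) = 0.
  transitivity (@lebesgue_measure R setT * @lebesgue_measure R (nodes h))%E.
    exact: product_measure1E.
  rewrite [X in (_ * X)%E]countable_lebesgue_measure0 ?mule0//; exact: countable_nodes.
by rewrite -[leRHS]adde0; apply: leeD; [rewrite -e1|rewrite -e2]; exact: lexx.
Qed.

Lemma has_integral_weight hm hp a b (f g F : R -> R) (I J : R) : 0 < hm -> 0 < hp ->
  (forall x, x < 0 -> F x = f x) -> (forall x, 0 <= x -> F x = g x) ->
  has_integral (@leb1 R) (half_line (- hm)) f I ->
  has_integral (@leb1 R) (half_line hp) g J ->
  has_integral (@leb1 R) setT (fun x => (if x < 0 then a else b) * F x) (a * I + b * J).
Proof.
move=> hm0 hp0 Ff Fg hI hJ.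
apply: (@has_integral_line _ hm hp (fun x => a * f x) (fun x => b * g x)) => //.
- by move=> x x0; rewrite x0 Ff.
- by move=> x x0; rewrite ltNge x0 /= Fg.
- by apply: has_integralZ => //; exact: measurable_half_line.
- by apply: has_integralZ => //; exact: measurable_half_line.
Qed.

Lemma has_integral_Omega (F G : R -> R) (I J : R) :
  has_integral (@leb1 R) setT F I -> has_integral (@leb1 R) `]0, pi[ G J ->
  has_integral (@leb2 R) (@Omega R) (fun p => F p.1 * G p.2) (I * J).
Proof.
move=> hF hG; have -> : @Omega R = [set p | `]0, pi[%classic p.2].
  by apply/seteqP; split => p /=; rewrite in_itv.
apply: (@has_integral_prod _ _ (measurableTypeR R) (measurableTypeR R) R
  (@lebesgue_measure R) (@lebesgue_measure R) F G `]0, pi[%classic I J) => //.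
Qed.

(** Off the grid the partial derivatives are slopes, and the weight depends on [x] alone, so Fubini
    splits each pair into stiffness times mass plus mass times stiffness. *)
Lemma aform_tens hm hp M a b k l (v w : 'I_k -> R -> R) (v' w' : 'I_l -> R -> R) :
  0 < hm -> 0 < hp -> (0 < M)%N ->
  (forall i, line_fun hm hp (v i)) -> (forall i, seg_fun M (w i)) ->
  (forall j, line_fun hm hp (v' j)) -> (forall j, seg_fun M (w' j)) ->
  aform a b (tens v w) (tens v' w') = \sum_(i < k) \sum_(j < l)
    ((a * half_stiff (- hm) (v i) (v' j) + b * half_stiff hp (v i) (v' j)) *
       seg_mass (w i) (w' j) +
     (a * half_mass (- hm) (v i) (v' j) + b * half_mass hp (v i) (v' j)) *
       seg_stiff (hy R M) (w i) (w' j)).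
Proof.
move=> hm0 hp0 M0 lv sw lv' sw'; have h0 := hy_gt0 R M0.
pose ls := line_slope hm hp; pose ss := slope (hy R M).
have mO : measurable (@Omega R : set (measurableTypeR R * measurableTypeR R)).
  have -> : @Omega R = [set p | `]0, pi[%classic p.2].
    by apply/seteqP; split => p /=; rewrite in_itv.
  by rewrite -[X in measurable X]setTI; apply: measurable_snd => //; exact: measurable_itv.
transitivity (\int[@leb2 R]_(p in @Omega R) (\sum_(i < k) \sum_(j < l)
    (((if p.1 < 0 then a else b) * (ls (v i) p.1 * ls (v' j) p.1)) * (w i p.2 * w' j p.2) +
     ((if p.1 < 0 then a else b) * (v i p.1 * v' j p.1)) * (ss (w i) p.2 * ss (w' j) p.2)))).
  apply: (eq_Rintegral_off_null (measurable_grid hm hp (hy R M)) (leb2_grid _ _ _)).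
  move=> p /andP[p0 ppi] Np.
  have Nx : ~ (nodes hp `|` nodes (- hm)) p.1 by move=> H; apply: Np; left.
  have Ny : ~ nodes (hy R M) p.2 by move=> H; apply: Np; right.
  have dv i : is_derive p.1 1 (v i) (ls (v i) p.1).
    by apply: is_derive_line_slope => //; case: (lv i).
  have dv' j : is_derive p.1 1 (v' j) (ls (v' j) p.1).
    by apply: is_derive_line_slope => //; case: (lv' j).
  have hp2 : half_line (hy R M) p.2 by rewrite half_line_pos//; exact: ltW.
  have dw i : is_derive p.2 1 (w i) (ss (w i) p.2).
    by apply: is_derive_slope => //; [rewrite gt_eqF|case: (sw i)].
  have dw' j : is_derive p.2 1 (w' j) (ss (w' j) p.2).
    by apply: is_derive_slope => //; [rewrite gt_eqF|case: (sw' j)].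
  rewrite /sigma /grad_dot (dx_tens w dv) (dx_tens w' dv') (dy_tens v dw) (dy_tens v' dw').
  rewrite !big_distrlr /= -big_split mulr_sumr; apply: eq_bigr => i _.
  rewrite -big_split mulr_sumr; apply: eq_bigr => j _ /=.
  set c := if _ then _ else _. ring.
apply: has_integralE; apply: has_integral_sum => // i; apply: has_integral_sum => // j.
apply: has_integralD => //.
  apply: (@has_integral_Omega
    (fun x => (if x < 0 then a else b) * (ls (v i) x * ls (v' j) x)) (fun y => w i y * w' j y));
    last exact: has_integral_seg_mass (sw i) (sw' j).
  have [[Pp Pm] _] := lv i; have [[Pp' Pm'] _] := lv' j.
  apply: (@has_integral_weight hm hp _ _
    (fun x => slope (- hm) (v i) x * slope (- hm) (v' j) x)
    (fun x => slope hp (v i) x * slope hp (v' j) x)) => //.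
  - by move=> x x0; rewrite /ls !line_slope_neg.
  - by move=> x x0; rewrite /ls !line_slope_pos.
  - by apply: has_integral_half_stiff (lv i) (lv' j) => //; rewrite oppr_eq0 gt_eqF.
  - by apply: has_integral_half_stiff (lv i) (lv' j) => //; rewrite gt_eqF.
apply: (@has_integral_Omega
  (fun x => (if x < 0 then a else b) * (v i x * v' j x)) (fun y => ss (w i) y * ss (w' j) y));
  last exact: has_integral_seg_stiff (sw i) (sw' j).
apply: (@has_integral_weight hm hp _ _ (fun x => v i x * v' j x)
  (fun x => v i x * v' j x)) => //.
- exact: has_integral_half_mass (lv i) (lv' j).
- exact: has_integral_half_mass (lv i) (lv' j).
Qed.

End TensorForms.

(** * The discrete sine basis *)

Section SineBasis.
Variable R : realType.
Implicit Types (d x t h lam : R) (u v w : R -> R) (a : nat -> R) (k n N M : nat).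

Definition interp d a x : R :=
  let n := Num.truncn (x / d) in a n + (x / d - n%:R) * (a n.+1 - a n).

Lemma interp_node d a n : d != 0 -> interp d a (d * n%:R) = a n.
Proof.
move=> d0; have e : d * n%:R / d = n%:R by rewrite mulrAC divff// mul1r.
by rewrite /interp e (@truncn_def _ n%:R n) ?subrr ?mul0r ?addr0// lexx ltr_nat ltnSn.
Qed.

Lemma P1_interp d a : d != 0 -> P1 d (interp d a).
Proof.
move=> d0 n t /andP[t0 t1]; rewrite !interp_node//.
move: t1; rewrite le_eqVlt => /predU1P[->|t1].
  by rewrite natr1 interp_node// subrr mul0r add0r mul1r.
rewrite /interp mulrAC divff// mul1r.
rewrite (@truncn_def _ (n%:R + t) n); last by rewrite lerDl t0 /= -natr1 ltrD2l.
by rewrite addrAC subrr add0r; ring.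
Qed.

Lemma P1_eq0 d v : d != 0 -> P1 d v -> (forall n, v (d * n%:R) = 0) ->
  forall x, half_line d x -> v x = 0.
Proof.
move=> d0 Pv v0 x; rewrite -bigcup_cell => -[n _ cx].
by rewrite (P1_cell d0 Pv cx) !v0 !mulr0 addr0.
Qed.

Lemma P1_lincomb d k (c : 'I_k -> R) (v : 'I_k -> R -> R) :
  (forall i, P1 d (v i)) -> P1 d (fun x => \sum_(i < k) c i * v i x).
Proof.
move=> Pv n t t01; rewrite !mulr_sumr -big_split /=; apply: eq_bigr => i _.
by rewrite (Pv i n t t01); ring.
Qed.

Lemma seg_fun_lincomb M k (c : 'I_k -> R) (v : 'I_k -> R -> R) :
  (forall i, seg_fun M (v i)) -> seg_fun M (fun x => \sum_(i < k) c i * v i x).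
Proof.
move=> sv; split; first by apply: P1_lincomb => i; case: (sv i).
by move=> x Nx; rewrite big1// => i _; case: (sv i) => _ ->; rewrite ?mulr0.
Qed.

Lemma seg_mass_lincomb M k (c : 'I_k -> R) (v : 'I_k -> R -> R) w : (0 < M)%N ->
  (forall i, seg_fun M (v i)) -> seg_fun M w ->
  seg_mass (fun x => \sum_(i < k) c i * v i x) w = \sum_(i < k) c i * seg_mass (v i) w.
Proof.
move=> M0 sv sw; apply: has_integralE.
have mI : measurable (`]0, pi[%classic : set (measurableTypeR R)) by exact: measurable_itv.
have := has_integral_sum mI (fun i => has_integralZ (c i) mI (has_integral_seg_mass M0 (sv i) sw)).
apply: eq_has_integral => // y _.
by rewrite mulr_suml; apply: eq_bigr => i _; ring.
Qed.

Lemma seg_massC u v : seg_mass u v = seg_mass v u.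
Proof. by apply: eq_Rintegral => x _; rewrite mulrC. Qed.

Lemma seg_stiffC h u v : seg_stiff h u v = seg_stiff h v u.
Proof. by apply: eq_Rintegral => x _; rewrite mulrC. Qed.

Lemma seg_mass_gt0 M w n : (0 < M)%N -> seg_fun M w -> (n < M)%N ->
  w (hy R M * n%:R) != 0 -> 0 < seg_mass w w.
Proof.
move=> M0 sw nM wn; have [Pw _] := sw; have h0 := hy_gt0 R M0.
have hn : hy R M != 0 by rewrite gt_eqF.
have := has_integral_open_strip M0 (has_integral_strip_sqr M hn Pw).
move=> /has_integralE E; have -> : seg_mass w w = \int[@leb1 R]_(x in `]0, pi[) w x ^+ 2.
  by apply: eq_Rintegral => x _; rewrite expr2.
rewrite E; have ge0 (i : 'I_M) : true -> 0 <= `|hy R M| / 3 *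
    (w (hy R M * i%:R) ^+ 2 + w (hy R M * i.+1%:R) ^+ 2 + w (hy R M * i%:R) * w (hy R M * i.+1%:R)).
  by move=> _; rewrite mulr_ge0 ?divr_ge0//; nra.
rewrite lt_neqAle sumr_ge0// andbT eq_sym psumr_neq0//.
apply/hasP; exists (Ordinal nM); first by rewrite mem_index_enum.
rewrite /= mulr_gt0 ?divr_gt0 ?normr_gt0//.
have : 0 < w (hy R M * n%:R) ^+ 2 by rewrite exprn_even_gt0.
nra.
Qed.

Definition theta M k : R := pi * k%:R / M%:R.

Definition sine_seq M k n : R := sin (theta M k * n%:R).

(** The sine sequence continues past the node [M], where it vanishes; the cut-off provides the
    extension by zero required by [H10]. *)
Definition sine_mode M k x : R :=
  if 0 < x < pi then interp (hy R M) (sine_seq M k) x else 0.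

(* h^2 times the k-th discrete Dirichlet eigenvalue of - D^2, as a function of
   the angle theta M k. *)
Definition symbol t : R := 6 * (1 - cos t) / (2 + cos t).

Definition eigval M k : R := symbol (theta M k) / hy R M ^+ 2.

Lemma sine_seqM M k : (0 < M)%N -> sine_seq M k M = 0.
Proof.
move=> M0; rewrite /sine_seq /theta divfK ?pnatr_eq0 -?lt0n//.
elim: k => [|k IHk]; first by rewrite mulr0 sin0.
by rewrite -natr1 mulrDr mulr1 sinDpi IHk oppr0.
Qed.

Lemma sine_mode_segment M k x : (0 < M)%N -> 0 <= x <= pi ->
  sine_mode M k x = interp (hy R M) (sine_seq M k) x.
Proof.
move=> M0 /andP[x0 xpi]; have h0 := hy_gt0 R M0; have hn : hy R M != 0 by rewrite gt_eqF.
rewrite /sine_mode; case: ifPn => //; rewrite negb_and -!leNgt => /orP[x0'|xpi'].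
  have -> : x = hy R M * 0%:R by apply/eqP; rewrite mulr0 eq_le x0 x0'.
  by rewrite interp_node// /sine_seq mulr0 sin0.
have -> : x = hy R M * M%:R by apply/eqP; rewrite hyM// eq_le xpi xpi'.
by rewrite interp_node// sine_seqM.
Qed.

Lemma sine_mode_node M k n : (0 < M)%N -> (n <= M)%N ->
  sine_mode M k (hy R M * n%:R) = sine_seq M k n.
Proof.
move=> M0 nM; have h0 := hy_gt0 R M0.
rewrite sine_mode_segment//; first by rewrite interp_node// gt_eqF.
by rewrite mulr_ge0 ?(ltW h0)//= -(hyM R M0) ler_pM2l// ler_nat.
Qed.

Lemma seg_fun_sine_mode M k : (0 < M)%N -> seg_fun M (sine_mode M k).
Proof.
move=> M0; have h0 := hy_gt0 R M0; have hn : hy R M != 0 by rewrite gt_eqF.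
have out : zero_outside (sine_mode M k).
  by move=> x /negP/negbTE Nx; rewrite /sine_mode Nx.
split=> // n t /andP[t0 t1]; have [nM|Mn] := ltnP n M.
  have := @P1_interp (hy R M) (sine_seq M k) hn n t; rewrite t0 t1 => /(_ isT).
  rewrite !interp_node// !sine_mode_node// 1?ltnW// => <-.
  apply: sine_mode_segment => //.
  rewrite mulr_ge0 ?(ltW h0) ?addr_ge0//= -(hyM R M0) ler_pM2l//.
  by rewrite (@le_trans _ _ n.+1%:R) ?ler_nat// -natr1 lerD2l.
have ge_pi (y : R) : n%:R <= y -> sine_mode M k (hy R M * y) = 0.
  move=> ny; apply: (zero_outside_ge out); rewrite -(hyM R M0) ler_pM2l//.
  by apply: (le_trans _ ny); rewrite ler_nat.
by rewrite !ge_pi ?mulr0 ?addr0 ?ler_nat// lerDl.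
Qed.

Lemma theta_itv M k : (0 < k)%N -> (k < M)%N -> 0 < theta M k < pi.
Proof.
move=> k0 kM; have M0 : (0 < M)%N by exact: leq_ltn_trans kM.
rewrite /theta divr_gt0 ?mulr_gt0 ?pi_gt0 ?ltr0n//=.
by rewrite ltr_pdivrMr ?ltr0n// ltr_pM2l ?pi_gt0// ltr_nat.
Qed.

Lemma two_cos_gt0 t : 0 < 2 + cos t.
Proof. by have := cos_geN1 t; lra. Qed.

(** The negative parameter makes harmonicity an eigenvalue equation. By the addition formula the two
    neighbours sum to [2 cos theta] times the middle value, and [symbol] solves the remaining scalar
    equation. *)
Lemma sine_discrete_harmonic M k : (0 < M)%N ->
  discrete_harmonic (hy R M) (- eigval M k) (interp (hy R M) (sine_seq M k)).
Proof.
move=> M0 n; have h0 := hy_gt0 R M0; have hn : hy R M != 0 by rewrite gt_eqF.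
rewrite !interp_node// gtr0_norm// /sine_seq; set th := theta M k.
have e2 : sin (th * n.+2%:R) = 2 * cos th * sin (th * n.+1%:R) - sin (th * n%:R).
  have -> : th * n.+2%:R = th * n.+1%:R + th by rewrite -natr1; ring.
  have -> : th * n%:R = th * n.+1%:R - th by rewrite -natr1; ring.
  by rewrite sinB sinD; ring.
have c0 : 2 + cos th != 0 by rewrite gt_eqF// two_cos_gt0.
rewrite e2 /offdiag /halfdiag /eigval /symbol -/th.
by field; rewrite c0 hn.
Qed.

(** Summation by parts with parameter [- eigval]: both boundary terms carry a value of [w] at 0 or
    [pi], which is zero. *)
Lemma seg_stiff_sine M k w : (0 < M)%N -> seg_fun M w ->
  seg_stiff (hy R M) (sine_mode M k) w = eigval M k * seg_mass (sine_mode M k) w.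
Proof.
move=> M0 sw; have [Pw w0] := sw; have h0 := hy_gt0 R M0.
have hn : hy R M != 0 by rewrite gt_eqF.
have sk := seg_fun_sine_mode k M0.
have := has_integral_strip_harmonic M hn (P1_interp (sine_seq M k) hn) Pw
  (sine_discrete_harmonic k M0).
rewrite hyM// (zero_outside_ge w0 (lexx pi)) (zero_outside_le w0 (lexx 0)) !mulr0 subrr.
have mS : measurable (strip (hy R M) M : set (measurableTypeR R)) by exact: measurable_strip.
have mI : measurable (`]0, pi[%classic : set (measurableTypeR R)) by exact: measurable_itv.
move=> hS.
have {}hS : has_integral (@leb1 R) (strip (hy R M) M)
    (fun y => slope (hy R M) (sine_mode M k) y * slope (hy R M) w y +
       - eigval M k * (sine_mode M k y * w y)) 0.
  apply: eq_has_integral hS => // y Sy.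
  have [n nM cy] : exists2 n, (n < M)%N & cell (hy R M) n y.
    have /andP[y0 yM] := Sy; exists (Num.truncn (y / hy R M)).
      by rewrite -(ltr_nat R); apply: le_lt_trans yM; case/andP: (truncn_itv y0).
    by rewrite /cell /=; exact: truncn_itv.
  rewrite !(slope_cell _ cy) !sine_mode_node// 1?ltnW// !interp_node//.
  rewrite sine_mode_segment//; move: Sy; rewrite strip_hy// /= in_itv /= => /andP[-> /ltW ->].
  by [].
have /has_integralE := has_integral_open_strip M0 hS.
have := has_integralD mI (has_integral_seg_stiff M0 sk sw)
  (has_integralZ (- eigval M k) mI (has_integral_seg_mass M0 sk sw)).
move=> /has_integralE -> /eqP.
by rewrite mulNr subr_eq0 => /eqP.
Qed.

(** [symbol] is a nonconstant Moebius function of [cos t], and the cosine is injective on this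
    interval. *)
Lemma symbol_inj : {in `[0, pi] &, injective (@symbol)}.
Proof.
move=> s t s0 t0 e; apply: cos_inj => //.
have cs := two_cos_gt0 s; have ct := two_cos_gt0 t.
have cs0 : 2 + cos s != 0 by rewrite gt_eqF.
have ct0 : 2 + cos t != 0 by rewrite gt_eqF.
move: e; rewrite /symbol => /eqP; rewrite eqr_div// => /eqP e.
by nra.
Qed.

Lemma eigval_inj M j k : (0 < j < M)%N -> (0 < k < M)%N -> eigval M j = eigval M k -> j = k.
Proof.
move=> /andP[j0 jM] /andP[k0 kM]; have M0 : (0 < M)%N by exact: leq_ltn_trans kM.
have hn : hy R M ^+ 2 != 0 by rewrite expf_neq0// gt_eqF// hy_gt0.
move=> /(mulIf (invr_neq0 hn)) /symbol_inj.
have /andP[j0' j1'] := theta_itv j0 jM; have /andP[k0' k1'] := theta_itv k0 kM.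
rewrite !in_itv /= !ltW// => /(_ isT isT) /(mulIf _) e.
have {}e := e (invr_neq0 _); move: e; rewrite pnatr_eq0 -lt0n M0 => /(_ isT).
move=> /(mulfI _) e; have {}e := e (lt0r_neq0 (pi_gt0 R)).
by apply/eqP; rewrite -(eqr_nat R); apply/eqP.
Qed.

(** The ordinal [k] stands for the frequency [k.+1], so the frequencies run from 1 to [M - 1]. *)
Definition sine M (k : 'I_M.-1) : R -> R := sine_mode M k.+1.
Arguments sine : clear implicits.

Lemma sine_index M (k : 'I_M.-1) : (0 < k.+1 < M)%N.
Proof. by case: M k => [|M] [k]. Qed.

Lemma sine_index_gt0 M (k : 'I_M.-1) : (0 < M)%N.
Proof. by case: M k => [|M] []. Qed.

Lemma seg_fun_sine M (k : 'I_M.-1) : seg_fun M (sine M k).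
Proof. exact/seg_fun_sine_mode/sine_index_gt0/k. Qed.

(** Eigenfunctions of the symmetric stiffness form for distinct eigenvalues are orthogonal for the
    mass form. *)
Lemma seg_mass_sine_neq M (i j : 'I_M.-1) : i != j -> seg_mass (sine M i) (sine M j) = 0.
Proof.
move=> ij; have M0 := sine_index_gt0 i.
have e1 := seg_stiff_sine i.+1 M0 (seg_fun_sine j).
have e2 := seg_stiff_sine j.+1 M0 (seg_fun_sine i).
have e : (eigval M i.+1 - eigval M j.+1) * seg_mass (sine M i) (sine M j) = 0.
  rewrite mulrBl; apply/eqP; rewrite subr_eq0; apply/eqP.
  by rewrite -[LHS]e1 seg_stiffC e2 seg_massC.
move/eqP: e; rewrite mulf_eq0 subr_eq0 => /orP[/eqP e|/eqP//].
have [] := eigval_inj (sine_index i) (sine_index j) e.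
by move=> /ord_inj e'; rewrite e' eqxx in ij.
Qed.

Lemma seg_mass_sine_gt0 M (i : 'I_M.-1) : 0 < seg_mass (sine M i) (sine M i).
Proof.
have M0 := sine_index_gt0 i; have /andP[i0 iM] := sine_index i.
apply: (@seg_mass_gt0 M _ 1) => //; first exact: seg_fun_sine.
  by apply: leq_ltn_trans iM.
rewrite /sine sine_mode_node// /sine_seq mulr1 gt_eqF// sin_gt0_pi//.
exact: theta_itv.
Qed.

Lemma sine_free M (c : 'I_M.-1 -> R) :
  (forall y, \sum_(k < M.-1) c k * sine M k y = 0) -> forall k : 'I_M.-1, c k = 0.
Proof.
move=> c0 k; have M0 := sine_index_gt0 k.
have := seg_mass_lincomb c M0 (@seg_fun_sine M) (seg_fun_sine k).
rewrite (bigD1 k)//= big1 ?addr0; last by move=> i ik; rewrite seg_mass_sine_neq ?mulr0.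
rewrite (_ : seg_mass _ _ = 0).
  by move=> /esym/eqP; rewrite mulf_eq0 (gt_eqF (seg_mass_sine_gt0 k)) orbF => /eqP.
rewrite /seg_mass /Rintegral; under eq_integral do rewrite c0 mul0r.
by rewrite integral0.
Qed.

Lemma seg_fun_eq0 M w : (0 < M)%N -> seg_fun M w ->
  (forall j : 'I_M.-1, w (hy R M * j.+1%:R) = 0) -> forall y, w y = 0.
Proof.
move=> M0 [Pw w0] wn y; have h0 := hy_gt0 R M0; have hn : hy R M != 0 by rewrite gt_eqF.
have [y0|y0] := leP y 0; first exact: zero_outside_le.
apply: (P1_eq0 hn Pw); last by rewrite half_line_pos//; exact: ltW.
case=> [|n]; first by rewrite mulr0 (zero_outside_le w0).
have [nM|Mn] := ltnP n M.-1; first exact: wn (Ordinal nM).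
apply: (zero_outside_ge w0); rewrite -{1}(hyM R M0) ler_pM2l// ler_nat.
by rewrite -(prednK M0) ltnS.
Qed.

(** Dimension count: a function is determined by its [M - 1] interior nodal values, and the square
    matrix of nodal values of the sines is invertible because they are linearly independent. *)
Lemma sine_span M w : (0 < M)%N -> seg_fun M w ->
  exists c : 'I_M.-1 -> R, forall y, w y = \sum_(k < M.-1) c k * sine M k y.
Proof.
move=> M0 sw; pose S : 'M[R]_M.-1 := \matrix_(i, j) sine M i (hy R M * j.+1%:R).
have Su : S \in unitmx.
  rewrite -row_free_unit -kermx_eq0; apply/eqP/row_matrixP => i; rewrite row0.
  have := sub_kermxP (row_sub i (kermx S)); move: (row i _) => c cS.
  apply/rowP => k; rewrite [RHS]mxE.
  suff h y : \sum_(k < M.-1) c 0 k * sine M k y = 0 by exact: (sine_free h).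
  have sl := seg_fun_lincomb (fun i => c 0 i) (@seg_fun_sine M).
  move: y; apply: (seg_fun_eq0 M0 sl) => j.
  have := congr1 (fun A : 'rV[R]_M.-1 => A 0 j) cS; rewrite !mxE => cS0.
  by rewrite -[RHS]cS0; apply: eq_bigr => l _; rewrite mxE.
have [c cS] : exists c : 'rV[R]_M.-1, c *m S = \row_j w (hy R M * j.+1%:R).
  by exists ((\row_j w (hy R M * j.+1%:R)) *m invmx S); rewrite mulmxKV.
exists (fun i => c 0 i) => y; apply/eqP; rewrite -subr_eq0; apply/eqP.
have sd : seg_fun M (fun y => w y - \sum_(k < M.-1) c 0 k * sine M k y).
  have [Pl l0] := seg_fun_lincomb (fun i => c 0 i) (@seg_fun_sine M).
  have [Pw w0] := sw; split.
    by move=> n t t01; rewrite (Pw n t t01) (Pl n t t01); ring.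
  by move=> z Nz; rewrite w0// l0// subrr.
apply: (seg_fun_eq0 M0 sd) => j; apply/eqP; rewrite subr_eq0; apply/eqP.
have := congr1 (fun A : 'rV[R]_M.-1 => A 0 j) cS; rewrite !mxE => <-.
by apply: eq_bigr => l _; rewrite mxE.
Qed.

End SineBasis.

(** * Energy-orthogonal splitting on the line *)

Section LineOperator.
Variable R : realType.
Variables hm hp : R.
Hypotheses (hm0 : 0 < hm) (hp0 : 0 < hp).
Implicit Types (d x t h lam al be ga c : R) (u v w e : R -> R) (n N : nat).

Let hpn : hp != 0. Proof. by rewrite gt_eqF. Qed.
Let hmn : - hm != 0. Proof. by rewrite oppr_eq0 gt_eqF. Qed.

Definition line_glue u v x : R := if x < 0 then u x else v x.

Lemma line_glue_neg u v x : u 0 = v 0 -> half_line (- hm) x -> line_glue u v x = u x.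
Proof.
rewrite half_line_neg// => uv0 /=; rewrite /line_glue le_eqVlt => /predU1P[->|->//].
by rewrite ltxx.
Qed.

Lemma line_glue_pos u v x : half_line hp x -> line_glue u v x = v x.
Proof. by rewrite half_line_pos// /line_glue /= leNgt => /negbTE ->. Qed.

Lemma half_line_node d n t : d != 0 -> 0 <= t -> half_line d (d * (n%:R + t)).
Proof. by move=> d0 t0; rewrite /half_line /= mulrAC divff// mul1r addr_ge0. Qed.

Lemma half_line_node0 d n : d != 0 -> half_line d (d * n%:R).
Proof. by move=> d0; rewrite -[n%:R]addr0; exact: half_line_node. Qed.

Lemma eq_P1 d u v : d != 0 -> (forall x, half_line d x -> u x = v x) -> P1 d u -> P1 d v.
Proof.
move=> d0 uv Pu n t t01; have /andP[t0 _] := t01.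
by rewrite -!uv ?Pu//; [exact: half_line_node0|exact: half_line_node0|exact: half_line_node].
Qed.

Lemma eq_slope d u v x : d != 0 -> (forall x, half_line d x -> u x = v x) ->
  slope d u x = slope d v x.
Proof. by move=> d0 uv; rewrite /slope !uv//; exact: half_line_node0. Qed.

Lemma line_fun_of_halves u : P1 hp u -> P1 (- hm) u ->
  L2_on (half_line hp) u -> L2_on (half_line (- hm)) u -> line_fun hm hp u.
Proof.
move=> Pp Pm Lp Lm; split=> //.
by case: (has_integral_line (F := fun x => u x ^+ 2) hm0 hp0 (fun x _ => erefl)
  (fun x _ => erefl) (integrable_has_integral Lm) (integrable_has_integral Lp)).
Qed.

Lemma eq_L2_on d u v : (forall x, half_line d x -> u x = v x) ->
  L2_on (half_line d) u -> L2_on (half_line d) v.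
Proof.
move=> uv; apply: eq_integrable; first exact: measurable_half_line.
by move=> x /set_mem Hx; rewrite uv.
Qed.

Lemma line_fun_glue u v : line_fun hm hp u -> line_fun hm hp v -> u 0 = v 0 ->
  line_fun hm hp (line_glue u v).
Proof.
move=> lu lv uv0; have [[_ Pu] _] := lu; have [[Pv _] _] := lv.
have em x : half_line (- hm) x -> u x = line_glue u v x by move=> Hx; rewrite line_glue_neg.
have ep x : half_line hp x -> v x = line_glue u v x by move=> Hx; rewrite line_glue_pos.
apply: line_fun_of_halves.
- exact: eq_P1 ep Pv.
- exact: eq_P1 em Pu.
- by apply: eq_L2_on ep _; exact: line_fun_L2 lv.
- by apply: eq_L2_on em _; exact: line_fun_L2 lu.
Qed.

Lemma line_fun_comb (c1 c2 : R) u v : line_fun hm hp u -> line_fun hm hp v ->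
  line_fun hm hp (fun x => c1 * u x + c2 * v x).
Proof.
move=> lu lv; have [[Pu Pu'] Lu] := lu; have [[Pv Pv'] Lv] := lv.
have PD d : P1 d u -> P1 d v -> P1 d (fun x => c1 * u x + c2 * v x).
  by move=> Pu1 Pv1 n t t01; rewrite Pu1// Pv1//; ring.
split; first by split; exact: PD.
have mT : measurable [set: measurableTypeR R] by [].
have i1 := integrableD mT (integrableZl mT (2 * c1 ^+ 2) Lu) (integrableZl mT (2 * c2 ^+ 2) Lv).
apply: (le_integrable mT _ _ i1).
  apply/measurable_EFinP; apply: measurable_funX; apply: measurable_funD.
    by apply: measurable_funM => //; exact: line_fun_measurable lu.
  by apply: measurable_funM => //; exact: line_fun_measurable lv.
move=> x _ /=; rewrite lee_fin ger0_norm ?sqr_ge0//; apply: le_trans (ler_norm _).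
by have := sqr_ge0 (c1 * u x - c2 * v x); nra.
Qed.

Lemma line_fun0 : line_fun hm hp (fun=> 0).
Proof.
split; last by rewrite /L2_on; under eq_fun do rewrite expr0n; exact: integrable0.
by split=> n t _; rewrite !mulr0 addr0.
Qed.

Lemma line_fun_lincomb k (c : 'I_k -> R) (v : 'I_k -> R -> R) :
  (forall i, line_fun hm hp (v i)) -> line_fun hm hp (fun x => \sum_(i < k) c i * v i x).
Proof.
elim: k c v => [|k IHk] c v lv.
  by under eq_fun do rewrite big_ord0; exact: line_fun0.
under eq_fun do rewrite big_ord_recr /= -[X in X + _]mul1r.
by apply: line_fun_comb; [exact: IHk|exact: lv].
Qed.

Definition half_energy d lam u v : R := half_stiff d u v + lam * half_mass d u v.

Lemma eq_half_energy d lam u u' v v' : d != 0 ->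
  (forall x, half_line d x -> u x = u' x) -> (forall x, half_line d x -> v x = v' x) ->
  half_energy d lam u v = half_energy d lam u' v'.
Proof.
move=> d0 uu' vv'; rewrite /half_energy; congr (_ + _ * _).
  by apply: eq_Rintegral => x _; rewrite (eq_slope _ d0 uu') (eq_slope _ d0 vv').
by apply: eq_Rintegral => x /set_mem Hx; rewrite uu'// vv'.
Qed.

Lemma half_energyC d lam u v : half_energy d lam u v = half_energy d lam v u.
Proof.
by rewrite /half_energy; congr (_ + _ * _); apply: eq_Rintegral => x _; rewrite mulrC.
Qed.

Definition side d : Prop := d = hp \/ d = - hm.

Lemma side_neq0 d : side d -> d != 0.
Proof. by case=> ->. Qed.

Lemma side_P1 d v : side d -> line_fun hm hp v -> P1 d v.
Proof. by case=> -> [[]]. Qed.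

Lemma has_integral_half_energy d lam u v : side d -> line_fun hm hp u -> line_fun hm hp v ->
  has_integral (@leb1 R) (half_line d)
    (fun x => slope d u x * slope d v x + lam * (u x * v x)) (half_energy d lam u v).
Proof.
move=> sd lu lv.
have mH : measurable (half_line d : set (measurableTypeR R)) by exact: measurable_half_line.
apply: has_integralD => //; last first.
  by apply: has_integralZ => //; exact: has_integral_half_mass lu lv.
by apply: (has_integral_half_stiff _ _ _ lu lv);
  [exact: side_neq0|exact: side_P1 sd lu|exact: side_P1 sd lv].
Qed.

Lemma half_energy_comb d lam (c1 c2 : R) u v w : side d ->
  line_fun hm hp u -> line_fun hm hp v -> line_fun hm hp w ->
  half_energy d lam (fun x => c1 * u x + c2 * v x) w =
  c1 * half_energy d lam u w + c2 * half_energy d lam v w.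
Proof.
move=> sd lu lv lw.
have mH : measurable (half_line d : set (measurableTypeR R)) by exact: measurable_half_line.
have := has_integral_half_energy lam sd (line_fun_comb c1 c2 lu lv) lw.
move=> /has_integralE <-; apply: has_integralE.
have := has_integralD mH (has_integralZ c1 mH (has_integral_half_energy lam sd lu lw))
  (has_integralZ c2 mH (has_integral_half_energy lam sd lv lw)).
by apply: eq_has_integral => // x _; rewrite /slope; ring.
Qed.

Lemma half_energy0 d lam w : half_energy d lam (fun=> 0) w = 0.
Proof.
have i0 (f : R -> R) : (forall x, f x = 0) -> \int[@leb1 R]_(x in half_line d) f x = 0.
  move=> f0; rewrite -[RHS](has_integralE (has_integral0 (@leb1 R) (half_line d))).
  by apply: eq_Rintegral => x _; exact: f0.
rewrite /half_energy /half_stiff /half_mass !i0 ?mulr0 ?addr0// => x; first by rewrite mul0r.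
by rewrite /slope subrr !mul0r.
Qed.

Lemma half_energy_ge0 d lam v : 0 <= lam -> 0 <= half_energy d lam v v.
Proof.
move=> lam0; rewrite addr_ge0// ?mulr_ge0//; apply: Rintegral_ge0 => x _;
  by rewrite -expr2 sqr_ge0.
Qed.

Lemma half_energy_eq0 d lam v : side d -> 0 < lam -> line_fun hm hp v ->
  half_energy d lam v v = 0 -> forall x, half_line d x -> v x = 0.
Proof.
move=> sd lam0 lv; have d0 := side_neq0 sd; have Pv := side_P1 sd lv.
have s0 : 0 <= half_stiff d v v.
  by apply: Rintegral_ge0 => x _; rewrite -expr2 sqr_ge0.
have m0 : 0 <= half_mass d v v.
  by apply: Rintegral_ge0 => x _; rewrite -expr2 sqr_ge0.
move=> /eqP; rewrite paddr_eq0 ?mulr_ge0 ?(ltW lam0)// => /andP[_].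
rewrite mulf_eq0 gt_eqF//= => /eqP mv0.
apply: P1_eq0 => // n; have hS := has_integral_strip_sqr n.+1 d0 Pv.
have hH : has_integral (@leb1 R) (half_line d) (fun x => v x ^+ 2) 0.
  rewrite -mv0; apply: eq_has_integral (has_integral_half_mass d hm0 hp0 lv lv).
    exact: measurable_half_line.
  by move=> x _; rewrite expr2.
have nd0 : 0 < `|d| by rewrite normr_gt0.
have : \sum_(i < n.+1) `|d| / 3 * (v (d * i%:R) ^+ 2 + v (d * i.+1%:R) ^+ 2 +
    v (d * i%:R) * v (d * i.+1%:R)) <= 0.
  apply: (le_has_integral_subset _ _ _ _ hS hH).
  - exact: measurable_strip.
  - exact: measurable_half_line.
  - by move=> x /andP[].
  - by move=> x _; exact: sqr_ge0.
have ge0 (i : nat) : 0 <= `|d| / 3 * (v (d * i%:R) ^+ 2 + v (d * i.+1%:R) ^+ 2 +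
    v (d * i%:R) * v (d * i.+1%:R)).
  by rewrite mulr_ge0 ?divr_ge0//; nra.
rewrite big_ord_recr /= => h.
have {}h : `|d| / 3 * (v (d * n%:R) ^+ 2 + v (d * n.+1%:R) ^+ 2 +
    v (d * n%:R) * v (d * n.+1%:R)) <= 0.
  by apply: le_trans h; rewrite lerDr; apply: sumr_ge0 => i _; exact: ge0.
have c0 : 0 < `|d| / 3 by rewrite divr_gt0.
rewrite pmulr_rle0// in h.
have : v (d * n%:R) ^+ 2 <= 0.
  move: h; set p := v _; set q := v _ => h.
  (* [p^2 + q^2 + p q = 3/4 p^2 + 1/4 (p + 2 q)^2]. *)
  have := sqr_ge0 (p + 2 * q); nra.
by rewrite le_eqVlt ltNge sqr_ge0 orbF sqrf_eq0 => /eqP.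
Qed.

(* The energy of the decaying discrete-harmonic extension of the boundary
   value 1 to a half-line. *)
Definition trace_energy lam h : R := Num.sqrt (halfdiag lam h ^+ 2 - offdiag lam h ^+ 2).

(** The root of modulus below 1 of [a + 2 b q + a q^2], written as [- a / (b + E)] instead of
    [(E - b) / a], because [a] vanishes when [lam h^2 = 6]. *)
Definition decay lam h : R := - offdiag lam h / (halfdiag lam h + trace_energy lam h).

Section Coefficients.
Variables lam h : R.
Hypotheses (lam0 : 0 < lam) (h0 : 0 < h).

Lemma halfdiag_gt0 : 0 < halfdiag lam h.
Proof. by rewrite /halfdiag addr_gt0 ?invr_gt0// divr_gt0// mulr_gt0. Qed.

(** The factors are [b + a = lam h / 2] and [b - a = 2 / h + lam h / 6]. *)
Lemma trace_discriminant : halfdiag lam h ^+ 2 - offdiag lam h ^+ 2 =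
  lam * (1 + lam * h ^+ 2 / 12).
Proof. by rewrite /halfdiag /offdiag; field; rewrite gt_eqF. Qed.

Lemma trace_energyE : trace_energy lam h = Num.sqrt lam * Num.sqrt (1 + lam * h ^+ 2 / 12).
Proof. by rewrite /trace_energy trace_discriminant sqrtrM// ltW. Qed.

Lemma trace_discriminant_gt0 : 0 < halfdiag lam h ^+ 2 - offdiag lam h ^+ 2.
Proof.
by rewrite trace_discriminant mulr_gt0// addr_gt0// divr_gt0// mulr_gt0// exprn_gt0.
Qed.

Lemma trace_energy_gt0 : 0 < trace_energy lam h.
Proof. by rewrite sqrtr_gt0 trace_discriminant_gt0. Qed.

Lemma sqr_trace_energy : trace_energy lam h ^+ 2 = halfdiag lam h ^+ 2 - offdiag lam h ^+ 2.
Proof. by rewrite sqr_sqrtr// ltW// trace_discriminant_gt0. Qed.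

(** [- a^2 / (b + E) = (E^2 - b^2) / (b + E)]. Read as [b + a q = E], this is the flux of the
    decaying mode at the interface. *)
Lemma offdiag_decay : offdiag lam h * decay lam h = trace_energy lam h - halfdiag lam h.
Proof.
have := sqr_trace_energy; have := halfdiag_gt0; have := trace_energy_gt0.
rewrite /decay; set a := offdiag _ _; set b := halfdiag _ _; set E := trace_energy _ _.
move=> E0 b0 E2; have bE : b + E != 0 by rewrite gt_eqF// addr_gt0.
apply: (mulIf bE); rewrite mulrA divfK//.
have -> : (E - b) * (b + E) = E ^+ 2 - b ^+ 2 by ring.
by rewrite E2; ring.
Qed.

Lemma decay_root : offdiag lam h + 2 * halfdiag lam h * decay lam h +
  offdiag lam h * decay lam h ^+ 2 = 0.
Proof.
have bE : halfdiag lam h + trace_energy lam h != 0.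
  by rewrite gt_eqF// addr_gt0// ?halfdiag_gt0// trace_energy_gt0.
have -> : offdiag lam h + 2 * halfdiag lam h * decay lam h + offdiag lam h * decay lam h ^+ 2 =
  offdiag lam h + decay lam h * (2 * halfdiag lam h + offdiag lam h * decay lam h) by ring.
rewrite offdiag_decay.
have -> : 2 * halfdiag lam h + (trace_energy lam h - halfdiag lam h) =
  halfdiag lam h + trace_energy lam h by ring.
by rewrite /decay divfK// subrr.
Qed.

Lemma decay_lt1 : decay lam h ^+ 2 < 1.
Proof.
have := sqr_trace_energy; have := halfdiag_gt0; have := trace_energy_gt0.
rewrite /decay; set a := offdiag _ _; set b := halfdiag _ _; set E := trace_energy _ _.
move=> E0 b0 E2; have bE : 0 < b + E by rewrite addr_gt0.
rewrite expr_div_n sqrrN ltr_pdivrMr ?exprn_gt0// mul1r.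
by nra.
Qed.

End Coefficients.

Definition half_mode lam d : R -> R := interp d (fun n => decay lam `|d| ^+ n).

Lemma half_mode_node lam d n : d != 0 -> half_mode lam d (d * n%:R) = decay lam `|d| ^+ n.
Proof. by move=> d0; rewrite /half_mode interp_node. Qed.

Lemma half_mode_harmonic lam d : 0 < lam -> d != 0 -> discrete_harmonic d lam (half_mode lam d).
Proof.
move=> lam0 d0 n; have nd0 : 0 < `|d| by rewrite normr_gt0.
rewrite !half_mode_node// !exprS.
have := decay_root lam0 nd0; set a := offdiag _ _; set b := halfdiag _ _; set r := decay _ _.
move=> e; have -> : a * r ^+ n + 2 * b * (r * r ^+ n) + a * (r * (r * r ^+ n)) =
  r ^+ n * (a + 2 * b * r + a * r ^+ 2) by ring.
by rewrite e mulr0.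
Qed.

Lemma half_mode_L2 lam d : 0 < lam -> d != 0 -> L2_on (half_line d) (half_mode lam d).
Proof.
move=> lam0 d0; have nd0 : 0 < `|d| by rewrite normr_gt0.
have r1 := decay_lt1 lam0 nd0.
have q0 : 0 < 1 - decay lam `|d| ^+ 2 by rewrite subr_gt0.
apply: (@L2_of_nodes _ _ _ (1 - decay lam `|d| ^+ 2)^-1) => //; first exact: P1_interp.
move=> N; rewrite -[leRHS]mul1r ler_pdivlMr//.
have -> : \sum_(n < N) half_mode lam d (d * n%:R) ^+ 2 =
    \sum_(n < N) (decay lam `|d| ^+ 2) ^+ n.
  by apply: eq_bigr => n _; rewrite half_mode_node// -!exprM mulnC.
set q := decay _ _ ^+ 2; rewrite mulrC -opprB mulNr -subrX1 opprB.
by rewrite gerBl exprn_ge0// sqr_ge0.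
Qed.

Lemma half_mode_flux lam d : 0 < lam -> d != 0 ->
  flux d lam (half_mode lam d) 0 = trace_energy lam `|d|.
Proof.
move=> lam0 d0; have nd0 : 0 < `|d| by rewrite normr_gt0.
by rewrite /flux !half_mode_node// expr0 mulr1 expr1 offdiag_decay// addrCA subrr addr0.
Qed.

Definition trace_mode lam : R -> R := line_glue (half_mode lam (- hm)) (half_mode lam hp).

Lemma half_mode0 lam d : d != 0 -> half_mode lam d 0 = 1.
Proof. by move=> d0; have := half_mode_node lam 0 d0; rewrite mulr0 expr0. Qed.

Lemma trace_mode0 lam : trace_mode lam 0 = 1.
Proof. by rewrite /trace_mode /line_glue ltxx half_mode0. Qed.

Lemma trace_modeE lam d x : side d -> half_line d x -> half_mode lam d x = trace_mode lam x.
Proof.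
by case=> -> Hx; rewrite /trace_mode; [rewrite line_glue_pos|rewrite line_glue_neg// !half_mode0].
Qed.

Lemma line_fun_trace_mode lam : 0 < lam -> line_fun hm hp (trace_mode lam).
Proof.
move=> lam0; have ep x := @trace_modeE lam hp x (or_introl erefl).
have em x := @trace_modeE lam (- hm) x (or_intror erefl).
apply: line_fun_of_halves.
- by apply: eq_P1 ep _ => //; exact: P1_interp.
- by apply: eq_P1 em _ => //; exact: P1_interp.
- by apply: eq_L2_on ep _; exact: half_mode_L2.
- by apply: eq_L2_on em _; exact: half_mode_L2.
Qed.

(** The trace mode sees [v] only through its interface value, hence it is orthogonal on each side to
    all functions vanishing there. *)
Lemma half_energy_trace_mode lam d v : 0 < lam -> side d -> line_fun hm hp v ->
  half_energy d lam (trace_mode lam) v = trace_energy lam `|d| * v 0.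
Proof.
move=> lam0 sd lv; have d0 := side_neq0 sd; have le := line_fun_trace_mode lam0.
have E x : half_line d x -> trace_mode lam x = half_mode lam d x.
  by move=> Hx; rewrite (trace_modeE _ sd Hx).
have he : discrete_harmonic d lam (trace_mode lam).
  by move=> n; rewrite !E; [exact: half_mode_harmonic|exact: half_line_node0..].
have := has_integral_half_line_harmonic d0 (side_P1 sd le) (side_P1 sd lv)
  (@line_fun_measurable _ _ _ _ _ hm0 hp0 le) (@line_fun_measurable _ _ _ _ _ hm0 hp0 lv)
  (line_fun_L2 d le) (line_fun_L2 d lv) he.
move=> /has_integralE; rewrite (has_integralE (has_integral_half_energy lam sd le lv)) => ->.
by rewrite -half_mode_flux// /flux !E//; exact: half_line_node0.
Qed.

(* In the decomposition v = v 0 *: trace_mode + v^- + v^+, which is orthogonal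
   for the energy, this operator multiplies v^-, v^+ and the trace mode by
   al, be and ga respectively. *)
Definition line_op lam al be ga v : R -> R :=
  line_glue (fun x => al * v x + (ga - al) * v 0 * trace_mode lam x)
       (fun x => be * v x + (ga - be) * v 0 * trace_mode lam x).

Lemma line_op0 lam al be ga v : line_op lam al be ga v 0 = ga * v 0.
Proof. by rewrite /line_op /line_glue ltxx trace_mode0; ring. Qed.

Lemma line_fun_op lam al be ga v : 0 < lam -> line_fun hm hp v ->
  line_fun hm hp (line_op lam al be ga v).
Proof.
move=> lam0 lv; have le := line_fun_trace_mode lam0.
by apply: line_fun_glue; [exact: line_fun_comb|exact: line_fun_comb|rewrite trace_mode0; ring].
Qed.

(** The splitting is preserved, so the multipliers multiply entrywise; reciprocal multipliers
    therefore give the inverse. *)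
Lemma line_op_comp lam al be ga al' be' ga' v :
  line_op lam al' be' ga' (line_op lam al be ga v) =
  line_op lam (al' * al) (be' * be) (ga' * ga) v.
Proof.
apply/funext => x; rewrite [LHS]/line_op line_op0 /line_glue.
by case: ifPn => [x0|/negbTE x0]; rewrite /line_op /line_glue x0; ring.
Qed.

Lemma line_op1 lam v : line_op lam 1 1 1 v = v.
Proof. by apply/funext => x; rewrite /line_op /line_glue; case: ifPn => _; ring. Qed.

Definition side_coef d al be : R := if d < 0 then al else be.

Lemma line_op_side lam al be ga v d x : side d -> half_line d x ->
  line_op lam al be ga v x =
  side_coef d al be * v x + (ga - side_coef d al be) * v 0 * trace_mode lam x.
Proof.
rewrite /side_coef; case=> -> Hx.
  by rewrite ltNge (ltW hp0) /= /line_op line_glue_pos.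
rewrite oppr_lt0 hm0 /line_op line_glue_neg//.
by rewrite trace_mode0; ring.
Qed.

Lemma half_energy_op lam al be ga d v w : 0 < lam -> side d ->
  line_fun hm hp v -> line_fun hm hp w ->
  half_energy d lam (line_op lam al be ga v) w = side_coef d al be * half_energy d lam v w +
    (ga - side_coef d al be) * v 0 * (trace_energy lam `|d| * w 0).
Proof.
move=> lam0 sd lv lw; have le := line_fun_trace_mode lam0.
rewrite (eq_half_energy _ (side_neq0 sd) (fun x => @line_op_side lam al be ga v d x sd)
  (fun x _ => erefl (w x))).
by rewrite half_energy_comb// half_energy_trace_mode.
Qed.

(** Pythagoras: [E * v 0 ^+ 2] is the energy of the trace part on this side and the remainder that
    of the part vanishing at the interface. *)
Lemma half_energy_op_op lam al be ga d v : 0 < lam -> side d -> line_fun hm hp v ->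
  half_energy d lam (line_op lam al be ga v) (line_op lam al be ga v) =
  side_coef d al be ^+ 2 * (half_energy d lam v v - trace_energy lam `|d| * v 0 ^+ 2) +
  ga ^+ 2 * (trace_energy lam `|d| * v 0 ^+ 2).
Proof.
move=> lam0 sd lv; have lo := line_fun_op al be ga lam0 lv.
rewrite half_energy_op// half_energyC half_energy_op// line_op0.
by ring.
Qed.

(** With the multipliers 1, 1, 0 the operator projects onto the part vanishing at the interface, and
    the difference of the two sides is its energy. *)
Lemma half_energy_trace_le lam d v : 0 < lam -> side d -> line_fun hm hp v ->
  trace_energy lam `|d| * v 0 ^+ 2 <= half_energy d lam v v.
Proof.
move=> lam0 sd lv; have := half_energy_op_op 1 1 0 lam0 sd lv.
have -> : side_coef d 1 1 = 1 by rewrite /side_coef; case: ifP.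
rewrite expr1n mul1r expr0n mul0r addr0 -subr_ge0 => <-.
by apply: half_energy_ge0; exact: ltW.
Qed.

Definition line_energy lam (a b : R) u v : R :=
  a * half_energy (- hm) lam u v + b * half_energy hp lam u v.

Let side_p : side hp := or_introl erefl.
Let side_m : side (- hm) := or_intror erefl.

Let coef_p al be : side_coef hp al be = be.
Proof. by rewrite /side_coef ltNge (ltW hp0). Qed.

Let coef_m al be : side_coef (- hm) al be = al.
Proof. by rewrite /side_coef oppr_lt0 hm0. Qed.

Let norm_p : `|hp| = hp. Proof. by rewrite gtr0_norm. Qed.
Let norm_m : `|- hm| = hm. Proof. by rewrite normrN gtr0_norm. Qed.

(** Each side leaves a defect proportional to [v 0 * w 0]; the two defects cancel exactly when [ga]
    is the mean of [al] and [be] weighted by the trace energies. *)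
Lemma line_energy_riesz lam al be ga v w : 0 < lam -> line_fun hm hp v -> line_fun hm hp w ->
  ga * (trace_energy lam hm + trace_energy lam hp) =
    al * trace_energy lam hm + be * trace_energy lam hp ->
  line_energy lam 1 1 (line_op lam al be ga v) w = line_energy lam al be v w.
Proof.
move=> lam0 lv lw gaE; rewrite /line_energy !half_energy_op// coef_p coef_m norm_p norm_m.
apply/eqP; rewrite -subr_eq0; apply/eqP.
transitivity ((ga * (trace_energy lam hm + trace_energy lam hp) -
  (al * trace_energy lam hm + be * trace_energy lam hp)) * (v 0 * w 0)); first by ring.
by rewrite gaE subrr mul0r.
Qed.

(** The energies of the three orthogonal parts are scaled by [al^2], [be^2] and [ga^2], and each
    part has nonnegative energy. *)
Lemma line_energy_op_le lam al be ga c v : 0 < lam -> line_fun hm hp v ->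
  al ^+ 2 <= c -> be ^+ 2 <= c -> ga ^+ 2 <= c ->
  line_energy lam 1 1 (line_op lam al be ga v) (line_op lam al be ga v) <=
  c * line_energy lam 1 1 v v.
Proof.
move=> lam0 lv alc bec gac; rewrite /line_energy !half_energy_op_op// coef_p coef_m norm_p norm_m.
have := half_energy_trace_le lam0 side_p lv; have := half_energy_trace_le lam0 side_m lv.
rewrite norm_p norm_m.
have := mulr_ge0 (ltW (trace_energy_gt0 lam0 hm0)) (sqr_ge0 (v 0)).
have := mulr_ge0 (ltW (trace_energy_gt0 lam0 hp0)) (sqr_ge0 (v 0)).
set Ep := _ * v 0 ^+ 2; set Em := _ * v 0 ^+ 2.
set Hp := half_energy hp _ _ _; set Hm := half_energy (- hm) _ _ _.
rewrite -(subr_ge0 Em) -(subr_ge0 Ep) => Ep0 Em0 dm dp.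
have := ler_wpM2r dm alc; have := ler_wpM2r dp bec.
have := ler_wpM2r Ep0 gac; have := ler_wpM2r Em0 gac.
lra.
Qed.

Lemma line_energy_eq0 lam v : 0 < lam -> line_fun hm hp v ->
  line_energy lam 1 1 v v = 0 -> v = (fun=> 0).
Proof.
move=> lam0 lv /eqP; rewrite /line_energy !mul1r paddr_eq0 ?half_energy_ge0 ?(ltW lam0)//.
move=> /andP[/eqP em /eqP ep]; apply/funext => x; have [x0|x0] := leP 0 x.
  by apply: (half_energy_eq0 side_p lam0 lv ep); rewrite half_line_pos.
by apply: (half_energy_eq0 side_m lam0 lv em); rewrite half_line_neg//=; exact: ltW.
Qed.

Lemma line_energy_ge0 lam v : 0 < lam -> 0 <= line_energy lam 1 1 v v.
Proof. by move=> lam0; rewrite /line_energy !mul1r addr_ge0// half_energy_ge0// ltW. Qed.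

Lemma line_energy_comb lam (a b c1 c2 : R) u v w : line_fun hm hp u -> line_fun hm hp v ->
  line_fun hm hp w -> line_energy lam a b (fun x => c1 * u x + c2 * v x) w =
  c1 * line_energy lam a b u w + c2 * line_energy lam a b v w.
Proof. by move=> lu lv lw; rewrite /line_energy !half_energy_comb//; ring. Qed.

Lemma line_funZ c v : line_fun hm hp v -> line_fun hm hp (fun x => c * v x).
Proof.
move=> lv; have := line_fun_comb c 0 lv lv.
by under eq_fun do rewrite mul0r addr0.
Qed.

Lemma line_energy_scale lam (a b : R) c v : line_fun hm hp v ->
  line_energy lam a b (fun x => c * v x) (fun x => c * v x) = c ^+ 2 * line_energy lam a b v v.
Proof.
move=> lv; have lc := line_funZ c lv.
have scale d w : side d -> line_fun hm hp w ->
    half_energy d lam (fun x => c * v x) w = c * half_energy d lam v w.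
  move=> sd lw; have := half_energy_comb lam c 0 sd lv lv lw.
  by under eq_fun do rewrite mul0r addr0; rewrite mul0r addr0.
rewrite /line_energy !scale// ![half_energy _ _ v (fun x => _)]half_energyC !scale//.
by ring.
Qed.

Lemma line_energy_trace_mode lam : 0 < lam ->
  line_energy lam 1 1 (trace_mode lam) (trace_mode lam) =
  trace_energy lam hm + trace_energy lam hp.
Proof.
move=> lam0; have le := line_fun_trace_mode lam0.
by rewrite /line_energy !half_energy_trace_mode// norm_p norm_m trace_mode0; ring.
Qed.

End LineOperator.

(** * The discrete operator *)

Section DiscreteOperator.
Variable R : realType.
Variables (sm sp r ry : R) (M : nat).
Hypotheses (r0 : 0 < r) (ry0 : 0 < ry) (M0 : (0 < M)%N).
Implicit Types (al be c : R) (ga : 'I_M.-1 -> R) (v : 'I_M.-1 -> R -> R) (u : R * R -> R).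

Let hm : R := hminus ry M.
Let hp : R := hplus r ry M.
Let lam (k : 'I_M.-1) : R := eigval R M k.+1.
Let S : set (R * R -> R) := discrete_space r ry M.

Lemma hminus_gt0 : 0 < hm.
Proof. by rewrite /hm /hminus divr_gt0// hy_gt0. Qed.

Lemma hplus_gt0 : 0 < hp.
Proof. by rewrite /hp /hplus mulr_gt0// hminus_gt0. Qed.

Let hm0 := hminus_gt0.
Let hp0 := hplus_gt0.

Lemma symbol_gt0 (t : R) : 0 < t < pi -> 0 < symbol t.
Proof.
move=> t_itv; rewrite /symbol divr_gt0 ?two_cos_gt0// mulr_gt0// subr_gt0.
have s0 := sin_gt0_pi t_itv; have := cos2Dsin2 t; have := cos_le1 t.
rewrite le_eqVlt => /predU1P[->|//]; nra.
Qed.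

Lemma eigval_gt0 k : 0 < lam k.
Proof.
have /andP[k0 kM] := sine_index k.
by rewrite /lam /eigval divr_gt0 ?exprn_gt0 ?hy_gt0// symbol_gt0// theta_itv.
Qed.

Let lam0 := eigval_gt0.

Definition line_family v : Prop := forall k, line_fun hm hp (v k).

Definition sine_sum v : R * R -> R := tens v (@sine R M).

(** Expanding every factor in [y] in the sine basis and collecting coefficients gives a normal form
    with one function of [x] per frequency; [sine_sum_inj] shows that it is unique. *)
Lemma discrete_spaceP u : S u <-> exists v, line_family v /\ u = sine_sum v.
Proof.
split=> [[k [v [w [lv sw ->]]]]|[v [lv ->]]].
  have {}sw i : seg_fun M (w i) by exact/WspaceP.
  have {}lv i : line_fun hm hp (v i) by exact/VspaceP.
  have [c wc] := choice (fun i => sine_span M0 (sw i)).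
  exists (fun j x => \sum_(i < k) c i j * v i x); split.
    by move=> j; exact: line_fun_lincomb.
  apply/funext => p; rewrite /sine_sum /tens.
  under eq_bigr do rewrite wc mulr_sumr.
  rewrite exchange_big /=; apply: eq_bigr => j _; rewrite mulr_suml.
  by apply: eq_bigr => i _; ring.
exists M.-1, v, (@sine R M); split=> // i; first by apply/(VspaceP _ hm0 hp0); exact: lv.
by apply/WspaceP => //; exact: seg_fun_sine.
Qed.

Definition sine_weight (k : 'I_M.-1) : R := seg_mass (@sine R M k) (@sine R M k).

(** Sines are orthogonal for mass and stiffness alike, and the stiffness of each is [eigval] times
    its mass, so the frequencies decouple into energies with [lam = eigval]. *)
Lemma aform_sine_sum al be v v' : line_family v -> line_family v' ->
  aform al be (sine_sum v) (sine_sum v') =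
  \sum_k sine_weight k * line_energy hm hp (lam k) al be (v k) (v' k).
Proof.
move=> lv lv'.
rewrite /sine_sum (aform_tens al be hm0 hp0 M0 lv (@seg_fun_sine R M) lv' (@seg_fun_sine R M)).
apply: eq_bigr => k _; rewrite (bigD1 k)//= big1 ?addr0; last first.
  move=> j jk; rewrite [seg_stiff _ _ _](seg_stiff_sine _ M0 (@seg_fun_sine R M j)).
  by rewrite -/(sine k) (@seg_mass_sine_neq R M k j) 1?eq_sym// !mulr0 addr0.
rewrite [seg_stiff _ _ _](seg_stiff_sine _ M0 (@seg_fun_sine R M k)).
by rewrite -/(sine k) /sine_weight /line_energy /half_energy -/(lam k); ring.
Qed.

Lemma inner_aform (u u' : R * R -> R) : inner u u' = aform 1 1 u u'.
Proof. by apply: eq_Rintegral => p _; rewrite /sigma if_same mul1r. Qed.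

Lemma inner_sine_sum v v' : line_family v -> line_family v' ->
  inner (sine_sum v) (sine_sum v') =
  \sum_k sine_weight k * line_energy hm hp (lam k) 1 1 (v k) (v' k).
Proof. by move=> lv lv'; rewrite inner_aform aform_sine_sum. Qed.

Lemma sine_weight_gt0 k : 0 < sine_weight k.
Proof. exact: seg_mass_sine_gt0. Qed.

Lemma sine_sum_inj v v' : sine_sum v = sine_sum v' -> v = v'.
Proof.
move=> e; apply/funext => k; apply/funext => x; apply/eqP; rewrite -subr_eq0; apply/eqP.
apply: (@sine_free R M (fun k => v k x - v' k x) _ k) => y.
have := congr1 (fun u => u (x, y)) e; rewrite /sine_sum /tens /= => /eqP.
rewrite -subr_eq0 -sumrB => /eqP e'; rewrite -[RHS]e'.
by apply: eq_bigr => j _; rewrite mulrBl.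
Qed.

(** Definiteness, tested on the difference. [riesz_op] picks a representer by [xget], and uniqueness
    identifies the one picked. *)
Lemma inner_unique u1 u2 : S u1 -> S u2 ->
  (forall u, S u -> inner u1 u = inner u2 u) -> u1 = u2.
Proof.
move=> /discrete_spaceP[v1 [l1 ->]] /discrete_spaceP[v2 [l2 ->]] e.
pose z (k : 'I_M.-1) x := 1 * v1 k x + - 1 * v2 k x.
have lz : line_family z by move=> k; exact: line_fun_comb.
have Sz : S (sine_sum z) by apply/discrete_spaceP; exists z.
have zE k : line_energy hm hp (lam k) 1 1 (z k) (z k) =
    line_energy hm hp (lam k) 1 1 (v1 k) (z k) - line_energy hm hp (lam k) 1 1 (v2 k) (z k).
  by rewrite {1}/z line_energy_comb// mul1r mulN1r.
have := e _ Sz; rewrite !inner_sine_sum// => /eqP.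
rewrite -subr_eq0 -sumrB; under eq_bigr do rewrite -mulrBr -zE.
rewrite psumr_eq0; last first.
  by move=> k _; rewrite mulr_ge0 ?(ltW (sine_weight_gt0 k))// line_energy_ge0.
move=> /allP z0; congr sine_sum; apply/funext => k.
have := z0 k; rewrite mem_index_enum => /(_ isT) /=.
rewrite mulf_eq0 gt_eqF ?sine_weight_gt0//= => /eqP /(line_energy_eq0 hm0 hp0 (lam0 k) (lz k)).
move=> zk; apply/funext => x; have := congr1 (fun f => f x) zk.
by rewrite /z mul1r mulN1r => /eqP; rewrite subr_eq0 => /eqP.
Qed.

Definition trace_coef k : R :=
  (sm * trace_energy (lam k) hm + sp * trace_energy (lam k) hp) /
  (trace_energy (lam k) hm + trace_energy (lam k) hp).

Definition mode_op al be ga v k : R -> R := line_op hm hp (lam k) al be (ga k) (v k).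

Lemma line_family_mode_op al be ga v : line_family v -> line_family (mode_op al be ga v).
Proof. by move=> lv k; exact: line_fun_op. Qed.

Lemma trace_sum_gt0 k : 0 < trace_energy (lam k) hm + trace_energy (lam k) hp.
Proof. by rewrite addr_gt0// trace_energy_gt0. Qed.

Lemma discrete_op_sine_sum v : line_family v ->
  discrete_op sm sp r ry M (sine_sum v) = sine_sum (mode_op sm sp trace_coef v).
Proof.
move=> lv; have lT := line_family_mode_op sm sp trace_coef lv.
have ST : S (sine_sum (mode_op sm sp trace_coef v)).
  by apply/discrete_spaceP; eexists; split; [exact: lT|].
have innerT u : S u -> inner (sine_sum (mode_op sm sp trace_coef v)) u =
    aform sm sp (sine_sum v) u.
  move=> /discrete_spaceP[v' [lv' ->]]; rewrite inner_sine_sum// aform_sine_sum//.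
  apply: eq_bigr => k _; rewrite /mode_op line_energy_riesz//.
  by rewrite /trace_coef divfK// gt_eqF// trace_sum_gt0.
rewrite /discrete_op /riesz_op; apply: xget_unique; first exact: (conj ST innerT).
move=> w [Sw innerw].
exact: (inner_unique Sw ST (fun u Su => etrans (innerw u Su) (esym (innerT u Su)))).
Qed.

Lemma sqr_H10norm_sine_sum v : line_family v -> H10norm (sine_sum v) ^+ 2 =
  \sum_k sine_weight k * line_energy hm hp (lam k) 1 1 (v k) (v k).
Proof.
move=> lv; rewrite /H10norm inner_sine_sum// sqr_sqrtr//.
apply: sumr_ge0 => k _.
by rewrite mulr_ge0 ?(ltW (sine_weight_gt0 k))// line_energy_ge0.
Qed.

Lemma H10norm_ge0 u : 0 <= H10norm u.
Proof. exact: sqrtr_ge0. Qed.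

Lemma mode_op_inverse v : sm != 0 -> sp != 0 -> (forall k, trace_coef k != 0) ->
  mode_op sm^-1 sp^-1 (fun k => (trace_coef k)^-1) (mode_op sm sp trace_coef v) = v /\
  mode_op sm sp trace_coef (mode_op sm^-1 sp^-1 (fun k => (trace_coef k)^-1) v) = v.
Proof.
move=> sm0 sp0 t0; split; apply/funext => k.
  by rewrite /mode_op line_op_comp// !mulVf// line_op1.
by rewrite /mode_op line_op_comp// !mulfV// line_op1.
Qed.

Lemma discrete_op_invertible : sm != 0 -> sp != 0 -> (forall k, trace_coef k != 0) ->
  invertible_on S (discrete_op sm sp r ry M).
Proof.
move=> sm0 sp0 t0; split.
- move=> u /discrete_spaceP[v [lv ->]]; rewrite discrete_op_sine_sum//.
  apply/discrete_spaceP; exists (mode_op sm sp trace_coef v); split=> //.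
  exact: line_family_mode_op.
- move=> u1 u2 /set_mem/discrete_spaceP[v1 [l1 ->]] /set_mem/discrete_spaceP[v2 [l2 ->]].
  rewrite !discrete_op_sine_sum// => /sine_sum_inj e.
  have [<- _] := mode_op_inverse v1 sm0 sp0 t0.
  by rewrite e; have [-> _] := mode_op_inverse v2 sm0 sp0 t0.
- move=> f /discrete_spaceP[g [lg ->]].
  pose v := mode_op sm^-1 sp^-1 (fun k => (trace_coef k)^-1) g.
  have lv : line_family v by exact: line_family_mode_op.
  exists (sine_sum v); first by apply/discrete_spaceP; exists v.
  by rewrite discrete_op_sine_sum// /v; have [_ ->] := mode_op_inverse g sm0 sp0 t0.
Qed.

(** The preimage of [f] is recovered from [f] by the reciprocal multipliers, all bounded by [1 / c],
    frequency by frequency in the energy. *)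
Lemma norm_inverse_le c : 0 < c -> c <= `|sm| -> c <= `|sp| ->
  (forall k, c <= `|trace_coef k|) ->
  invertible_on S (discrete_op sm sp r ry M) /\
  (norm_inverse S (discrete_op sm sp r ry M) <= (c^-1)%:E)%E.
Proof.
move=> c0 csm csp ct.
have neq0 (a : R) : c <= `|a| -> a != 0 by move=> ca; rewrite -normr_gt0 (lt_le_trans c0).
have sqr_le (a : R) : c <= `|a| -> a^-1 ^+ 2 <= c^-1 ^+ 2.
  move=> ca; rewrite -[a^-1 ^+ 2]real_normK ?num_real// lerXn2r ?nnegrE ?invr_ge0 ?(ltW c0)//.
  by rewrite normfV lef_pV2// posrE ?normr_gt0 ?neq0.
have inv := discrete_op_invertible (neq0 _ csm) (neq0 _ csp) (fun k => neq0 _ (ct k)).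
split=> //; rewrite /norm_inverse; case: asboolP => // _.
apply: ge_ereal_sup => _ [f [Sf f1] <-]; rewrite lee_fin.
have [pinvS _ _] := bijpinv_bij (fun=> (fun=> 0)) inv.
have Sy := pinvS f Sf.
have [_ _ surj] := inv; have := surjpK (fun=> (fun=> 0)) surj (mem_set Sf).
rewrite -/(inverse_on _ _) in Sy *; move: Sy.
move=> /discrete_spaceP[v [lv ->]]; rewrite discrete_op_sine_sum// => fE.
have {}f1 : H10norm (sine_sum (mode_op sm sp trace_coef v)) <= 1 by rewrite fE.
have lT := line_family_mode_op sm sp trace_coef lv.
rewrite -(@ler_pXn2r _ 2)// ?nnegrE ?H10norm_ge0 ?invr_ge0 ?(ltW c0)//.
have f2 : H10norm (sine_sum (mode_op sm sp trace_coef v)) ^+ 2 <= 1.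
  by rewrite -(expr1n _ 2) lerXn2r ?nnegrE ?H10norm_ge0.
rewrite (sqr_H10norm_sine_sum lT) in f2; rewrite (sqr_H10norm_sine_sum lv).
apply: (@le_trans _ _ (c^-1 ^+ 2 * \sum_k sine_weight k * line_energy hm hp (lam k) 1 1
    (mode_op sm sp trace_coef v k) (mode_op sm sp trace_coef v k))).
  rewrite mulr_sumr.
  apply: ler_sum => k _; rewrite mulrCA; apply: ler_wpM2l; first exact/ltW/sine_weight_gt0.
  have [e _] := mode_op_inverse v (neq0 _ csm) (neq0 _ csp) (fun k => neq0 _ (ct k)).
  have ek : line_op hm hp (lam k) sm^-1 sp^-1 (trace_coef k)^-1 (mode_op sm sp trace_coef v k) =
    v k := congr1 (fun w => w k) e.
  have := line_energy_op_le hm0 hp0 (lam0 k) (lT k) (sqr_le _ csm) (sqr_le _ csp) (sqr_le _ (ct k)).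
  by rewrite ek.
by rewrite ler_piMr// sqr_ge0.
Qed.

Lemma sqr_H10norm_scale c v : line_family v ->
  H10norm (sine_sum (fun k x => c * v k x)) ^+ 2 = c ^+ 2 * H10norm (sine_sum v) ^+ 2.
Proof.
move=> lv; have lc : line_family (fun k x => c * v k x) by move=> k; exact: line_funZ.
apply: etrans (sqr_H10norm_sine_sum lc) _.
apply: etrans (esym (congr1 (fun z => c ^+ 2 * z) (sqr_H10norm_sine_sum lv))).
rewrite mulr_sumr; apply: eq_bigr => k _.
by rewrite line_energy_scale// mulrCA.
Qed.

(** The eigenfunction of the discrete operator for the eigenvalue [trace_coef k]: a pure trace part
    at one frequency. *)
Definition single_mode (k j : 'I_M.-1) : R -> R :=
  if j == k then trace_mode hm hp (lam k) else (fun=> 0).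

Lemma line_family_single_mode k : line_family (single_mode k).
Proof.
move=> j; rewrite /single_mode; case: eqP => _; last exact: line_fun0.
exact: line_fun_trace_mode.
Qed.

Lemma sqr_H10norm_single_mode k : H10norm (sine_sum (single_mode k)) ^+ 2 =
  sine_weight k * (trace_energy (lam k) hm + trace_energy (lam k) hp).
Proof.
rewrite sqr_H10norm_sine_sum; last exact: line_family_single_mode.
rewrite (bigD1 k)//= big1 ?addr0.
  by rewrite /single_mode eqxx line_energy_trace_mode.
move=> j /negbTE jk; rewrite /single_mode jk /line_energy.
by rewrite !half_energy0 !mulr0 addr0 mulr0.
Qed.

Lemma nontrivial_kernel_trace k : trace_coef k = 0 ->
  nontrivial_kernel S (discrete_op sm sp r ry M).
Proof.
move=> t0; have le := line_family_single_mode k.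
exists (sine_sum (single_mode k)); split.
- by apply/discrete_spaceP; eexists; split; [exact: le|].
- move=> e0; have := sqr_H10norm_single_mode k.
  have e1 : sine_sum (single_mode k) = sine_sum (fun _ _ => 0).
    by rewrite e0; apply/funext => p; rewrite /sine_sum /tens big1// => j _; rewrite mul0r.
  have := congr1 (fun v => v k 0) (sine_sum_inj e1).
  by rewrite /single_mode eqxx (trace_mode0 _ hp0) => /eqP; rewrite oner_eq0.
- rewrite discrete_op_sine_sum//; apply/funext => p; rewrite /sine_sum /tens big1// => j _.
  rewrite /mode_op /single_mode; case: eqP => [->|_]; rewrite /line_op /line_glue.
    by rewrite t0 (trace_mode0 _ hp0); case: (p.1 < 0); ring.
  by rewrite !mulr0 !mul0r addr0 if_same mul0r.
Qed.

(** Let [w] be the preimage of the mode divided by its norm [n]. At the interface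
    [trace_coef k * w k 0 = 1 / n], while the squared norm of [w] is at least [n^2 * w k 0 ^+ 2]
    because the trace part carries no more than the full energy. Without an inverse the norm is
    [+oo] by convention. *)
Lemma norm_inverse_ge k (B : R) : 0 <= B -> `|trace_coef k| * B <= 1 ->
  (B%:E <= norm_inverse S (discrete_op sm sp r ry M))%E.
Proof.
move=> B0 tB; rewrite /norm_inverse; case: asboolP => [inv|_]; last exact: leey.
have [n n_ge0 nE] : exists2 n, 0 <= n & H10norm (sine_sum (single_mode k)) = n.
  by eexists; [exact: (H10norm_ge0 (sine_sum (single_mode k)))|].
have n2 : n ^+ 2 = sine_weight k * (trace_energy (lam k) hm + trace_energy (lam k) hp).
  by rewrite -nE; exact: sqr_H10norm_single_mode.
have n2_gt0 : 0 < n ^+ 2 by rewrite n2 mulr_gt0 ?sine_weight_gt0 ?trace_sum_gt0.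
have n_gt0 : 0 < n.
  by rewrite lt_neqAle n_ge0 andbT eq_sym; apply: contraTneq n2_gt0 => ->; rewrite expr0n ltxx.
pose g (j : 'I_M.-1) x := n^-1 * single_mode k j x.
have ls := line_family_single_mode k.
have lg : line_family g by move=> j; exact: line_funZ.
have Sg : S (sine_sum g) by apply/discrete_spaceP; exists g.
have eqr_le (x y : R) : x = y -> x <= y by move=> ->.
have sqr_le (x y : R) : 0 <= x -> 0 <= y -> x ^+ 2 <= y ^+ 2 -> x <= y.
  by move=> x0 y0; rewrite ler_pXn2r.
have g1 : H10norm (sine_sum g) <= 1.
  apply: sqr_le; [exact: H10norm_ge0|exact: ler01|].
  have -> : H10norm (sine_sum g) ^+ 2 = n^-1 ^+ 2 * n ^+ 2.
    transitivity (n^-1 ^+ 2 * H10norm (sine_sum (single_mode k)) ^+ 2); last by rewrite nE.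
    exact: (sqr_H10norm_scale n^-1 ls).
  by rewrite -exprMn mulVf ?expr1n// gt_eqF.
have [pinvS _ _] := bijpinv_bij (fun=> (fun=> 0)) inv.
have [_ _ surj] := inv; have := surjpK (fun=> (fun=> 0)) surj (mem_set Sg).
rewrite -/(inverse_on _ _) => Ay.
apply: (@le_trans _ _
  (H10norm (inverse_on S (discrete_op sm sp r ry M) (sine_sum g)))%:E); last first.
  by apply: ereal_sup_ubound; exists (sine_sum g).
have := pinvS _ Sg; rewrite -/(inverse_on _ _) => Sy.
move: Ay; case/discrete_spaceP : Sy => w [lw ->]; rewrite discrete_op_sine_sum// => /sine_sum_inj e.
have := congr1 (fun v => v k 0) e.
rewrite /mode_op line_op0// /g /single_mode eqxx (trace_mode0 _ hp0) mulr1 => tw.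
rewrite lee_fin; apply: sqr_le; [exact: B0|exact: H10norm_ge0|].
apply: (@le_trans _ _
  (\sum_j sine_weight j * line_energy hm hp (lam j) 1 1 (w j) (w j))); last first.
  by apply: eqr_le; exact: (esym (sqr_H10norm_sine_sum lw)).
have ge0 j : 0 <= sine_weight j * line_energy hm hp (lam j) 1 1 (w j) (w j).
  by rewrite mulr_ge0 ?(ltW (sine_weight_gt0 j))// line_energy_ge0.
rewrite (bigD1 k)//= -[leLHS]addr0; apply: lerD; last by apply: sumr_ge0 => j _; exact: ge0.
apply: (@le_trans _ _ (n ^+ 2 * w k 0 ^+ 2)).
  have nw : B <= n * `|w k 0|.
    have tn : `|trace_coef k| * (n * `|w k 0|) = 1.
      rewrite mulrCA -normrM tw normfV (gtr0_norm n_gt0) mulfV// gt_eqF//.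
    have t_gt0 : 0 < `|trace_coef k|.
      rewrite lt_neqAle normr_ge0 andbT eq_sym; apply/negP => /eqP t0.
      by move: tn; rewrite t0 mul0r => /eqP; rewrite eq_sym oner_eq0.
    by rewrite -(ler_pM2l t_gt0) tn.
  rewrite -[w k 0 ^+ 2]real_normK ?num_real// -exprMn lerXn2r ?nnegrE//.
  by rewrite mulr_ge0// ltW.
rewrite n2 -mulrA ler_wpM2l ?(ltW (sine_weight_gt0 k))// mulrDl.
rewrite /line_energy !mul1r; apply: lerD.
  have := half_energy_trace_le hm0 hp0 (lam0 k) (or_intror erefl) (lw k).
  by rewrite normrN gtr0_norm.
have := half_energy_trace_le hm0 hp0 (lam0 k) (or_introl erefl) (lw k).
by rewrite gtr0_norm.
Qed.

End DiscreteOperator.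

(** * Mesh ratios and angles *)

Section Ratios.
Variable R : realType.
Implicit Types (sm sp kappa r ry mu t q : R) (k m n M : nat).

Lemma sqrtM_le (a b c d : R) : 0 <= a -> 0 <= c -> a * b <= c * d ->
  Num.sqrt a * Num.sqrt b <= Num.sqrt c * Num.sqrt d.
Proof. by move=> a0 c0 le_abcd; rewrite -!sqrtrM// ler_wsqrtr. Qed.

Definition weighted_mean kappa (a b : R) : R := (a + kappa * b) / (a + b).

(** The mean depends only on the ratio of its weights: after cross-multiplication the difference is
    [(1 - kappa) (a d - b c)]. *)
Lemma weighted_mean_le kappa (a b c d : R) : kappa <= 1 -> 0 < a -> 0 < b -> 0 < c -> 0 < d ->
  b * c <= a * d -> weighted_mean kappa c d <= weighted_mean kappa a b.
Proof.
move=> k1 a0 b0 c0 d0 le_bc.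
rewrite /weighted_mean ler_pdivrMr ?addr_gt0// mulrAC ler_pdivlMr ?addr_gt0//.
rewrite -subr_ge0.
have -> : (a + kappa * b) * (c + d) - (c + kappa * d) * (a + b) =
  (1 - kappa) * (a * d - b * c) by ring.
by rewrite mulr_ge0// subr_ge0.
Qed.

Lemma norm_between_ge (x y z : R) : 0 < y * z -> (y <= x <= z) \/ (z <= x <= y) ->
  Num.min `|y| `|z| <= `|x|.
Proof.
move=> yz h; rewrite ge_min.
have [y0|y0] := ltP 0 y.
  have z0 : 0 < z by rewrite pmulr_rgt0 in yz.
  case: h => /andP[h1 h2].
    by rewrite (gtr0_norm y0) (ger0_norm (le_trans (ltW y0) h1)) h1.
  by rewrite (gtr0_norm z0) (ger0_norm (le_trans (ltW z0) h1)) h1 orbT.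
have {}y0 : y < 0.
  by rewrite lt_neqAle y0 andbT; apply: contraTneq yz => ->; rewrite mul0r ltxx.
have z0 : z < 0 by rewrite nmulr_rgt0 in yz.
case: h => /andP[h1 h2].
  by rewrite (ltr0_norm z0) (ler0_norm (le_trans h2 (ltW z0))) lerN2 h2 orbT.
by rewrite (ltr0_norm y0) (ler0_norm (le_trans h2 (ltW y0))) lerN2 h2.
Qed.

(** The trace energy without its factor [sqrt lam], which cancels in the mean. Here
    [lam h_-^2 = mu / ry^2], and in [mode_plus] [lam h_+^2 = r^2 mu / ry^2]. *)
Definition mode_minus ry mu : R := Num.sqrt (1 + mu / (12 * ry ^+ 2)).
Definition mode_plus r ry mu : R := Num.sqrt (1 + r ^+ 2 * mu / (12 * ry ^+ 2)).

Lemma mode_minus_gt0 ry mu : 0 <= mu -> 0 < mode_minus ry mu.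
Proof. by move=> mu0; rewrite sqrtr_gt0 ltr_pwDl// divr_ge0// mulr_ge0// sqr_ge0. Qed.

Lemma mode_plus_gt0 r ry mu : 0 <= mu -> 0 < mode_plus r ry mu.
Proof.
by move=> mu0; rewrite sqrtr_gt0 ltr_pwDl// divr_ge0// mulr_ge0// sqr_ge0.
Qed.

Lemma trace_coefE sm sp r ry M (k : 'I_M.-1) : sm != 0 -> 0 < r -> 0 < ry ->
  trace_coef sm sp r ry k = sm * weighted_mean (sp / sm)
    (mode_minus ry (symbol (theta R M k.+1))) (mode_plus r ry (symbol (theta R M k.+1))).
Proof.
move=> sm0 r0 ry0; have M0 := sine_index_gt0 k.
have lam0 := eigval_gt0 R M0 k; have h0 := hy_gt0 R M0.
have hm0 := hminus_gt0 ry0 M0; have hp0 := hplus_gt0 r0 ry0 M0.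
have mu0 : 0 <= symbol (theta R M k.+1).
  by apply/ltW/symbol_gt0; case/andP: (sine_index k); exact: theta_itv.
have a0 := mode_minus_gt0 ry mu0; have b0 := mode_plus_gt0 r ry mu0.
have eA : trace_energy (eigval R M k.+1) (hminus ry M) =
    Num.sqrt (eigval R M k.+1) * mode_minus ry (symbol (theta R M k.+1)).
  rewrite trace_energyE// /mode_minus; congr (_ * Num.sqrt (1 + _)).
  by rewrite /eigval /hminus; field; rewrite !gt_eqF.
have eB : trace_energy (eigval R M k.+1) (hplus r ry M) =
    Num.sqrt (eigval R M k.+1) * mode_plus r ry (symbol (theta R M k.+1)).
  rewrite trace_energyE// /mode_plus; congr (_ * Num.sqrt (1 + _)).
  by rewrite /eigval /hplus /hminus; field; rewrite !gt_eqF.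
rewrite /trace_coef eA eB /weighted_mean.
have s0 : 0 < Num.sqrt (eigval R M k.+1) by rewrite sqrtr_gt0.
field; rewrite sm0 !gt_eqF ?addr_gt0 ?mulr_gt0//.
Qed.

Lemma symbol_lt12 t : 0 < t < pi -> symbol t < 12.
Proof.
move=> t_itv; have c2 := two_cos_gt0 t; rewrite /symbol ltr_pdivrMr//.
have s0 := sin_gt0_pi t_itv; have := cos2Dsin2 t; have := cos_geN1 t.
by rewrite le_eqVlt => /predU1P[<-|]; nra.
Qed.

(** With [xi = mu / (12 ry^2)] the squared ratio of the weights is [(1 + r^2 xi) / (1 + xi)],
    monotone on [0 <= xi <= 1 / ry^2] in a direction given by the sign of [r^2 - 1]. The right end
    yields [z], after multiplying both weights by [ry]. *)
Lemma weighted_mean_between kappa r ry mu : kappa <= 1 -> 0 < r -> 0 < ry -> 0 <= mu <= 12 ->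
  let x := weighted_mean kappa (mode_minus ry mu) (mode_plus r ry mu) in
  let y := weighted_mean kappa 1 1 in
  let z := weighted_mean kappa (Num.sqrt (1 + ry ^+ 2)) (Num.sqrt (r ^+ 2 + ry ^+ 2)) in
  (y <= x <= z) \/ (z <= x <= y).
Proof.
move=> k1 r0 ry0 /andP[mu0 mu12] x y z.
have a0 := mode_minus_gt0 ry mu0; have b0 := mode_plus_gt0 r ry mu0.
have t0 : 0 < ry ^+ 2 by rewrite exprn_gt0.
have s1 : 0 < Num.sqrt (1 + ry ^+ 2) by rewrite sqrtr_gt0 addr_gt0.
have s2 : 0 < Num.sqrt (r ^+ 2 + ry ^+ 2) by rewrite sqrtr_gt0 addr_gt0// exprn_gt0.
have xi0 : 0 <= mu / (12 * ry ^+ 2) by rewrite divr_ge0// mulr_ge0// ltW.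
have xi_t : mu / (12 * ry ^+ 2) * ry ^+ 2 <= 1.
  have -> : mu / (12 * ry ^+ 2) * ry ^+ 2 = mu / 12 by field; rewrite gt_eqF.
  by rewrite ler_pdivrMr// mul1r.
have eb : mode_plus r ry mu = Num.sqrt (1 + r ^+ 2 * (mu / (12 * ry ^+ 2))).
  by rewrite /mode_plus mulrA.
have r20 := sqr_ge0 r.
have [r1|r1] := leP 1 (r ^+ 2).
  right; apply/andP; split; apply: weighted_mean_le => //.
    rewrite eb /mode_minus; apply: sqrtM_le; [by rewrite addr_ge0// mulr_ge0|exact: addr_ge0|].
    rewrite -subr_ge0; set xi := mu / _ in xi0 xi_t *; set t := ry ^+ 2 in t0 xi_t *.
    have -> : (1 + xi) * (r ^+ 2 + t) - (1 + r ^+ 2 * xi) * (1 + t) =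
      (r ^+ 2 - 1) * (1 - xi * t) by ring.
    by rewrite mulr_ge0// subr_ge0.
  by rewrite !mul1r eb /mode_minus ler_wsqrtr// lerD2l ler_peMl.
left; apply/andP; split; apply: weighted_mean_le => //.
  by rewrite !mulr1 eb /mode_minus ler_wsqrtr// lerD2l ler_piMl// ltW.
rewrite eb /mode_minus; set t := ry ^+ 2 in t0 xi_t *.
apply: sqrtM_le; [by rewrite addr_ge0// ltW|by rewrite addr_ge0// ltW|].
rewrite -subr_ge0; set xi := mu / _ in xi0 xi_t *.
have -> : (1 + t) * (1 + r ^+ 2 * xi) - (r ^+ 2 + t) * (1 + xi) =
  (1 - r ^+ 2) * (1 - xi * t) by ring.
by rewrite mulr_ge0 ?subr_ge0// ltW.
Qed.

Definition discriminant kappa r ry : R :=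
  1 + ry ^+ 2 * (1 - kappa ^+ 2) - r ^+ 2 * kappa ^+ 2.

(** Multiplication by the conjugate, which is positive since [kappa < 0], turns the sum of roots
    into [discriminant]. *)
Lemma sqrt_sum_sign kappa r ry : kappa < 0 -> 0 < r -> 0 < ry ->
  (0 < Num.sqrt (1 + ry ^+ 2) + kappa * Num.sqrt (r ^+ 2 + ry ^+ 2)) =
    (0 < discriminant kappa r ry) /\
  (Num.sqrt (1 + ry ^+ 2) + kappa * Num.sqrt (r ^+ 2 + ry ^+ 2) < 0) =
    (discriminant kappa r ry < 0).
Proof.
move=> k0 r0 ry0; have t0 : 0 < ry ^+ 2 by rewrite exprn_gt0.
have r20 : 0 < r ^+ 2 by rewrite exprn_gt0.
have s1 : 0 < Num.sqrt (1 + ry ^+ 2) by rewrite sqrtr_gt0 addr_gt0.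
have s2 : 0 < Num.sqrt (r ^+ 2 + ry ^+ 2) by rewrite sqrtr_gt0 addr_gt0.
have e1 : Num.sqrt (1 + ry ^+ 2) ^+ 2 = 1 + ry ^+ 2 by rewrite sqr_sqrtr// addr_ge0// ltW.
have e2 : Num.sqrt (r ^+ 2 + ry ^+ 2) ^+ 2 = r ^+ 2 + ry ^+ 2.
  by rewrite sqr_sqrtr// addr_ge0// ltW.
have p0 : 0 < Num.sqrt (1 + ry ^+ 2) - kappa * Num.sqrt (r ^+ 2 + ry ^+ 2).
  by rewrite subr_gt0 (lt_trans _ s1)// nmulr_rlt0.
have -> : discriminant kappa r ry =
    (Num.sqrt (1 + ry ^+ 2) - kappa * Num.sqrt (r ^+ 2 + ry ^+ 2)) *
    (Num.sqrt (1 + ry ^+ 2) + kappa * Num.sqrt (r ^+ 2 + ry ^+ 2)).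
  rewrite -subr_sqr exprMn e1 e2 /discriminant; ring.
by rewrite pmulr_rgt0// pmulr_rlt0.
Qed.

Lemma norm_lt1 kappa : kappa < 0 -> (`|kappa| < 1) = (0 < 1 - kappa ^+ 2).
Proof.
move=> k0; rewrite ltr0_norm// subr_gt0.
by apply/idP/idP => h; nra.
Qed.

Lemma norm_gt1 kappa : kappa < 0 -> (1 < `|kappa|) = (1 - kappa ^+ 2 < 0).
Proof.
move=> k0; rewrite ltr0_norm// subr_lt0.
by apply/idP/idP => h; nra.
Qed.

Lemma stable_weighted_mean kappa r ry : kappa < 0 -> 0 < r -> 0 < ry ->
  stable_ratios kappa r ry -> 0 < weighted_mean kappa 1 1 *
    weighted_mean kappa (Num.sqrt (1 + ry ^+ 2)) (Num.sqrt (r ^+ 2 + ry ^+ 2)).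
Proof.
move=> k0 r0 ry0 st; have [sp sn] := sqrt_sum_sign k0 r0 ry0.
have s1 : 0 < Num.sqrt (1 + ry ^+ 2) by rewrite sqrtr_gt0 addr_gt0// exprn_gt0.
have s2 : 0 < Num.sqrt (r ^+ 2 + ry ^+ 2) by rewrite sqrtr_gt0 addr_gt0// exprn_gt0.
rewrite /weighted_mean mulr1; case: st => -[]; rewrite ltr0_norm// => k1 rk.
  apply: mulr_gt0; apply: divr_gt0; [lra|lra| |exact: addr_gt0].
  by rewrite sp /discriminant subr_gt0.
rewrite nmulr_rgt0 ?ltr_pdivrMr ?addr_gt0// ?mul0r; last by lra.
by rewrite sn /discriminant subr_lt0.
Qed.

Lemma stability_constantP sm sp r ry : sm < 0 -> 0 < sp -> 0 < r -> 0 < ry ->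
  stable_ratios (sp / sm) r ry ->
  let c := `|sm| * stability_constant (sp / sm) r ry in
  [/\ 0 < c, c <= `|sm|, c <= `|sp| &
    forall M (k : 'I_M.-1), c <= `|trace_coef sm sp r ry k|].
Proof.
move=> sm0 sp0 r0 ry0 st c; have smn : sm != 0 by rewrite lt_eqF.
have k0 : sp / sm < 0 by rewrite nmulr_llt0 ?invr_lt0.
have yz := stable_weighted_mean k0 r0 ry0 st.
have nsm : 0 < `|sm| by rewrite normr_gt0.
have cE : stability_constant (sp / sm) r ry = Num.min 1 (Num.min `|sp / sm|
    (Num.min `|weighted_mean (sp / sm) 1 1|
      `|weighted_mean (sp / sm) (Num.sqrt (1 + ry ^+ 2)) (Num.sqrt (r ^+ 2 + ry ^+ 2))|)).
  by rewrite /stability_constant /weighted_mean mulr1.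
split.
- rewrite /c mulr_gt0// cE !lt_min ltr01 normr_gt0 lt_eqF//=.
  by move: yz; rewrite !normr_gt0 -negb_or -mulf_eq0 => /gt_eqF ->.
- by rewrite /c cE ger_pMr// ge_min lexx.
- have -> : `|sp| = `|sm| * `|sp / sm| by rewrite -normrM mulrC divfK.
  by rewrite /c cE ler_pM2l// ge_min ge_min lexx orbT.
- move=> M k; rewrite trace_coefE// normrM /c cE ler_pM2l//.
  apply: (@le_trans _ _ (Num.min `|weighted_mean (sp / sm) 1 1|
      `|weighted_mean (sp / sm) (Num.sqrt (1 + ry ^+ 2)) (Num.sqrt (r ^+ 2 + ry ^+ 2))|)).
    by rewrite ge_min; apply/orP; right; rewrite ge_min lexx orbT.
  apply: norm_between_ge => //; apply: weighted_mean_between => //.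
    by apply: ltW; apply: lt_trans k0 _.
  have /andP[i0 iM] := sine_index k; have th := theta_itv R i0 iM.
  by rewrite (ltW (symbol_gt0 th)) (ltW (symbol_lt12 th)).
Qed.

(** Inverting [symbol] gives [cos t = (6 - 2 mu) / (6 + mu)]; this is its value at the critical [mu
    = - 12 ry^2 (1 - kappa^2) / (1 - kappa^2 r^2)]. *)
Definition cos_angle kappa r ry : R :=
  1 + 6 * ry ^+ 2 * (1 - kappa ^+ 2) /
      ((1 - kappa ^+ 2 * r ^+ 2) - 2 * ry ^+ 2 * (1 - kappa ^+ 2)).

Lemma unstable_ratiosE kappa r ry : kappa < 0 ->
  unstable_ratios kappa r ry <->
  (0 < 1 - kappa ^+ 2 /\ 1 - kappa ^+ 2 * r ^+ 2 < - (ry ^+ 2 * (1 - kappa ^+ 2))) \/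
  (1 - kappa ^+ 2 < 0 /\ - (ry ^+ 2 * (1 - kappa ^+ 2)) < 1 - kappa ^+ 2 * r ^+ 2).
Proof.
move=> k0; rewrite /unstable_ratios norm_lt1// norm_gt1//.
by split=> -[[h1 h2]|[h1 h2]]; [left|right|left|right]; split=> //; lra.
Qed.

(** * The critical angle and the zero of the trace multiplier *)

Section Unstable.
Variables kappa r ry : R.
Hypotheses (k0 : kappa < 0) (r0 : 0 < r) (ry0 : 0 < ry).
Hypothesis unst : unstable_ratios kappa r ry.

Let D := 1 - kappa ^+ 2.
Let c := 1 - kappa ^+ 2 * r ^+ 2.
Let t := ry ^+ 2.
Let t0 : 0 < t. Proof. by rewrite exprn_gt0. Qed.

(** The distances to -1 and 1 are [2 (c + t D) / (c - 2 t D)] and [- 6 t D / (c - 2 t D)];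
    instability means that [D] and [c + t D] have opposite signs, which makes both positive. *)
Lemma cos_angle_itv : -1 < cos_angle kappa r ry < 1.
Proof.
move/(unstable_ratiosE _ _ k0): unst; rewrite /cos_angle -/D -/c -/t.
case=> -[D0 cD].
  have tD : 0 < t * D by rewrite mulr_gt0.
  have den : c - 2 * t * D < 0 by lra.
  apply/andP; split; rewrite -subr_gt0.
    have -> : 1 + 6 * t * D / (c - 2 * t * D) - -1 = (2 * c + 2 * t * D) / (c - 2 * t * D).
      by field; rewrite lt_eqF.
    by rewrite nmulr_rgt0 ?invr_lt0//; lra.
  rewrite opprD addrA subrr add0r oppr_gt0 nmulr_llt0 ?invr_lt0//; lra.
have tD : t * D < 0 by rewrite pmulr_rlt0.
have den : 0 < c - 2 * t * D by lra.
apply/andP; split; rewrite -subr_gt0.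
  have -> : 1 + 6 * t * D / (c - 2 * t * D) - -1 = (2 * c + 2 * t * D) / (c - 2 * t * D).
    by field; rewrite gt_eqF.
  by rewrite divr_gt0//; lra.
rewrite opprD addrA subrr add0r oppr_gt0 pmulr_llt0 ?invr_gt0//; lra.
Qed.

Lemma cos_s_angle : cos (s_angle kappa r ry) = cos_angle kappa r ry.
Proof.
have /andP[h1 h2] := cos_angle_itv.
by rewrite /s_angle acosK// in_itv /= !ltW.
Qed.

Lemma s_angle_itv : 0 < s_angle kappa r ry < pi.
Proof.
have /andP[h1 h2] := cos_angle_itv.
by rewrite /s_angle acos_gt0 ?acos_ltpi// ?h1 ?h2 ?ltW.
Qed.

(** The numerator vanishes when the square of [mode_minus] is [kappa^2] times that of [mode_plus],
    [kappa] being negative. At the critical angle [xi = - D / c], which solves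
    [1 + xi = kappa^2 (1 + r^2 xi)]. *)
Lemma weighted_mean_s_angle :
  weighted_mean kappa (mode_minus ry (symbol (s_angle kappa r ry)))
    (mode_plus r ry (symbol (s_angle kappa r ry))) = 0.
Proof.
have tn0 : t != 0 by rewrite gt_eqF.
have [cn0 dn0 cD] : [/\ c != 0, c - 2 * t * D != 0 & c * D < 0].
  move/(unstable_ratiosE _ _ k0): unst; rewrite -/D -/c -/t => -[] [D0 cD].
    have tD : 0 < t * D by rewrite mulr_gt0.
    have c0 : c < 0 by lra.
    split; [by rewrite lt_eqF|by rewrite lt_eqF//; lra|by rewrite nmulr_rlt0].
  have tD : t * D < 0 by rewrite pmulr_rlt0.
  have c0 : 0 < c by lra.
  split; [by rewrite gt_eqF|by rewrite gt_eqF//; lra|by rewrite pmulr_rlt0].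
have muE : symbol (s_angle kappa r ry) = - (12 * t * D / c).
  rewrite /symbol cos_s_angle /cos_angle -/D -/c -/t.
  field; rewrite cn0 dn0 /=.
  have -> : 2 * (c - 2 * t * D) + (c - 2 * t * D + 6 * t * D) = 3 * c by ring.
  by rewrite mulf_neq0.
rewrite /weighted_mean; apply/eqP; rewrite mulf_eq0; apply/orP; left.
rewrite /mode_minus /mode_plus muE -/t.
have -> : - (12 * t * D / c) / (12 * t) = - (D / c) by field; rewrite cn0 tn0.
have -> : r ^+ 2 * - (12 * t * D / c) / (12 * t) = - (r ^+ 2 * D / c) by field; rewrite cn0 tn0.
have Dc : D / c < 0.
  have -> : D / c = c * D / c ^+ 2 by field.
  by rewrite pmulr_llt0// invr_gt0 exprn_even_gt0.
have -> : 1 - D / c = kappa ^+ 2 * (1 - r ^+ 2 * D / c).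
  transitivity ((1 - D) - (1 - c) * D / c); first by field.
  by move: (c^-1) => ci; rewrite /D /c; ring.
by rewrite sqrtrM ?sqr_ge0// sqrtr_sqr ltr0_norm// mulNr addNr.
Qed.

End Unstable.

(** * Rational critical angles and density of the mesh angles *)

(** For the angle [pi l / k] the number of cells is [m k / l]; divisibility of the product [m * k]
    serves both [l %| m] and suitable multiples of [k]. *)
Lemma s_angle_admissible kappa r ry l k m : 0 < ry -> (0 < l)%N -> (0 < k)%N -> (0 < m)%N ->
  s_angle kappa r ry = pi * l%:R / k%:R -> (l %| m * k)%N ->
  admissible_hy (ry * hminus_kernel kappa r ry m).
Proof.
move=> ry0 l0 k0 m0 sE /dvdnP[N NE]; exists N; split.
  rewrite lt0n; apply/eqP => N0; move/eqP: NE.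
  by rewrite N0 mul0n muln_eq0 (gtn_eqF m0) (gtn_eqF k0).
have {}NE : m%:R * k%:R = N%:R * l%:R :> R by rewrite -!natrM NE.
rewrite /hminus_kernel sE.
have mn : m%:R != 0 :> R by rewrite pnatr_eq0 -lt0n.
have kn : k%:R != 0 :> R by rewrite pnatr_eq0 -lt0n.
have ln : l%:R != 0 :> R by rewrite pnatr_eq0 -lt0n.
have pin : (pi : R) != 0 by rewrite gt_eqF// pi_gt0.
have ryn : ry != 0 by rewrite gt_eqF.
apply: (mulIf ln); rewrite -NE; move: (pi : R) pin => p pin.
by field; rewrite mn kn ln pin ryn.
Qed.

(** Since [cos s = (c + 4 t D) / (c - 2 t D)], the choice [t = - c / (4 D)] gives the angle
    [pi / 2]. It is positive because instability forces [c] and [D] to have opposite signs. *)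
Lemma exists_ry_angle kappa r ry : kappa < 0 -> 0 < ry -> unstable_ratios kappa r ry ->
  exists ry' : R, [/\ 0 < ry', unstable_ratios kappa r ry' &
    s_angle kappa r ry' = pi * 1%:R / 2%:R].
Proof.
move=> k0 ry0 /(unstable_ratiosE _ _ k0).
set D := 1 - kappa ^+ 2; set c := 1 - kappa ^+ 2 * r ^+ 2 => unst.
have t0 : 0 < ry ^+ 2 by rewrite exprn_gt0.
have [Dn cn cD] : [/\ D != 0, c != 0 & 0 < - c / (4 * D)].
  case: unst => -[D0 cD].
    have tD : 0 < ry ^+ 2 * D by rewrite mulr_gt0.
    by split; [rewrite gt_eqF|rewrite lt_eqF//; lra|rewrite divr_gt0 ?mulr_gt0//; lra].
  have tD : ry ^+ 2 * D < 0 by rewrite pmulr_rlt0.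
  split; [by rewrite lt_eqF|by rewrite gt_eqF//; lra|].
  by rewrite nmulr_rgt0 ?invr_lt0 ?pmulr_rlt0//; lra.
exists (Num.sqrt (- c / (4 * D))).
have e : Num.sqrt (- c / (4 * D)) ^+ 2 = - c / (4 * D) by rewrite sqr_sqrtr// ltW.
have eD : - c / (4 * D) * D = - (c / 4) by field.
split; first by rewrite sqrtr_gt0.
  apply/(unstable_ratiosE _ _ k0); rewrite -/D -/c e eD.
  case: unst => -[D0 cD'].
    have tD : 0 < ry ^+ 2 * D by rewrite mulr_gt0.
    by left; split=> //; lra.
  have tD : ry ^+ 2 * D < 0 by rewrite pmulr_rlt0.
  by right; split=> //; lra.
rewrite /s_angle -/D -/c e.
have -> : 1 + 6 * (- c / (4 * D)) * D / (c - 2 * (- c / (4 * D)) * D) = 0.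
  have -> : c - 2 * (- c / (4 * D)) * D = 3 / 2 * c by field.
  by field; rewrite Dn cn.
by rewrite acos0 mulr1.
Qed.

(** Supplies rational multiples of [pi] close to [pi], the range in which the equation for [r] is
    solvable. *)
Lemma cos_near_pi (e : R) : 0 < e ->
  exists n, (0 < n)%N /\ 1 + cos (pi * n%:R / n.+1%:R) < e.
Proof.
move=> e0.
have cv : cos (pi / n.+1%:R) @[n --> \oo] --> cos (0 : R).
  suff cv0 : pi / n.+1%:R @[n --> \oo] --> (0 : R).
    by apply: (cvg_comp _ cos cv0); exact: continuous_cos.
  rewrite -(mulr0 (pi : R)); apply: cvgM; first exact: cvg_cst.
  by have := @cvg_harmonic R; rewrite /harmonic.
have : \forall n \near \oo, 1 - e < cos (pi / n.+1%:R).
  by apply: (cvgr_gt _ cv); rewrite cos0 ltrBlDr ltrDl.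
move=> [N _ HN]; exists N.+1; split=> //.
have := HN N.+1 (leqnSn N); rewrite /=.
have -> : pi * N.+1%:R / N.+2%:R = pi - pi / N.+2%:R :> R.
  have -> : N.+1%:R = N.+2%:R - 1 :> R by rewrite -[N.+2%:R]natr1 addrK.
  by field.
by rewrite cosB cospi sinpi; lra.
Qed.

(** Prescribing [cos s = q] forces [1 - kappa^2 r'^2 = - ry^2 D g] with [g = (4 + 2 q) / (1 - q)],
    so [1 + ry^2 D g] must be positive. For [D < 0] this may fail at a convenient angle such as
    [pi / 2]; as [q] tends to -1, [g] tends to 1 and the condition becomes [1 + ry^2 D > 0], which
    instability grants. The strict inequality [g > 1] keeps the new ratios unstable. *)
Lemma exists_r_angle kappa r ry : kappa < 0 -> 0 < r -> 0 < ry -> unstable_ratios kappa r ry ->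
  exists r' : R, [/\ 0 < r', unstable_ratios kappa r' ry &
    exists n, (0 < n)%N /\ s_angle kappa r' ry = pi * (n ^ 2)%:R / (n * n.+1)%:R].
Proof.
move=> k0 r0 ry0 /(unstable_ratiosE _ _ k0).
set D := 1 - kappa ^+ 2; set c := 1 - kappa ^+ 2 * r ^+ 2 => unst.
have t0 : 0 < ry ^+ 2 by rewrite exprn_gt0.
have kk : 0 < kappa ^+ 2 by rewrite exprn_even_gt0//= lt_eqF.
(* For [D < 0] instability reads [kappa^2 r^2 < 1 + ry^2 D], whose left side is positive. *)
have pos : 0 < 1 + ry ^+ 2 * D.
  case: unst => -[D0 cD]; first by rewrite addr_gt0// mulr_gt0.
  have kr : 0 < kappa ^+ 2 * r ^+ 2 by rewrite mulr_gt0// exprn_gt0.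
  by rewrite /c in cD; lra.
(* Here [x] stands for [1 + q], so that [g = (2 + 2 x) / (2 - x)]. With [a = 1 + ry^2 D] the
   numerator to be made positive is [2 a + 2 a x - 3 x], for which [x < a / 4] suffices. *)
have [e e0 eD] : exists2 e, 0 < e & forall x, 0 < x -> x < e ->
    x < 1 /\ 0 < 1 + ry ^+ 2 * D * ((2 + 2 * x) / (2 - x)).
  pose a := 1 + ry ^+ 2 * D; have a0 : 0 < a by [].
  exists (Num.min 1 (a / 4)); first by rewrite lt_min ltr01 divr_gt0.
  move=> x x0; rewrite lt_min => /andP[x1 xa]; split=> //.
  have d0 : 0 < 2 - x by lra.
  have -> : 1 + ry ^+ 2 * D * ((2 + 2 * x) / (2 - x)) =
      ((2 - x) + (a - 1) * (2 + 2 * x)) / (2 - x) by rewrite /a; field; rewrite gt_eqF.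
  by rewrite divr_gt0//; nra.
have [n [n0 nE]] := cos_near_pi e0.
set th := pi * n%:R / n.+1%:R in nE; set q := cos th in nE.
have th_itv : 0 < th < pi by apply: theta_itv.
have q_itv : -1 < q < 1.
  have s0 := sin_gt0_pi th_itv; have := cos2Dsin2 th; rewrite -/q => h.
  by apply/andP; split; nra.
have /andP[q1 q2] := q_itv.
have [x1 gpos] : 1 + q < 1 /\ 0 < 1 + ry ^+ 2 * D * ((2 + 2 * (1 + q)) / (2 - (1 + q))).
  by apply: eD => //; lra.
pose g := (4 + 2 * q) / (1 - q).
have g1 : 1 < g by rewrite /g ltr_pdivlMr ?subr_gt0//; lra.
have {}gpos : 0 < 1 + ry ^+ 2 * D * g.
  move: gpos; have -> : 2 + 2 * (1 + q) = 4 + 2 * q by ring.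
  by have -> : 2 - (1 + q) = 1 - q by ring.
pose r' := Num.sqrt ((1 + ry ^+ 2 * D * g) / kappa ^+ 2).
have r'0 : 0 < r' by rewrite sqrtr_gt0 divr_gt0.
have c'E : 1 - kappa ^+ 2 * r' ^+ 2 = - (ry ^+ 2 * D * g).
  rewrite sqr_sqrtr; last by rewrite ltW// divr_gt0.
  by rewrite mulrC divfK ?gt_eqF//; ring.
have Dn : D != 0 by case: unst => -[D0 _]; [rewrite gt_eqF|rewrite lt_eqF].
exists r'; split=> //.
  apply/(unstable_ratiosE _ _ k0); rewrite -/D c'E.
  case: unst => -[D0 _].
    left; split=> //; have tD : 0 < ry ^+ 2 * D by rewrite mulr_gt0.
    by rewrite ltrN2 ltr_pMr.
  right; split=> //; have tD : ry ^+ 2 * D < 0 by rewrite pmulr_rlt0.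
  by rewrite ltrN2 gtr_nMr.
exists n; split=> //.
have -> : pi * (n ^ 2)%:R / (n * n.+1)%:R = th.
  rewrite /th natrM natrX -!mulrA; congr (_ * _); field.
  by rewrite nat1r !pnatr_eq0 -!lt0n n0.
rewrite /s_angle -/D c'E.
have -> : 1 + 6 * ry ^+ 2 * D / (- (ry ^+ 2 * D * g) - 2 * ry ^+ 2 * D) = q.
  have q1n : 1 - q != 0 by rewrite gt_eqF// subr_gt0.
  have -> : - (ry ^+ 2 * D * g) - 2 * ry ^+ 2 * D = - (6 * ry ^+ 2 * D / (1 - q)).
    by rewrite /g; field.
  by field; rewrite Dn q1n gt_eqF.
by rewrite /q cosK// in_itv /=; case/andP: th_itv => /ltW -> /ltW ->.
Qed.

Lemma continuous_weighted_mean_symbol kappa r ry :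
  continuous (fun t => weighted_mean kappa (mode_minus ry (symbol t)) (mode_plus r ry (symbol t))).
Proof.
have csym : continuous (@symbol R).
  move=> t; apply: cvgM.
    apply: cvgM; first exact: cvg_cst.
    by apply: cvgB; [exact: cvg_cst|exact: continuous_cos].
  apply: cvgV; first by rewrite gt_eqF// two_cos_gt0.
  by apply: cvgD; [exact: cvg_cst|exact: continuous_cos].
have sym0 t : 0 <= symbol t.
  by rewrite divr_ge0 ?(ltW (two_cos_gt0 t))// mulr_ge0// subr_ge0 cos_le1.
have cm : continuous (fun t => mode_minus ry (symbol t)).
  move=> t; apply: (@continuous_comp _ _ _ (fun t => 1 + symbol t / (12 * ry ^+ 2)) Num.sqrt).
    apply: cvgD; first exact: cvg_cst.
    by apply: cvgM; [exact: csym|exact: cvg_cst].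
  exact: sqrt_continuous.
have cp : continuous (fun t => mode_plus r ry (symbol t)).
  move=> t; apply: (@continuous_comp _ _ _
    (fun t => 1 + r ^+ 2 * symbol t / (12 * ry ^+ 2)) Num.sqrt).
    apply: cvgD; first exact: cvg_cst.
    apply: cvgM; last exact: cvg_cst.
    by apply: cvgM; [exact: cvg_cst|exact: csym].
  exact: sqrt_continuous.
move=> t; apply: cvgM.
  apply: cvgD; first exact: cm.
  by apply: cvgM; [exact: cvg_cst|exact: cp].
apply: cvgV; last by apply: cvgD; [exact: cm|exact: cp].
by rewrite gt_eqF// addr_gt0//;
  [exact: (mode_minus_gt0 ry (sym0 t))|exact: (mode_plus_gt0 r ry (sym0 t))].
Qed.

(** The frequency [k.+1] is the integer part of [s M / pi], with an error of at most [pi / M] in the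
    angle. [M > pi / s] makes it at least 1, and [s < pi] keeps it below [M]. *)
Lemma theta_dense (s e : R) : 0 < s < pi -> 0 < e ->
  \forall M \near \oo, exists k : 'I_M.-1, `|s - theta R M k.+1| < e.
Proof.
move=> /andP[s0 s_pi] e0; have p0 := pi_gt0 R.
near=> M.
have M1 : pi / s < M%:R by near: M; exact: nbhs_infty_gtr.
have M2 : pi / e < M%:R by near: M; exact: nbhs_infty_gtr.
have M0 : 0 < M%:R :> R by apply: lt_trans M1; rewrite divr_gt0.
pose x := s * M%:R / pi.
have x1 : 1 <= x by rewrite /x ler_pdivlMr// mul1r mulrC -ler_pdivrMr// ltW.
have /andP[nx xn] := truncn_itv (le_trans ler01 x1).
have n0 : (0 < Num.truncn x)%N by rewrite truncn_gt0.
have nM : (Num.truncn x < M)%N.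
  rewrite -(ltr_nat R); apply: le_lt_trans nx _.
  by rewrite /x ltr_pdivrMr// mulrC ltr_pM2l.
have kM : ((Num.truncn x).-1 < M.-1)%N by rewrite -ltnS !prednK// (leq_ltn_trans _ nM).
exists (Ordinal kM); rewrite /= prednK// /theta.
have d : s - pi * (Num.truncn x)%:R / M%:R = (x - (Num.truncn x)%:R) * (pi / M%:R).
  have pn : (pi : R) != 0 by rewrite gt_eqF.
  have Mn : M%:R != 0 :> R by rewrite gt_eqF.
  by rewrite /x; move: (pi : R) pn => p pn; field; rewrite pn Mn.
rewrite d ger0_norm; last by rewrite mulr_ge0 ?subr_ge0// divr_ge0 ?ltW.
apply: (@le_lt_trans _ _ (1 * (pi / M%:R))).
  by rewrite ler_wpM2r ?divr_ge0 ?ltW// ltrBlDr nat1r.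
by rewrite mul1r ltr_pdivrMr// mulrC -ltr_pdivrMr.
Unshelve. all: by end_near. Qed.

End Ratios.

(** * Blow-up of the inverse and kernels for unstable ratios *)

Section UnstableRatios.
Variable R : realType.
Implicit Types (sm sp r ry : R) (k m n M : nat).

Lemma norm_inverse_cvgy sm sp r ry : sm < 0 -> 0 < sp -> 0 < r -> 0 < ry ->
  unstable_ratios (sp / sm) r ry ->
  (fun M => norm_inverse (discrete_space r ry M) (discrete_op sm sp r ry M)) @ \oo --> +oo%E.
Proof.
move=> sm0 sp0 r0 ry0 unst; have smn : sm != 0 by rewrite lt_eqF.
have k0 : sp / sm < 0 by rewrite nmulr_llt0 ?invr_lt0.
(* The bound is raised to a positive one, so that the tolerance [1 / (|sm| B')] for the trace
   multiplier makes sense. *)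
apply/cvgeyPge => B; pose B' := Num.max B 1.
have B'0 : 0 < B' by rewrite lt_max ltr01 orbT.
have nsm : 0 < `|sm| by rewrite normr_gt0.
set s := s_angle (sp / sm) r ry.
pose f t := weighted_mean (sp / sm) (mode_minus ry (symbol t)) (mode_plus r ry (symbol t)).
have fs : f t @[t --> s] --> (0 : R).
  rewrite -(weighted_mean_s_angle k0 ry0 unst).
  exact: continuous_weighted_mean_symbol.
have e0 : 0 < (`|sm| * B')^-1 by rewrite invr_gt0 mulr_gt0.
have /nbhs_ballP[d /= d0 hd] : \forall t \near s, `|f t| < (`|sm| * B')^-1.
  have /cvgr0Pnorm_lt := fs; exact.
near=> M.
have M0 : (0 < M)%N by near: M; exact: nbhs_infty_gt.
have [k sk] : exists k : 'I_M.-1, `|s - theta R M k.+1| < d.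
  by near: M; exact: (theta_dense (s_angle_itv k0 ry0 unst) d0).
apply: (@le_trans _ _ B'%:E); first by rewrite lee_fin le_max lexx.
apply: (norm_inverse_ge r0 ry0 M0 (k := k)); first exact: ltW.
rewrite trace_coefE// normrM -/(f _).
have := hd _ sk => /ltW h.
have -> : `|sm| * `|f (theta R M k.+1)| * B' = `|f (theta R M k.+1)| * (`|sm| * B') by ring.
by rewrite -ler_pdivlMr ?mulr_gt0// mul1r.
Unshelve. all: by end_near. Qed.

(** The equation for the mesh size says that the critical angle is exactly [theta M m]; being below
    [pi] it forces [m < M], so [m] is one of the frequencies and its multiplier vanishes. *)
Lemma nontrivial_kernel_s_angle sm sp r ry m M : sm < 0 -> 0 < sp -> 0 < r -> 0 < ry ->
  unstable_ratios (sp / sm) r ry -> (0 < m)%N -> (0 < M)%N ->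
  hminus ry M = hminus_kernel (sp / sm) r ry m ->
  nontrivial_kernel (discrete_space r ry M) (discrete_op sm sp r ry M).
Proof.
move=> sm0 sp0 r0 ry0 unst m0 M0 hE; have smn : sm != 0 by rewrite lt_eqF.
have k0 : sp / sm < 0 by rewrite nmulr_llt0 ?invr_lt0.
have sE : s_angle (sp / sm) r ry = theta R M m.
  have mn : m%:R != 0 :> R by rewrite pnatr_eq0 -lt0n.
  have ryn : ry != 0 by rewrite gt_eqF.
  have -> : s_angle (sp / sm) r ry = ry * m%:R * hminus_kernel (sp / sm) r ry m.
    by rewrite /hminus_kernel; move: (s_angle _ _ _) => s; field; rewrite ryn mn.
  rewrite -hE /hminus /hy /theta; move: (pi : R) => p.
  by field; rewrite ryn pnatr_eq0 -lt0n M0.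
have /andP[_] := s_angle_itv k0 ry0 unst.
rewrite sE /theta -mulrA gtr_pMr ?pi_gt0// ltr_pdivrMr ?ltr0n// mul1r ltr_nat => mM.
have kM : (m.-1 < M.-1)%N by rewrite -ltnS !prednK.
apply: (nontrivial_kernel_trace r0 ry0 M0 (k := Ordinal kM)).
rewrite trace_coefE//= prednK// -sE.
by rewrite (weighted_mean_s_angle k0 ry0 unst) mulr0.
Qed.

End UnstableRatios.

Theorem theorem3p17 (R : realType) (sm sp r ry : R)
  (hsm : sm < 0) (hsp : 0 < sp) (hr : 0 < r) (hry : 0 < ry) :
  let kappa := sp / sm in
  let S := discrete_space r ry in
  let A := discrete_op sm sp r ry in
  (stable_ratios kappa r ry ->
     forall M : nat, (0 < M)%N ->
       invertible_on (S M) (A M) /\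
       (norm_inverse (S M) (A M) <=
          (1 / (`|sm| * stability_constant kappa r ry))%:E)%E) /\
  (unstable_ratios kappa r ry ->
     [/\ (fun M : nat => norm_inverse (S M) (A M)) @ \oo --> +oo%E,
         (forall m M : nat, (0 < m)%N -> (0 < M)%N ->
            hminus ry M = hminus_kernel kappa r ry m ->
            nontrivial_kernel (S M) (A M)),
         (forall l k : nat, (0 < l)%N -> (0 < k)%N ->
            s_angle kappa r ry = pi * l%:R / k%:R ->
            forall m : nat, (0 < m)%N -> (l %| m)%N ->
              admissible_hy (ry * hminus_kernel kappa r ry m)),
         (exists ry' : R, [/\ 0 < ry', unstable_ratios kappa r ry' &
            exists l k : nat, [/\ (0 < l)%N, (0 < k)%N,
              s_angle kappa r ry' = pi * l%:R / k%:R &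
              forall m : nat, (0 < m)%N -> (k %| m)%N ->
                admissible_hy (ry' * hminus_kernel kappa r ry' m)]]) &
         (exists r' : R, [/\ 0 < r', unstable_ratios kappa r' ry &
            exists l k : nat, [/\ (0 < l)%N, (0 < k)%N,
              s_angle kappa r' ry = pi * l%:R / k%:R &
              forall m : nat, (0 < m)%N -> (k %| m)%N ->
                admissible_hy (ry * hminus_kernel kappa r' ry m)]])]).
Proof.
move=> kappa S A; have k0 : kappa < 0 by rewrite nmulr_llt0 ?invr_lt0.
split=> [st M M0|unst].
  have [c0 csm csp ct] := stability_constantP hsm hsp hr hry st.
  rewrite div1r; exact: (norm_inverse_le hr hry M0 c0 csm csp (ct M)).
split.
- exact: norm_inverse_cvgy.
- by move=> m M m0 M0; exact: nontrivial_kernel_s_angle.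
- move=> l k l0 k0' sE m m0 lm.
  by apply: (s_angle_admissible hry l0 k0' m0 sE); exact: dvdn_mulr.
- have [ry' [ry'0 unst' sE]] := exists_ry_angle k0 hry unst.
  exists ry'; split=> //; exists 1%N, 2%N; split=> // m m0 _.
  by apply: (s_angle_admissible ry'0 _ _ m0 sE) => //; exact: dvd1n.
- have [r' [r'0 unst' [n [n0 sE]]]] := exists_r_angle k0 hr hry unst.
  have l0 : (0 < n ^ 2)%N by rewrite expn_gt0 n0.
  have k0' : (0 < n * n.+1)%N by rewrite muln_gt0 n0.
  (* The fraction [n / (n + 1)] is deliberately left unreduced: for [k %| m] the product [m * k] is
     a multiple of [k^2], which [l = n^2] divides when [k = n (n + 1)], whereas [l = n] and
     [k = n + 1] are coprime. *)
  exists r'; split=> //; exists (n ^ 2)%N, (n * n.+1)%N; split=> // m m0 km.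
  apply: (s_angle_admissible hry l0 k0' m0 sE).
  by apply: dvdn_mul; [exact: dvdn_trans (dvdn_mulr _ (dvdnn n)) km|exact: dvdn_mulr].
Qed.
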